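(* Let $M$ be a finite monoid, let $p>0$ be a prime and let $(F,\mathcal O,k)$ be a $p$-modular system for $M$ such that $F$ contains a primitive $n$-th root of unity, where $n$ is the least common multiple of the periods of elements of $M$. Suppose that $C(FM)$ is nonsingular and that, for every finitely generated projective $\mathcal OM$-module $P$, the ordinary character of $F\otimes_{\mathcal O}P$ is determined by its restriction to the set of $p$-regular elements of $M$ (that is, if $P,P'$ are finitely generated projective $\mathcal OM$-modules and the characters of $F\otimes_{\mathcal O}P$ and $F\otimes_{\mathcal O}P'$ agree on all $p$-regular elements of $M$, then they agree on $M$). Then $C(kM)$ is nonsingular.
   Context: A (complete) $p$-modular system $(F,\mathcal O,k)$ consists of a complete discrete valuation ring $\mathcal O$ of characteristic $0$ with maximal ideal $\mathfrak m$, field of fractions $F$ and residue field $k=\mathcal O/\mathfrak m$ of characteristic $p$. For $m\in M$, let $i\geq0$, $s>0$ be least with $m^i=m^{i+s}$; $s$ is the period of $m$, and $m$ is $p$-regular if $p\nmid s$. The (ordinary) character of a finitely generated $FM$-module $V$ sends $m\in M$ to the trace of the action of $m$ on $V$. The Cartan matrix $C(A)$ of a finite dimensional algebra $A$ has $(i,j)$ entry the multiplicity of $P_i/\mathrm{rad}\,P_i$ as a composition factor of $P_j$, where $P_1,P_2,\ldots$ represent the isomorphism classes of projective indecomposable left $A$-modules. *)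

(* Defs.v *)
From HB Require Import structures.
From mathcomp Require Import all_boot.

(* Declared before fingroup is loaded: HB does not allow this structure to be
   inserted below finStarMonoidType afterwards. *)
#[short(type="finMonoidType")]
HB.structure Definition FinMonoid := {M of Monoid M & Finite M}.

From mathcomp Require Import all_order all_algebra.
From mathcomp Require Import boolp classical_sets.

Set Implicit Arguments.
Unset Strict Implicit.
Unset Printing Implicit Defensive.

Set Warnings "-redundant-canonical-projection".

Import GRing.Theory.
Local Open Scope ring_scope.
Local Open Scope quotient_scope.

Section Period.
Variable M : finMonoidType.
Implicit Type m : M.

Fact power_index_subproof m :
  exists i, `[< exists2 s, (0 < s)%N & (m ^+ i = m ^+ (i + s))%g >].
Proof.
have : ~~ injectiveb (fun i : 'I_#|M|.+1 => (m ^+ i)%g).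
  by apply/negP=> /injectiveP/leq_card; rewrite card_ord ltnn.
case/injectivePn=> i [j neq_ij eq_ij].
wlog lt_ij : i j neq_ij eq_ij / (i < j)%N => [W|].
  have := neq_ij; rewrite -val_eqE neq_ltn => /orP[/(W i j)|/(W j i)].
    exact.
  by rewrite eq_sym; apply.
exists i; apply/asboolP; exists (j - i)%N; first by rewrite subn_gt0.
by rewrite subnKC // ltnW.
Qed.

Definition power_index m : nat := ex_minn (power_index_subproof m).

Fact period_subproof m :
  exists s, (0 < s)%N && (m ^+ power_index m == m ^+ (power_index m + s))%g.
Proof.
rewrite /power_index; case: ex_minnP => i /asboolP[s s_gt0 eq_is] _.
by exists s; rewrite s_gt0; apply/eqP.
Qed.

Definition period m : nat := ex_minn (period_subproof m).

Definition p_regular (p : nat) m : bool := ~~ (p %| period m)%N.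

End Period.

(* A copy of {ffun M -> R}, which may carry the pointwise product. *)
Definition monoid_algebra (R : comNzRingType) (M : finMonoidType) : Type :=
  {ffun M -> R}.

Section MonoidAlgebra.
Variables (R : comNzRingType) (M : finMonoidType).

Local Notation RM := (monoid_algebra R M).

HB.instance Definition _ := GRing.Zmodule.copy RM {ffun M -> R}.

Implicit Types (a b : R) (f g h : RM).

Definition monoid_algebra_scale a f : RM := [ffun m => a * f m].

Fact monoid_algebra_scaleA a b f :
  monoid_algebra_scale a (monoid_algebra_scale b f)
    = monoid_algebra_scale (a * b) f.
Proof. by apply/ffunP=> m; rewrite !ffunE mulrA. Qed.

Fact monoid_algebra_scale1 : left_id 1 monoid_algebra_scale.
Proof. by move=> f; apply/ffunP=> m; rewrite !ffunE mul1r. Qed.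

Fact monoid_algebra_scaleDr : right_distributive monoid_algebra_scale +%R.
Proof. by move=> a f g; apply/ffunP=> m; rewrite !ffunE mulrDr. Qed.

Fact monoid_algebra_scaleDl f :
  {morph monoid_algebra_scale^~ f : a b / a + b}.
Proof. by move=> a b; apply/ffunP=> m; rewrite !ffunE mulrDl. Qed.

HB.instance Definition _ := GRing.Zmodule_isLmodule.Build R RM
  monoid_algebra_scaleA monoid_algebra_scale1
  monoid_algebra_scaleDr monoid_algebra_scaleDl.

Definition monoid_basis (m : M) : RM := [ffun x => (x == m)%:R].

Definition monoid_algebra_mul f g : RM :=
  [ffun m => \sum_x \sum_(y | (x * y)%g == m) f x * g y].

Local Notation mulA := monoid_algebra_mul.

Let mulE f g m :
  mulA f g m = \sum_x \sum_y f x * g y * ((x * y)%g == m)%:R.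
Proof.
rewrite ffunE; apply: eq_bigr => x _; rewrite big_mkcond; apply: eq_bigr => y _.
by case: eqP => _; rewrite ?mulr1 ?mulr0.
Qed.

Fact monoid_algebra_mulA : associative mulA.
Proof.
move=> f g h; apply/ffunP=> m; rewrite !mulE.
transitivity (\sum_x \sum_y \sum_z
    f x * g y * h z * ((x * y * z)%g == m)%:R).
  apply: eq_bigr => x _.
  transitivity (\sum_u \sum_y \sum_z
     f x * g y * h z * ((y * z)%g == u)%:R * ((x * u)%g == m)%:R).
    apply: eq_bigr => u _; rewrite mulE mulr_sumr mulr_suml.
    apply: eq_bigr => y _; rewrite mulr_sumr mulr_suml.
    by apply: eq_bigr => z _; rewrite !mulrA.
  rewrite exchange_big; apply: eq_bigr => y _.
  rewrite exchange_big; apply: eq_bigr => z _.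
  rewrite (bigD1 (y * z)%g) //= eqxx mulr1 mulgA big1 ?addr0 // => u.
  by rewrite eq_sym => /negPf->; rewrite mulr0 mul0r.
apply: esym.
transitivity (\sum_u \sum_z \sum_x \sum_y
   f x * g y * h z * ((x * y)%g == u)%:R * ((u * z)%g == m)%:R).
  apply: eq_bigr => u _; apply: eq_bigr => z _; rewrite mulE !mulr_suml.
  apply: eq_bigr => x _; rewrite !mulr_suml.
  by apply: eq_bigr => y _; congr (_ * _); rewrite mulrAC.
rewrite exchange_big; under eq_bigr do rewrite exchange_big.
rewrite exchange_big; apply: eq_bigr => x _.
under eq_bigr do rewrite exchange_big.
rewrite exchange_big; apply: eq_bigr => y _; apply: eq_bigr => z _.
rewrite (bigD1 (x * y)%g) //= eqxx mulr1 big1 ?addr0 // => u.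
by rewrite eq_sym => /negPf->; rewrite mulr0 mul0r.
Qed.

Fact monoid_algebra_mul1 : left_id (monoid_basis 1%g) mulA.
Proof.
move=> f; apply/ffunP=> m; rewrite mulE (bigD1 1%g) //= [X in _ + X]big1.
  rewrite addr0 (bigD1 m) //= ffunE eqxx mul1g eqxx mul1r mulr1 big1 ?addr0 //.
  by move=> y /negPf y_m; rewrite mul1g y_m mulr0.
by move=> x /negPf x1; rewrite big1 // => y _; rewrite ffunE x1 !mul0r.
Qed.

Fact monoid_algebra_1mul : right_id (monoid_basis 1%g) mulA.
Proof.
move=> f; apply/ffunP=> m; rewrite mulE (bigD1 m) //= [X in _ + X]big1.
  rewrite addr0 (bigD1 1%g) //= ffunE eqxx mulg1 eqxx !mulr1 big1 ?addr0 //.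
  by move=> y /negPf y1; rewrite ffunE y1 mulr0 mul0r.
move=> x /negPf x_m; rewrite big1 // => y _; rewrite ffunE.
case: (y =P 1%g) => [->|_]; last by rewrite mulr0 mul0r.
by rewrite mulg1 x_m mulr0.
Qed.

Fact monoid_algebra_mulDl : left_distributive mulA +%R.
Proof.
move=> f g h; apply/ffunP=> m; rewrite [RHS]ffunE !mulE -big_split.
apply: eq_bigr => x _; rewrite -big_split; apply: eq_bigr => y _ /=.
by rewrite ffunE !mulrDl.
Qed.

Fact monoid_algebra_mulDr : right_distributive mulA +%R.
Proof.
move=> f g h; apply/ffunP=> m; rewrite [RHS]ffunE !mulE -big_split.
apply: eq_bigr => x _; rewrite -big_split; apply: eq_bigr => y _ /=.
by rewrite ffunE mulrDr mulrDl.
Qed.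

Fact monoid_algebra_1neq0 : monoid_basis 1%g != 0 :> RM.
Proof.
by apply/eqP=> /ffunP/(_ 1%g)/eqP; rewrite !ffunE eqxx oner_eq0.
Qed.

HB.instance Definition _ := GRing.Zmodule_isNzRing.Build RM
  monoid_algebra_mulA monoid_algebra_mul1 monoid_algebra_1mul
  monoid_algebra_mulDl monoid_algebra_mulDr monoid_algebra_1neq0.

Fact monoid_algebra_scaleAl a f g : a *: (f * g) = (a *: f) * g.
Proof.
apply/ffunP=> m; rewrite [LHS]ffunE [RHS]mulE.
rewrite [(f * g : RM) m]mulE mulr_sumr; apply: eq_bigr => x _.
rewrite mulr_sumr; apply: eq_bigr => y _.
by rewrite ffunE -!mulrA.
Qed.

HB.instance Definition _ :=
  GRing.Lmodule_isLalgebra.Build R RM monoid_algebra_scaleAl.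

Fact monoid_algebra_scaleAr a f g : a *: (f * g) = f * (a *: g).
Proof.
apply/ffunP=> m; rewrite [LHS]ffunE [RHS]mulE.
rewrite [(f * g : RM) m]mulE mulr_sumr; apply: eq_bigr => x _.
rewrite mulr_sumr; apply: eq_bigr => y _.
by rewrite ffunE [f x * (a * _)]mulrCA -!mulrA.
Qed.

HB.instance Definition _ :=
  GRing.Lalgebra_isAlgebra.Build R RM monoid_algebra_scaleAr.

End MonoidAlgebra.

Definition restrict (R : pzRingType) (A : lalgType R) (V : lmodType A) : Type :=
  V.

Section Restrict.
Variables (R : pzRingType) (A : lalgType R) (V : lmodType A).

HB.instance Definition _ := GRing.Zmodule.copy (restrict V) V.

Definition restrict_scale (a : R) (v : restrict V) : restrict V :=
  (a%:A : A) *: (v : V).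

Fact restrict_scaleA a b v :
  restrict_scale a (restrict_scale b v) = restrict_scale (a * b) v.
Proof. by rewrite /restrict_scale scalerA -scalerAl mul1r scalerA. Qed.

Fact restrict_scale1 : left_id 1 restrict_scale.
Proof. by move=> v; rewrite /restrict_scale !scale1r. Qed.

Fact restrict_scaleDr : right_distributive restrict_scale +%R.
Proof. by move=> a u v; apply: scalerDr. Qed.

Fact restrict_scaleDl v : {morph restrict_scale^~ v : a b / a + b}.
Proof. by move=> a b; rewrite /restrict_scale !scalerDl. Qed.

HB.instance Definition _ := GRing.Zmodule_isLmodule.Build R (restrict V)
  restrict_scaleA restrict_scale1 restrict_scaleDr restrict_scaleDl.

End Restrict.

Section Submodule.
Variables (R : pzRingType) (V : lmodType R) (U : submodClosed V).

Record submodule := Submodule {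
  submodule_val : V;
  submodule_valP : submodule_val \in U
}.

HB.instance Definition _ := [isSub for submodule_val].
HB.instance Definition _ := [Choice of submodule by <:].
HB.instance Definition _ := [SubChoice_isSubLmodule of submodule by <:].

End Submodule.

Section QuotientModule.
Variables (R : pzRingType) (V : lmodType R) (U : submodClosed V).

Definition submod_zmod : {pred V} := U.

Fact submod_zmod_closed : zmod_closed submod_zmod.
Proof. by exact: GRing.submod_closedB (submodClosedP U). Qed.

HB.instance Definition _ := GRing.isZmodClosed.Build V submod_zmod
  submod_zmod_closed.

Definition quotient_module : Type := Quotient.quot submod_zmod.

HB.instance Definition _ := GRing.Zmodule.copy quotient_module
  (Quotient.quot submod_zmod).

Definition quotient_pi (x : V) : quotient_module :=
  \pi_(Quotient.quot submod_zmod) x.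

Definition quotient_scale (a : R) (x : quotient_module) : quotient_module :=
  quotient_pi (a *: repr (x : Quotient.quot submod_zmod)).

Fact quotient_piK (x : quotient_module) :
  quotient_pi (repr (x : Quotient.quot submod_zmod)) = x.
Proof. exact: reprK. Qed.

Fact quotient_piD : {morph quotient_pi : x y / x + y}.
Proof. by move=> x y; apply: raddfD. Qed.

Fact quotient_pi_eq0 x : (quotient_pi x == 0) = (x \in U).
Proof.
rewrite -[x in RHS]subr0 -[RHS]/(x - 0 \in submod_zmod).
by rewrite Quotient.idealrBE; congr (_ == _); rewrite piE.
Qed.

Fact quotient_piZ a x : quotient_pi (a *: x) = quotient_scale a (quotient_pi x).
Proof.
apply/eqP; rewrite /quotient_scale /quotient_pi.
rewrite -Quotient.idealrBE -scalerBr.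
have : x - repr (\pi_(Quotient.quot submod_zmod) x) \in submod_zmod.
  by rewrite Quotient.idealrBE reprK.
exact: (rpredZ a).
Qed.

Fact quotient_scaleA a b x :
  quotient_scale a (quotient_scale b x) = quotient_scale (a * b) x.
Proof. by rewrite -[x]quotient_piK -!quotient_piZ scalerA. Qed.

Fact quotient_scale1 : left_id 1 quotient_scale.
Proof. by move=> x; rewrite -[x]quotient_piK -quotient_piZ scale1r. Qed.

Fact quotient_scaleDr : right_distributive quotient_scale +%R.
Proof.
move=> a x y; rewrite -[x]quotient_piK -[y]quotient_piK.
by rewrite -quotient_piD -!quotient_piZ scalerDr quotient_piD.
Qed.

Fact quotient_scaleDl x : {morph quotient_scale^~ x : a b / a + b}.
Proof.
move=> a b; rewrite -[x]quotient_piK.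
by rewrite -!quotient_piZ scalerDl quotient_piD.
Qed.

HB.instance Definition _ := GRing.Zmodule_isLmodule.Build R quotient_module
  quotient_scaleA quotient_scale1 quotient_scaleDr quotient_scaleDl.

HB.instance Definition _ := GRing.isZmodMorphism.Build V quotient_module
  quotient_pi (fun x y => raddfB _ x y).
HB.instance Definition _ := GRing.isScalable.Build R V quotient_module *:%R
  quotient_pi quotient_piZ.

End QuotientModule.

Section Subquotient.
Variables (R : pzRingType) (V : lmodType R) (W U : submodClosed V).

Definition submodule_restrict : {pred submodule W} :=
  [pred x : submodule W | val x \in U].

Fact submodule_restrict_closed : submod_closed submodule_restrict.
Proof.
split=> [|a x y]; rewrite !inE ?raddf0 ?rpred0 //.
by move=> xU yU; rewrite linearP rpredD ?rpredZ.
Qed.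

HB.instance Definition _ := GRing.isSubmodClosed.Build R (submodule W)
  submodule_restrict (GRing.submod_closed_semi submodule_restrict_closed).

(* W / (U :&: W); it is only used when U is contained in W. *)
Definition subquotient : lmodType R := quotient_module submodule_restrict.

End Subquotient.

Section Modules.
Variable R : pzRingType.
Implicit Types V S P : lmodType R.

Definition isomorphic V S : Prop := exists f : {linear V -> S}, bijective f.

Definition zero_submodule V (U : submodClosed V) : Prop :=
  forall x, x \in U -> x = 0.

Definition full_submodule V (U : submodClosed V) : Prop := forall x, x \in U.

Definition nonzero_module V : Prop := exists x : V, x != 0.

Definition simple_module S : Prop :=
  nonzero_module S /\
  forall U : submodClosed S, zero_submodule U \/ full_submodule U.

Definition indecomposable V : Prop :=
  nonzero_module V /\
  forall U W : submodClosed V,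
    (forall x, x \in U -> x \in W -> x = 0) ->
    (forall x, exists2 u, u \in U & exists2 w, w \in W & x = u + w) ->
    zero_submodule U \/ zero_submodule W.

Definition finitely_generated V : Prop :=
  exists n (x : 'I_n -> V), forall v, exists a : 'I_n -> R,
    v = \sum_i a i *: x i.

Definition projective P : Prop :=
  forall (V W : lmodType R) (f : {linear V -> W}) (g : {linear P -> W}),
    (forall w, exists v, f v = w) ->
    exists h : {linear P -> V}, forall x, f (h x) = g x.

Definition maximal_submodule V (U : submodClosed V) : Prop :=
  ~ full_submodule U /\
  forall W : submodClosed V, {subset U <= W} ->
    {subset W <= U} \/ full_submodule W.

Definition radical V : {pred V} :=
  [pred x | `[< forall U : submodClosed V, maximal_submodule U -> x \in U >]].

Fact radical_closed V : submod_closed (@radical V).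
Proof.
split=> [|a x y]; first by apply/asboolP=> U _; apply: rpred0.
move=> /asboolP Rx /asboolP Ry; apply/asboolP=> U maxU.
by rewrite rpredD ?rpredZ ?Rx ?Ry.
Qed.

HB.instance Definition _ V := GRing.isSubmodClosed.Build R V
  (@radical V) (GRing.submod_closed_semi (@radical_closed V)).

Definition top_module V : lmodType R := quotient_module (@radical V).

Definition composition_series V n (U : nat -> submodClosed V) : Prop :=
  [/\ zero_submodule (U 0%N), full_submodule (U n) &
      forall i, (i < n)%N ->
        {subset U i <= U i.+1} /\ simple_module (subquotient (U i.+1) (U i))].

(* Independent of the composition series by Jordan-Holder; 0 is a dummy value
   for modules without a composition series. *)
Definition multiplicity S V : nat :=
  xget 0%N [set c : nat | exists n (U : nat -> submodClosed V),
    composition_series n U /\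
    c = (\sum_(i < n) `[< isomorphic (subquotient (U i.+1) (U i)) S >])%N]%classic.

(* Over a finite dimensional algebra an indecomposable projective module is
   automatically finitely generated. *)
Definition projective_indecomposable P : Prop :=
  [/\ finitely_generated P, projective P & indecomposable P].

Definition pim_representatives r (P : 'I_r -> lmodType R) : Prop :=
  [/\ forall i, projective_indecomposable (P i),
      forall i j, isomorphic (P i) (P j) -> i = j &
      forall Q : lmodType R, projective_indecomposable Q ->
        exists i, isomorphic Q (P i)].

Definition cartan_matrix r (P : 'I_r -> lmodType R) : 'M[int]_r :=
  \matrix_(i, j) (multiplicity (top_module (P i)) (P j))%:Z.

End Modules.

Section Trace.
Variables (F : fieldType) (W : lmodType F).

Definition is_basis d (e : 'I_d -> W) : Prop :=
  forall w, exists! a : 'rV[F]_d, w = \sum_i a 0 i *: e i.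

(* Independent of the basis; 0 is a dummy value for infinite-dimensional W. *)
Definition trace (f : W -> W) : F :=
  xget 0 [set c | exists d (e : 'I_d -> W) (A : 'M[F]_d),
    [/\ is_basis e, forall j, f (e j) = \sum_i A i j *: e i & c = \tr A]]%classic.

End Trace.

Definition character (F : fieldType) (M : finMonoidType)
    (V : lmodType (monoid_algebra F M)) (m : M) : F :=
  trace (fun v : restrict V => monoid_basis F m *: (v : V)).

(* V, with x |-> 1 (x) x given by j, is the F M-module obtained from the
   O M-module P by extension of scalars along iota: it has the universal
   property of the tensor product F (x)_O P, and M acts on the factor P. *)
Definition is_scalar_extension (O : comNzRingType) (F : fieldType)
    (M : finMonoidType) (iota : {rmorphism O -> F})
    (P : lmodType (monoid_algebra O M)) (V : lmodType (monoid_algebra F M))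
    (j : {linear restrict P -> restrict V | iota \; *:%R}) : Prop :=
  [/\ forall m (x : P), j (monoid_basis O m *: x) = monoid_basis F m *: (j x : V),
      forall (W : lmodType F) (g : {linear restrict P -> W | iota \; *:%R}),
        exists h : {linear restrict V -> W}, forall x, h (j x) = g x &
      forall (W : lmodType F) (h h' : {linear restrict V -> W}),
        (forall x, h (j x) = h' (j x)) -> h =1 h'].

Section ModularSystem.
Variable O : idomainType.

(* The ideals in idealr are proper; the unit ideal is principal anyway. *)
Definition principal_ideals : Prop :=
  forall I : idealr O, exists a, forall x, x \in I <-> exists b, x = b * a.

Definition nonzero_ideal (I : idealr O) : Prop := exists2 x, x \in I & x != 0.

Definition discrete_valuation_ring : Prop :=
  principal_ideals /\
  exists2 I : prime_idealr O, nonzero_ideal I &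
    forall J : prime_idealr O, nonzero_ideal J -> J =i I.

(* The maximal ideal, for O local. *)
Definition maximal_ideal : {pred O} := [pred x | x \isn't a GRing.unit].

Definition ideal_power (I : {pred O}) (n : nat) (x : O) : Prop :=
  exists r (a : 'I_r -> O) (f : 'I_r -> 'I_n -> O),
    (forall i j, f i j \in I) /\ x = \sum_i a i * \prod_j f i j.

Definition adically_complete (I : {pred O}) : Prop :=
  forall u : nat -> O,
    (forall n, exists N, forall i j, (N <= i)%N -> (N <= j)%N ->
       ideal_power I n (u i - u j)) ->
    exists l, forall n, exists N, forall i, (N <= i)%N ->
      ideal_power I n (u i - l).

Record p_modular_system (p : nat) (F k : fieldType)
    (iota : {rmorphism O -> F}) (red : {rmorphism O -> k}) : Prop := {
  pms_dvr : discrete_valuation_ring;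
  pms_complete : adically_complete maximal_ideal;
  pms_char0 : [pchar O] =i pred0;
  pms_iota_inj : injective iota;
  pms_fraction : forall x, exists a b, b != 0 /\ x = iota a / iota b;
  pms_red_surj : forall y, exists x, red x = y;
  pms_red_ker : forall x, (red x == 0) = (x \in maximal_ideal);
  pms_char_p : p \in [pchar k]
}.

End ModularSystem.

(* Main.v *)
Require Import Defs.
From HB Require Import structures.
From mathcomp Require Import all_boot all_order all_algebra.
From mathcomp Require Import cyclic fieldext ring_quotient ring.
From mathcomp Require Import boolp classical_sets.

Set Implicit Arguments.
Unset Strict Implicit.
Unset Printing Implicit Defensive.

Import GRing.Theory.
Local Open Scope ring_scope.

(* For a ring [R] let [Theta(a, b)] be the trace of [x |-> a x b] on [R M].  Up to
   positive row factors (the dimensions [dim e_i (top P_i)]) the Cartan matrix of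
   [k M] is the matrix of the numbers [dim e_i (k M) e_j], where [k M e_i] are the
   projective indecomposables, and likewise for [F M].  Lifting [e_j] to an
   idempotent [e^_j] of [O M] turns [dim f (k M) e_j] into [Theta(f^, e^_j)], which
   is also the value at [f^] of the character of [F M e^_j].

   Let [x] be an integer vector killed by [C(k M)] and [u = sum_j x_j e^_j].  Every
   p-regular element of [M] has, up to a nilpotent summand of [O M], an expansion
   into idempotents of [O M] (the isotypic idempotents of the p'-group which it
   generates), so [Theta(m, u) = 0] for p-regular [m], hence for all [m] by
   hypothesis.  As [C(F M)] is nonsingular, the class of [u] in the Grothendieck
   group of projective [F M]-modules vanishes, so every trace function kills [u]:
   the sums of the coefficients of [u] over the level sets of any function [l] on
   [M] with [l(xy) = l(yx)] vanish, in [F], in [O], and after reduction in [k].  For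
   each [i] there is such an [l], with values in an extension of [k], that vanishes
   on [e_j] for [j <> i] but not on [e_i]; hence [x_i] is divisible by [p].  Since
   the kernel of [C(k M)] is closed under division by [p], descent gives [x = 0]. *)

(** * Finite-dimensional linear algebra *)

(** Neither [F M] nor [k M] is assumed split, and this shapes the proof. A trace in characteristic
    [p] may vanish although the module does not, so what is carried from [k] to [F] is the rank of
    an idempotent operator: it is the same over both fields, and it is recovered from its trace in
    [F] because [F] has characteristic 0. In the other direction, the values of [l] lie in an
    extension of [k] and cannot be moved to [F]; the indicator functions of its level sets are 0-1
    valued and make sense over every ring. The final equation lives in characteristic [p] and
    determines [x] only modulo [p], which is why a descent has to finish the proof. The isotypic
    idempotents of a cyclic group of order [d] involve [1 / d] and a primitive [d]-th root of unity.
    For [d] prime to [p] and dividing a period, [O] contains both. The nilpotent summand is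
    invisible to [Theta] because left and right multiplications commute. Grothendieck groups are
    never built: a homomorphism out of one is replaced by a function of idempotents that is additive
    on orthogonal sums and agrees on [a b] and [b a]. *)

Section IdempotentMatrix.
Variables (K : fieldType) (n : nat) (E : 'M[K]_n).
Hypothesis EE : E *m E = E.

(** With [E = C R], where [C] has a left inverse and [R] can be cancelled on the right,
    [C R C R = C R] leaves [R C = 1]. *)
Lemma row_base_col_base : row_base E *m col_base E = 1%:M.
Proof.
have [Y YC] := row_fullP (col_base_full E).
have := mulmx_base E; move: (row_base_free E).
move: (row_base E) (col_base E) YC => R C YC fR CR.
have RE : R *m E = R.
  transitivity (Y *m (C *m R *m E)); first by rewrite !mulmxA YC mul1mx.
  by rewrite CR EE; have := congr1 (mulmx Y) CR; rewrite mulmxA YC mul1mx => ->.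
by apply: (row_free_inj fR); rewrite mul1mx -mulmxA CR RE.
Qed.

Lemma trace_idempotent_mx : \tr E = (\rank E)%:R.
Proof.
by rewrite -{1}(mulmx_base E) mxtrace_mulC row_base_col_base mxtrace1.
Qed.

End IdempotentMatrix.

Section SubspaceDimension.
Variables (K : fieldType) (W : lmodType K).
Implicit Types (S : W -> Prop).

Definition comb d (b : 'I_d -> W) (a : 'rV[K]_d) : W :=
  \sum_i a 0 i *: b i.

Lemma comb_linear d (b : 'I_d -> W) c a a' :
  comb b (c *: a + a') = c *: comb b a + comb b a'.
Proof.
rewrite /comb scaler_sumr -big_split; apply: eq_bigr => i _ /=.
by rewrite !mxE scalerDl scalerA.
Qed.

HB.instance Definition _ d (b : 'I_d -> W) :=
  GRing.isLinear.Build K 'rV[K]_d W *:%R (comb b) (comb_linear b).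

Lemma comb_delta d (b : 'I_d -> W) i : comb b (delta_mx 0 i) = b i.
Proof.
rewrite /comb (bigD1 i) //= mxE !eqxx scale1r big1 ?addr0 // => j /negPf ji.
by rewrite mxE ji andbF scale0r.
Qed.

Lemma comb_mulmx d m (b : 'I_d -> W) (g : 'I_m -> W) (X : 'M[K]_(d, m)) a :
  (forall i, b i = comb g (row i X)) -> comb b a = comb g (a *m X).
Proof.
move=> bE; rewrite mulmx_sum_row linear_sum; apply: eq_bigr => i _.
by rewrite linearZ /= bE.
Qed.

Lemma comb_rows d m (b : 'I_d -> W) (g : 'I_m -> W) :
  (forall i, exists a, b i = comb g a) ->
  exists X : 'M[K]_(d, m), forall i, b i = comb g (row i X).
Proof.
move=> H; have [f fP] := choice H.
by exists (\matrix_i f i) => i; rewrite rowK.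
Qed.

Definition free_family d (b : 'I_d -> W) : Prop :=
  forall a, comb b a = 0 -> a = 0.

Definition subspace_basis S d (b : 'I_d -> W) : Prop :=
  (forall i, S (b i)) /\ forall w, S w -> exists! a, w = comb b a.

(** A relation, since the modules below are bare [lmodType]s without a chosen basis; existence and
    uniqueness are proved separately. *)
Definition subspace_dim S d : Prop := exists b : 'I_d -> W, subspace_basis S b.

Definition subspace S : Prop :=
  S 0 /\ forall c x y, S x -> S y -> S (c *: x + y).

Lemma subspace_comb S d (b : 'I_d -> W) a :
  subspace S -> (forall i, S (b i)) -> S (comb b a).
Proof.
move=> [S0 SL] Sb; rewrite /comb; elim/big_ind: _ => // [x y Sx Sy|i _].
  by rewrite -[x]scale1r; apply: SL.
by rewrite -[_ *: _]addr0; apply: SL.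
Qed.

Lemma free_basis S d (b : 'I_d -> W) :
  subspace S -> subspace_basis S b -> free_family b.
Proof.
move=> [S0 _] [_ Sb] a b0; have [a' [_ a'P]] := Sb 0 S0.
by rewrite -(a'P _ (esym b0)) (a'P 0) // linear0.
Qed.

(** A row vector in the left kernel of the coordinate matrix [X] is a linear relation among the
    [b i], so [X] has full row rank. *)
Lemma free_leq d m (b : 'I_d -> W) (g : 'I_m -> W) :
  free_family b -> (forall i, exists a, b i = comb g a) -> (d <= m)%N.
Proof.
move=> fb /comb_rows[X bX].
suff /eqP <- : row_free X by apply: rank_leq_col.
rewrite -kermx_eq0; apply/eqP/row_matrixP => i; rewrite row0.
apply: fb; rewrite (comb_mulmx _ bX).
by rewrite -row_mul mulmx_ker row0 linear0.
Qed.

Lemma subspace_dim_uniq S d d' :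
  subspace S -> subspace_dim S d -> subspace_dim S d' -> d = d'.
Proof.
move=> subS [b bP] [b' b'P]; apply/eqP; rewrite eqn_leq.
have span n m (c : 'I_n -> W) (c' : 'I_m -> W) :
    subspace_basis S c -> subspace_basis S c' -> (n <= m)%N.
  move=> cP c'P; apply: (@free_leq _ _ c c'); first exact: free_basis cP.
  by move=> i; have [a [aE _]] := c'P.2 _ (cP.1 i); exists a.
by rewrite (span _ _ b b') // (span _ _ b' b).
Qed.

Definition extend_family d (w : W) (b : 'I_d -> W) (i : 'I_d.+1) : W :=
  if unlift ord0 i is Some j then b j else w.

Lemma comb_extend d w (b : 'I_d -> W) a :
  comb (extend_family w b) a = a 0 0 *: w + comb b (\row_j a 0 (lift ord0 j)).
Proof.
rewrite /comb big_ord_recl /extend_family unlift_none; congr (_ + _).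
by apply: eq_bigr => i _; rewrite liftK mxE.
Qed.

Lemma free_extend d w (b : 'I_d -> W) :
  free_family b -> (forall a, w <> comb b a) ->
  free_family (extend_family w b).
Proof.
move=> fb wb a; rewrite comb_extend => ab0.
have a00 : a 0 0 = 0.
  apply/eqP/negP => /negP a0.
  apply: (wb (- (a 0 0)^-1 *: \row_j a 0 (lift ord0 j))).
  move/eqP: ab0; rewrite addrC addr_eq0 => /eqP abE.
  by rewrite linearZ /= abE scaleNr scalerN opprK scalerA mulVf // scale1r.
move: ab0; rewrite a00 scale0r add0r => /fb /rowP a1.
apply/rowP => i; rewrite mxE; case: (unliftP ord0 i) => [j|] -> //.
by have := a1 j; rewrite !mxE.
Qed.

(** A free family in [S] of maximal length is a basis: a vector outside its span would extend it. *)
Lemma subspace_dim_exists S m (g : 'I_m -> W) :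
  subspace S -> (forall w, exists a, w = comb g a) ->
  exists2 d, (d <= m)%N & subspace_dim S d.
Proof.
move=> subS spang.
pose P d := `[< exists b : 'I_d -> W, free_family b /\ forall i, S (b i) >].
have P0 : exists d, P d.
  exists 0%N; apply/asboolP; exists (fun=> 0); split=> [a _|[]//].
  by apply/rowP => - [].
have Pm d : P d -> (d <= m)%N.
  by case/asboolP=> b [fb _]; apply: (free_leq fb) => i; apply: spang.
case: (ex_maxnP P0 Pm) => d Pd maxd; exists d; first exact: Pm.
case/asboolP: Pd => b [fb Sb]; exists b; split=> // w Sw.
have [[a wE]|nab] := pselect (exists a, w = comb b a).
  exists a; split=> // a' wE'; apply/eqP; rewrite -subr_eq0; apply/eqP/fb.
  by rewrite linearB /= -wE -wE' subrr.
have : P d.+1.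
  apply/asboolP; exists (extend_family w b); split=> [|i].
    by apply: free_extend => // a wE; apply: nab; exists a.
  by rewrite /extend_family; case: unlift.
by move/maxd; rewrite ltnn.
Qed.

Lemma subspace_dim_lt S S' w d d' :
  subspace S -> (forall x, S x -> S' x) -> S' w -> ~ S w ->
  subspace_dim S d -> subspace_dim S' d' -> (d < d')%N.
Proof.
move=> subS SS' S'w Sw [b bP] [b' b'P].
apply: (@free_leq _ _ (extend_family w b) b').
  apply: free_extend; first exact: free_basis bP.
  by move=> a wE; apply: Sw; rewrite wE; apply: subspace_comb bP.1.
move=> i; have S'i : S' (extend_family w b i).
  rewrite /extend_family; case: unlift => [j|] //.
  by apply: SS'; apply: bP.1.
by have [a [aE _]] := b'P.2 _ S'i; exists a.
Qed.

Lemma subspace_dim_ext S S' d :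
  (forall w, S w <-> S' w) -> subspace_dim S d -> subspace_dim S' d.
Proof.
move=> SS' [b [Sb bP]]; exists b; split=> [i|w]; first exact/SS'.
by move/SS'/bP.
Qed.

(* The rows [c (g i)] form an idempotent matrix, and its image is a model
   of [S]. *)
Lemma frame_basis S m (g : 'I_m -> W) (c : {linear W -> 'rV[K]_m}) :
  subspace S -> (forall i, S (g i)) -> (forall w, S w -> w = comb g (c w)) ->
  let E := \matrix_i c (g i) in
  E *m E = E /\
  subspace_basis S (fun s => comb g (row s (row_base E))).
Proof.
move=> subS Sg gc E.
have cE a : c (comb g a) = a *m E.
  rewrite mulmx_sum_row /comb linear_sum; apply: eq_bigr => i _.
  by rewrite linearZ rowK.
have EE : E *m E = E.
  apply/row_matrixP => i; rewrite row_mul rowK -cE -gc //.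
split=> //; set R := row_base E; set C := col_base E.
have RC1 : R *m C = 1%:M by apply: row_base_col_base.
have CR : C *m R = E by apply: mulmx_base.
have RE : R *m E = R by rewrite -[RHS]mul1mx -RC1 -mulmxA CR.
have cwE x : S x -> c x *m E = c x by move=> Sx; rewrite -cE -gc.
have RC : forall a, comb (fun s => comb g (row s R)) a = comb g (a *m R).
  by move=> a; apply: comb_mulmx.
split=> [s|w Sw]; first exact: subspace_comb.
exists (c w *m C); split=> [|a].
  by rewrite RC -mulmxA CR cwE // -gc.
rewrite RC => wE; move: (congr1 c wE); rewrite cE -[_ *m R *m _]mulmxA RE => ->.
by rewrite -mulmxA RC1 mulmx1.
Qed.

Lemma subspace_dim_frame S m (g : 'I_m -> W) (c : {linear W -> 'rV[K]_m}) :
  subspace S -> (forall i, S (g i)) -> (forall w, S w -> w = comb g (c w)) ->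
  subspace_dim S (\rank (\matrix_i c (g i))).
Proof.
move=> subS Sg gc; have [_ bP] := frame_basis subS Sg gc.
by eexists; apply: bP.
Qed.

End SubspaceDimension.

Section Trace.
Variables (F : fieldType) (W : lmodType F) (f : {linear W -> W}).

Lemma linear_comb d (b : 'I_d -> W) a : f (comb b a) = comb (f \o b) a.
Proof.
by rewrite /comb linear_sum; apply: eq_bigr => i _; rewrite linearZ.
Qed.

(** [trace] picks an unspecified basis through [xget], so the content is independence of the basis.
    That definition uses columns of coordinates and [B] uses rows, hence the transposes. *)
Lemma trace_matrix d (e : 'I_d -> W) (B : 'M[F]_d) :
  is_basis e -> (forall j, f (e j) = comb e (row j B)) ->
  trace f = \tr B.
Proof.
move=> eP fe.
have fcomb d' (e' : 'I_d' -> W) (A : 'M[F]_d') j :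
    f (e' j) = \sum_i A i j *: e' i -> f (e' j) = comb e' (row j A^T).
  by move=> ->; apply: eq_bigr => i _; rewrite !mxE.
have comb_inj d' (e' : 'I_d' -> W) a a' :
    is_basis e' -> comb e' a = comb e' a' -> a = a'.
  move=> e'P aa'; have [x [_ xP]] := e'P (comb e' a).
  by rewrite -(xP a) // (xP a').
have span d' (e' : 'I_d' -> W) w : is_basis e' -> exists a, w = comb e' a.
  by move=> e'P; have [a [wE _]] := e'P w; exists a.
(* The default value of [xget] is excluded: [e] with the matrix [B^T] is a witness. *)
rewrite /trace; case: xgetP => [c _ [d' [e' [A [e'P fe' ->]]]]|]; last first.
  case/(_ (\tr B)); exists d, e, B^T; split=> //; last by rewrite mxtrace_tr.
  by move=> j; rewrite fe; apply: eq_bigr => i _; rewrite !mxE.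
have [X XP] : exists X : 'M_(d', d), forall j, e' j = comb e (row j X).
  by apply: comb_rows => j; apply: span.
have [Y YP] : exists Y : 'M_(d, d'), forall j, e j = comb e' (row j Y).
  by apply: comb_rows => j; apply: span.
have inv n n' (u : 'I_n -> W) (u' : 'I_n' -> W) (U : 'M_(n, n')) U' :
    is_basis u -> (forall j, u j = comb u' (row j U)) ->
    (forall j, u' j = comb u (row j U')) -> U *m U' = 1%:M.
  move=> uP UP U'P; apply/row_matrixP => i; apply: (comb_inj _ u) => //.
  rewrite row_mul -(comb_mulmx _ U'P) -UP -[u i in LHS]comb_delta.
  by rewrite row1.
have XB : A^T *m X = X *m B.
  apply/row_matrixP => i; apply: (comb_inj _ e) => //.
  rewrite !row_mul -(comb_mulmx _ XP) -(fcomb _ _ _ _ (fe' i)) XP linear_comb.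
  by rewrite (@comb_mulmx _ _ _ _ _ e B) // => j; apply: fe.
by rewrite -mxtrace_tr -[A^T]mulmx1 -(inv _ _ _ _ _ _ e'P XP YP) mulmxA XB
           mxtrace_mulC mulmxA (inv _ _ _ _ _ _ eP YP XP) mul1mx.
Qed.

(** The family [g] spans but need not be free. As [c] is a section of [comb g], [W] is a direct
    summand of the row space; the matrix is that of [c \o f \o comb g], which is [f] on this summand
    and 0 on the complement [ker (comb g)]. *)
Lemma trace_frame m (g : 'I_m -> W) (c : {linear W -> 'rV[F]_m}) :
  (forall w, w = comb g (c w)) -> trace f = \tr (\matrix_i c (f (g i))).
Proof.
move=> gc; set E := \matrix_i c (g i); set D := \matrix_i _.
have subT : subspace (fun _ : W => True) by [].
have [EE [_ bP]] := frame_basis subT (fun=> I) (fun w _ => gc w).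
rewrite -/E in EE bP.
have RC1 := row_base_col_base EE; have := mulmx_base E.
move: (row_base E) (col_base E) RC1 bP => R C RC1 bP CR.
have gR a : comb (fun s => comb g (row s R)) a = comb g (a *m R).
  exact: comb_mulmx.
have cE a : c (comb g a) = a *m E.
  rewrite mulmx_sum_row /comb linear_sum; apply: eq_bigr => i _.
  by rewrite linearZ rowK.
have cfE a : c (f (comb g a)) = a *m D.
  rewrite mulmx_sum_row /comb !linear_sum; apply: eq_bigr => i _.
  by rewrite !linearZ rowK.
have DE : D *m E = D.
  by apply/row_matrixP => i; rewrite row_mul rowK -cE -gc.
rewrite (@trace_matrix _ (fun s => comb g (row s R)) (R *m D *m C)).
- by rewrite mxtrace_mulC mulmxA CR mxtrace_mulC DE.
- by move=> w; apply: bP.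
move=> j; rewrite gR -row_mul -mulmxA CR -mulmxA DE row_mul -cfE.
exact: gc.
Qed.

End Trace.

(** * Monoid algebras and their idempotents *)

Section MonoidAlgebraTheory.
Variables (R : comNzRingType) (M : finMonoidType).
Local Notation RM := (monoid_algebra R M).
Local Notation basis := (@monoid_basis R M).
Implicit Types (f g a b : RM).

Lemma monoid_algebraD f g m : (f + g) m = f m + g m.
Proof. by rewrite ffunE. Qed.

Lemma monoid_algebraZ (c : R) f m : (c *: f) m = c * f m.
Proof. by rewrite ffunE. Qed.

Lemma monoid_algebra_sum (I : Type) (r : seq I) (P : pred I) (F : I -> RM) m :
  (\sum_(i <- r | P i) F i) m = \sum_(i <- r | P i) F i m.
Proof. by elim/big_rec2: _ => [|i x y _ <-]; rewrite ffunE. Qed.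

Lemma monoid_algebra_expand f : f = \sum_m f m *: basis m.
Proof.
apply/ffunP => m; rewrite monoid_algebra_sum (bigD1 m) //= big1 => [|x].
  by rewrite !ffunE eqxx mulr1 addr0.
by rewrite eq_sym !ffunE => /negPf ->; rewrite mulr0.
Qed.

Lemma monoid_basisM x y :
  basis x * basis y = basis (x * y)%g.
Proof.
apply/ffunP => m; rewrite ffunE (bigD1 x) //= [X in _ + X]big1 ?addr0.
  rewrite big_mkcond (bigD1 y) //= !ffunE !eqxx mulr1 big1 ?addr0.
    by rewrite eq_sym; case: eqP.
  by move=> i /negPf iy; rewrite !ffunE iy mulr0; case: ifP.
by move=> i /negPf ix; rewrite big1 // => j _; rewrite !ffunE ix mul0r.
Qed.

Lemma monoid_basisX x n : basis (x ^+ n)%g = basis x ^+ n.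
Proof.
elim: n => [|n IHn]; first by [].
by rewrite expgS exprS -monoid_basisM IHn.
Qed.

Lemma monoid_algebra_lift_mul (V : lmodType R) (t : M -> V) f g :
  \sum_m (f * g) m *: t m = \sum_x \sum_y (f x * g y) *: t (x * y)%g.
Proof.
under eq_bigr do rewrite ffunE scaler_suml.
rewrite exchange_big; apply: eq_bigr => x _.
under eq_bigr do rewrite big_mkcond scaler_suml.
rewrite exchange_big; apply: eq_bigr => y _ /=.
rewrite (bigD1 (x * y)%g) //= eqxx big1 ?addr0 // => m.
by rewrite eq_sym => /negPf ->; rewrite scale0r.
Qed.

Definition coord_row f : 'rV[R]_#|M| := \row_i f (enum_val i).

Lemma coord_row_linear : linear coord_row.
Proof. by move=> c f g; apply/rowP => i; rewrite !mxE !ffunE. Qed.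

HB.instance Definition _ :=
  GRing.isLinear.Build R RM 'rV[R]_#|M| *:%R coord_row coord_row_linear.

Lemma coord_row_inj : injective coord_row.
Proof.
move=> f g /rowP fg; apply/ffunP => m.
by have := fg (enum_rank m); rewrite !mxE enum_rankK.
Qed.

Lemma sum_enum_val (V : nmodType) (t : M -> V) :
  \sum_(i < #|M|) t (enum_val i) = \sum_m t m.
Proof.
rewrite [RHS](reindex (@enum_val M M)) //.
by apply: onW_bij; apply: enum_val_bij.
Qed.

Lemma coord_row_expand f :
  f = \sum_i coord_row f 0 i *: basis (enum_val i).
Proof.
rewrite {1}[f]monoid_algebra_expand -(sum_enum_val (fun m => f m *: _)).
by apply: eq_bigr => i _; rewrite mxE.
Qed.

Definition operator_mx (phi : RM -> RM) : 'M[R]_#|M| :=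
  \matrix_i coord_row (phi (basis (enum_val i))).

Lemma coord_row_operator (phi : {linear RM -> RM}) f :
  coord_row (phi f) = coord_row f *m operator_mx phi.
Proof.
rewrite mulmx_sum_row {1}[f]coord_row_expand !linear_sum.
by apply: eq_bigr => i _; rewrite !linearZ rowK.
Qed.

Lemma coord_row_basis i : coord_row (basis (enum_val i)) = delta_mx 0 i.
Proof.
by apply/rowP => j; rewrite !mxE ffunE eqxx /= (inj_eq enum_val_inj).
Qed.

Lemma eq_coord_row (X Y : 'M[R]_#|M|) :
  (forall f, coord_row f *m X = coord_row f *m Y) -> X = Y.
Proof.
move=> XY; apply/row_matrixP => i; have := XY (basis (enum_val i)).
by rewrite coord_row_basis -!rowE.
Qed.

(* Matrices act on coordinate rows from the right, so that [lmul_mx] reverses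
   products. *)
Definition lmul_mx a : 'M[R]_#|M| := operator_mx ( *%R a).
Definition rmul_mx b : 'M[R]_#|M| := operator_mx ( *%R^~ b).

Lemma coord_row_lmul a f : coord_row (a * f) = coord_row f *m lmul_mx a.
Proof. exact: (coord_row_operator (GRing.mull_fun a idfun)). Qed.

Lemma coord_row_rmul b f : coord_row (f * b) = coord_row f *m rmul_mx b.
Proof. exact: (coord_row_operator (GRing.mulr_fun b idfun)). Qed.

Lemma lmul_mxM a b : lmul_mx (a * b) = lmul_mx b *m lmul_mx a.
Proof.
by apply: eq_coord_row => f; rewrite mulmxA -!coord_row_lmul mulrA.
Qed.

Lemma rmul_mxM a b : rmul_mx (a * b) = rmul_mx a *m rmul_mx b.
Proof.
by apply: eq_coord_row => f; rewrite mulmxA -!coord_row_rmul mulrA.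
Qed.

Lemma lmul_rmul_mxC a b : lmul_mx a *m rmul_mx b = rmul_mx b *m lmul_mx a.
Proof.
apply: eq_coord_row => f.
by rewrite !mulmxA -coord_row_lmul -!coord_row_rmul -coord_row_lmul mulrA.
Qed.

Lemma lmul_mx_linear : linear lmul_mx.
Proof.
move=> c a b; apply: eq_coord_row => f.
rewrite mulmxDr -scalemxAr -!coord_row_lmul mulrDl -scalerAl.
by rewrite linearD linearZ.
Qed.

Lemma rmul_mx_linear : linear rmul_mx.
Proof.
move=> c a b; apply: eq_coord_row => f.
rewrite mulmxDr -scalemxAr -!coord_row_rmul mulrDr -scalerAr.
by rewrite linearD linearZ.
Qed.

HB.instance Definition _ :=
  GRing.isLinear.Build R RM 'M[R]_#|M| *:%R lmul_mx lmul_mx_linear.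
HB.instance Definition _ :=
  GRing.isLinear.Build R RM 'M[R]_#|M| *:%R rmul_mx rmul_mx_linear.

Lemma lmul_mx1 : lmul_mx 1 = 1%:M.
Proof. by apply: eq_coord_row => f; rewrite -coord_row_lmul mul1r mulmx1. Qed.

Lemma rmul_mx_eq0 a : rmul_mx a = 0 -> a = 0.
Proof.
move=> a0; apply: coord_row_inj; rewrite linear0 -[a]mul1r coord_row_rmul a0.
by rewrite mulmx0.
Qed.

(* [bitrace a b] is the trace of [x |-> a x b]. *)
Definition bitrace a b : R := \tr (lmul_mx a *m rmul_mx b).

Lemma bitraceDl a a' b : bitrace (a + a') b = bitrace a b + bitrace a' b.
Proof. by rewrite /bitrace linearD mulmxDl mxtraceD. Qed.

Lemma bitraceZl c a b : bitrace (c *: a) b = c * bitrace a b.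
Proof. by rewrite /bitrace linearZ -scalemxAl mxtraceZ. Qed.

Lemma bitraceDr a b b' : bitrace a (b + b') = bitrace a b + bitrace a b'.
Proof. by rewrite /bitrace linearD mulmxDr mxtraceD. Qed.

Lemma bitraceMC a b c : bitrace a (b * c) = bitrace a (c * b).
Proof.
rewrite /bitrace !rmul_mxM mulmxA lmul_rmul_mxC -mulmxA mxtrace_mulC.
by rewrite mulmxA.
Qed.

Lemma bitraceE a b :
  bitrace a b = \sum_x (a * basis x * b) x.
Proof.
rewrite /bitrace /mxtrace -(sum_enum_val (fun x => (a * basis x * b) x)).
apply: eq_bigr => i _.
have := coord_row_rmul b (a * basis (enum_val i)).
rewrite [coord_row (a * _)]coord_row_lmul coord_row_basis -mulmxA -rowE => /rowP/(_ i).
by rewrite !mxE.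
Qed.

End MonoidAlgebraTheory.

Definition idempotent (R : pzRingType) (e : R) : Prop := e * e = e.

(** A row lying in both images is fixed by [E] and, being of the form [Y E'], killed by [E]; and
    [E (E + E') = E] puts each image inside that of the sum. *)
Lemma mxrank_orthogonal (K : fieldType) n (E E' : 'M[K]_n) :
  E *m E = E -> E' *m E' = E' -> E *m E' = 0 -> E' *m E = 0 ->
  \rank (E + E')%R = (\rank E + \rank E')%N.
Proof.
move=> EE EE' EE'0 E'E0; apply/eqP; rewrite eqn_leq; apply/andP; split; first exact: mxrank_add.
have cap0 : (E :&: E')%MS = 0.
  have /submxP[X XE] := capmxSl E E'; have /submxP[Y YE'] := capmxSr E E'.
  by rewrite XE -EE mulmxA -XE YE' -mulmxA E'E0 mulmx0.
rewrite -mxrank_sum_cap cap0 mxrank0 addn0.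
apply: mxrankS; rewrite addsmx_sub; apply/andP; split; apply/submxP.
  by exists E; rewrite mulmxDr EE EE'0 addr0.
by exists E'; rewrite mulmxDr EE' E'E0 add0r.
Qed.

Section Idempotents.
Variables (K : fieldType) (M : finMonoidType).
Local Notation A := (monoid_algebra K M).
Implicit Types (e f g h x : A).

Definition primitive e : Prop :=
  [/\ idempotent e, e <> 0 &
      forall f, idempotent f -> e * f = f -> f * e = f -> f = 0 \/ f = e].

(** The first [#|M| + 1] powers of [x] are linearly dependent. Solving such a relation for its
    lowest term expresses [x ^+ n] by higher powers, and [c] is a polynomial in [x]. *)
Lemma power_dependency x :
  exists n c, GRing.comm x c /\ x ^+ n = x ^+ n.+1 * c.
Proof.
pose X : 'M[K]_(#|M|.+1, #|M|) := \matrix_i coord_row (x ^+ i).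
have [a a0 aX] : exists2 a : 'rV_#|M|.+1, a != 0 & a *m X = 0.
  have : kermx X != 0.
    by rewrite kermx_eq0 /row_free neq_ltn ltnS rank_leq_col.
  case/rowV0Pn => a aX a0; exists a => //; exact/sub_kermxP.
have {aX} ax : \sum_i a 0 i *: x ^+ i = 0.
  apply: coord_row_inj; rewrite linear0 -aX mulmx_sum_row linear_sum.
  by apply: eq_bigr => i _; rewrite linearZ rowK.
have [i0 ai0] : exists i, a 0 i != 0.
  apply/existsP; apply: contra_neqT a0 => /existsPn a0.
  by apply/rowP => i; rewrite mxE; apply/eqP; have := a0 i; rewrite negbK.
case: (@arg_minnP _ i0 (fun i => a 0 i != 0) (fun i => i : nat) ai0) => i ai imin.
pose c := \sum_(j < #|M|.+1 | (i < j)%N) (- (a 0 j / a 0 i)) *: x ^+ (j - i.+1).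
exists i, c; split.
  by apply: commr_sum => j _; rewrite /GRing.comm -scalerAl -scalerAr -exprSr -exprS.
have := ax; rewrite (bigD1 i) //= => /eqP; rewrite addr_eq0 => /eqP axi.
transitivity ((a 0 i)^-1 *: (a 0 i *: x ^+ i)).
  by rewrite scalerA mulVf // scale1r.
rewrite axi /c mulr_sumr scalerN scaler_sumr -sumrN.
rewrite (bigID (fun j : 'I_#|M|.+1 => (i < j)%N)) /= [X in _ + X]big1 ?addr0.
  apply: eq_big => [j|j /andP[_ ij]].
    by case: ltngtP => //= ij; [rewrite -val_eqE /= gtn_eqF|
      rewrite -val_eqE /= ltn_eqF|rewrite -val_eqE /= ij eqxx].
  by rewrite -scalerAr -exprD subnKC // scaleNr scalerA [_ / _]mulrC.
move=> j /andP[ji]; rewrite -leqNgt => le_ji.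
suff -> : a 0 j = 0 by rewrite scale0r scaler0 oppr0.
apply/eqP/negP => /negP/imin le_ij.
by move: ji; rewrite -val_eqE /= eqn_leq le_ij le_ji.
Qed.

(** Fitting's argument: from [x ^+ n = x ^+ (n + n) * c ^+ n] the element [f = x ^+ n * c ^+ n] is
    an idempotent below [e]. If [f = 0] then [x] is nilpotent, and if [f = e] then [x] is invertible
    in the corner. *)
Lemma corner_local e x : primitive e -> e * x = x -> x * e = x ->
  (exists n, x ^+ n = 0) \/
  exists z, [/\ e * z = z, z * e = z, z * x = e & x * z = e].
Proof.
move=> [ee _ eprim] ex xe; have [n0 [c [xc xn]]] := power_dependency x.
(* The exponent must be positive: [x ^+ 0] is the unit of the algebra and not [e]. *)
pose n := n0.+1; have {}xn : x ^+ n = x ^+ n.+1 * c.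
  by rewrite /n exprS xn mulrA -exprS.
have xnk k : x ^+ n = x ^+ (n + k) * c ^+ k.
  elim: k => [|k IHk]; first by rewrite addn0 mulr1.
  rewrite {1}IHk.
  have -> : x ^+ (n + k) = x ^+ (n + k.+1) * c.
    by rewrite addnC exprD {1}xn mulrA -exprD addnS -addSnnS addnC.
  by rewrite -mulrA -exprS.
have com i j : x ^+ i * c ^+ j = c ^+ j * x ^+ i by apply/commrX/commr_sym/commrX/commr_sym.
pose f := x ^+ n * c ^+ n.
have yf : x ^+ n = x ^+ n * f by rewrite mulrA -exprD -xnk.
have exn : e * x ^+ n = x ^+ n by rewrite exprS mulrA ex.
have xne : x ^+ n * e = x ^+ n by rewrite exprSr -mulrA xe.
have ef : e * f = f by rewrite mulrA exn.
have fe : f * e = f by rewrite /f com -mulrA xne.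
have ff : idempotent f.
  by rewrite /idempotent {1}/f com -mulrA -yf -com.
case: (eprim f ff ef fe) => fE; first by left; exists n; rewrite yf fE mulr0.
(* As [e = f = x * x ^+ n0 * c ^+ n], the cofactor of [x] cut down to the corner is its inverse. *)
right; exists (e * (x ^+ n0 * c ^+ n) * e); split.
- by rewrite !mulrA ee.
- by rewrite -!mulrA ee.
- have cx : c ^+ n * x = x * c ^+ n by have := com 1 n; rewrite expr1.
  by rewrite -!mulrA ex cx [x ^+ n0 * _]mulrA -exprSr -/f ef.
by rewrite !mulrA xe -exprS -/f fE.
Qed.

(** Half of what makes [Phi] a homomorphism on the Grothendieck group of projectives; invariance
    under [a b |-> b a] is asked for separately. *)
Definition additive_on_idempotents (G : zmodType) (Phi : A -> G) : Prop :=
  forall g h, idempotent g -> idempotent h -> g * h = 0 -> h * g = 0 ->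
    Phi (g + h) = Phi g + Phi h.

(** Induction on the dimension of [A f], the rank of right multiplication by [f]. An idempotent that
    is not primitive splits as [u + (f - u)] with orthogonal nonzero terms, whose ranks add up. *)
Lemma idempotent_decomposition f : idempotent f ->
  exists s : seq A, (forall g, g \in s -> primitive g) /\
    forall (G : zmodType) (Phi : A -> G), additive_on_idempotents Phi ->
      Phi f = \sum_(g <- s) Phi g.
Proof.
have [r] := ubnP (\rank (rmul_mx f)); elim: r f => // r IHr f /ltnSE le_fr ff.
have [->|f0] := eqVneq f 0.
  exists [::]; split=> // G Phi PhiD; rewrite big_nil.
  have := PhiD 0 0; rewrite /idempotent !mulr0 addr0 => /(_ erefl erefl erefl erefl).
  by move/eqP; rewrite -subr_eq0 opprD addrA subrr add0r oppr_eq0 => /eqP.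
have [fprim|fnprim] := pselect (primitive f).
  exists [:: f]; split=> [g|G Phi _]; last by rewrite big_seq1.
  by rewrite inE => /eqP ->.
have [u [uu fu uf u0 uNf]] :
    exists u, [/\ idempotent u, f * u = u, u * f = u, u <> 0 & u <> f].
  apply: contrapT => nu; apply: fnprim; split=> // [|u uu fu uf]; first exact/eqP.
  by apply: contrapT => /not_orP[u0 uNf]; apply: nu; exists u.
pose v := f - u.
have vv : idempotent v.
  by rewrite /idempotent mulrBl !mulrBr ff fu uf uu subrr subr0.
have uv : u * v = 0 by rewrite mulrBr uf uu subrr.
have vu : v * u = 0 by rewrite mulrBl fu uu subrr.
have fE : f = u + v by rewrite addrC subrK.
have rk : \rank (rmul_mx f) = (\rank (rmul_mx u) + \rank (rmul_mx v))%N.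
  rewrite fE linearD mxrank_orthogonal // -rmul_mxM ?uu ?vv //.
    by rewrite uv linear0.
  by rewrite vu linear0.
have rk_gt0 (w : A) : w <> 0 -> (0 < \rank (rmul_mx w))%N.
  move=> w0; rewrite lt0n mxrank_eq0; apply/eqP => /rmul_mx_eq0; exact: w0.
have v0 : v <> 0 by move/eqP; rewrite subr_eq0 eq_sym => /eqP.
have [|s [sP sE]] := IHr u _ uu.
  by apply: leq_trans le_fr; rewrite rk -addn1 leq_add2l rk_gt0.
have [|t [tP tE]] := IHr v _ vv.
  by apply: leq_trans le_fr; rewrite rk -add1n leq_add2r rk_gt0.
exists (s ++ t); split=> [g|G Phi PhiD].
  by rewrite mem_cat => /orP[/sP|/tP].
by rewrite big_cat /= -(sE G Phi) // -(tE G Phi) // -PhiD // -fE.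
Qed.

End Idempotents.

(** * Projective indecomposable modules *)

Section SubmoduleOf.
Variables (R : pzRingType) (V : lmodType R) (P : V -> Prop).
Hypothesis P0 : P 0.
Hypothesis PL : forall a x y, P x -> P y -> P (a *: x + y).

Definition prop_pred : {pred V} := [pred x | `[< P x >]].

Fact prop_pred_closed : submod_closed prop_pred.
Proof.
split=> [|a x y /asboolP Px /asboolP Py]; first exact/asboolP.
by apply/asboolP/PL.
Qed.

Definition submodule_of : submodClosed V :=
  HB.pack prop_pred (GRing.isSubmodClosed.Build R V prop_pred
    (GRing.submod_closed_semi prop_pred_closed)).

Lemma submodule_ofP x : reflect (P x) (x \in submodule_of).
Proof. exact: asboolP. Qed.

End SubmoduleOf.

Section Modules.
Variables (K : fieldType) (M : finMonoidType).
Local Notation A := (monoid_algebra K M).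
Implicit Types (V P S : lmodType A) (e f : A).

Definition action V (v : V) (a : A^o) : V := (a : A) *: v.

Fact action_linear V (v : V) : linear (action v).
Proof. by move=> a x y; rewrite /action scalerDl scalerA. Qed.

HB.instance Definition _ V (v : V) :=
  GRing.isLinear.Build A A^o V *:%R (action v) (action_linear v).

(** This is [A e] when [e] is idempotent; the equation gives a boolean membership test. *)
Definition left_ideal e : {pred A^o} := [pred x | (x : A) * e == x].

Fact left_ideal_closed e : submod_closed (left_ideal e).
Proof.
split=> [|a x y]; rewrite !inE; first by rewrite mul0r.
by move=> /eqP xe /eqP ye; rewrite mulrDl -mulrA xe ye.
Qed.

HB.instance Definition _ e := GRing.isSubmodClosed.Build A A^o
  (left_ideal e) (GRing.submod_closed_semi (@left_ideal_closed e)).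

Definition finite_dimensional V : Prop :=
  exists m (g : 'I_m -> restrict V), forall w, exists a, w = comb g a.

Lemma comb_enum (W : lmodType K) (T : finType) (g : T -> W) (a : T -> K) :
  \sum_t a t *: g t
    = comb (fun i : 'I_#|T| => g (enum_val i)) (\row_i a (enum_val i)).
Proof.
rewrite (reindex (@enum_val T T)); last exact/onW_bij/enum_val_bij.
by apply: eq_bigr => i _; rewrite mxE.
Qed.

Lemma action_expand V (a : A) (v : V) :
  a *: v = \sum_m a m *: (monoid_basis K m *: v : restrict V) :> restrict V.
Proof.
rewrite {1}[a]monoid_algebra_expand scaler_suml; apply: eq_bigr => m _.
by rewrite -[a m *: _]mulr_algl -scalerA.
Qed.

Lemma finitely_generated_dim V : finitely_generated V -> finite_dimensional V.
Proof.
move=> [n [x xP]].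
pose g (t : 'I_n * M) : restrict V := monoid_basis K t.2 *: x t.1.
exists #|{: 'I_n * M}|, (fun i => g (enum_val i)) => w.
have [a wE] := xP w; exists (\row_i (a (enum_val i).1 (enum_val i).2)).
rewrite -(comb_enum g (fun t => a t.1 t.2)) wE.
rewrite -(pair_bigA _ (fun i m => a i m *: g (i, m))) /=.
by apply: eq_bigr => i _; rewrite action_expand.
Qed.

Lemma restrict_subspace V (U : submodClosed V) :
  subspace (fun v : restrict V => (v : V) \in U).
Proof.
split=> [|c x y xU yU]; first exact: (rpred0 U).
by rewrite rpredD //; apply: (rpredZ (c%:A : A)).
Qed.

Lemma submodule_dim V (U : submodClosed V) : finite_dimensional V ->
  exists d, subspace_dim (fun v : restrict V => (v : V) \in U) d.
Proof.
move=> [m [g gP]].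
by have [d _] := subspace_dim_exists (restrict_subspace U) gP; exists d.
Qed.

Lemma submodule_dim_le V : finite_dimensional V ->
  exists m, forall (U : submodClosed V) d,
    subspace_dim (fun v : restrict V => (v : V) \in U) d -> (d <= m)%N.
Proof.
move=> [m [g gP]]; exists m => U d dU.
have [d' d'm d'U] := subspace_dim_exists (restrict_subspace U) gP.
by rewrite (subspace_dim_uniq (restrict_subspace U) dU d'U).
Qed.

Definition zero_sub V : submodClosed V :=
  @submodule_of A V (fun x => x = 0) erefl
    (fun a x y x0 y0 => etrans (congr2 (fun x y => a *: x + y) x0 y0)
       (etrans (addr0 _) (scaler0 _ a))).

Lemma zero_subP V x : reflect (x = 0) (x \in @zero_sub V).
Proof. exact: submodule_ofP. Qed.

Lemma maximal_submodule_exists V :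
  finite_dimensional V -> nonzero_module V ->
  exists U : submodClosed V, maximal_submodule U.
Proof.
move=> fV [v v0]; have [m mP] := submodule_dim_le fV.
pose dimU (U : submodClosed V) :=
  subspace_dim (fun v : restrict V => (v : V) \in U).
pose Q d := `[< exists2 U, ~ full_submodule U & dimU U d >].
have Q0 : exists d, Q d.
  have [d dP] := submodule_dim (zero_sub V) fV; exists d; apply/asboolP.
  by exists (zero_sub V) => // /(_ v)/zero_subP/eqP; rewrite (negPf v0).
have Qm d : Q d -> (d <= m)%N by case/asboolP=> U _ /mP.
case: (ex_maxnP Q0 Qm) => d /asboolP[U Unf dU] dmax; exists U; split=> // W UW.
have [Wf|Wnf] := pselect (full_submodule W); [by right|left=> x xW].
apply: contrapT => xU; have [d' dW] := submodule_dim W fV.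
have : Q d' by apply/asboolP; exists W.
move/dmax; rewrite leqNgt => /negP; apply.
by apply: (subspace_dim_lt (restrict_subspace U) UW xW _ dU dW).
Qed.

(** An explicit isomorphism of [P] with [A e]: [kappa] has values in [A e], and [a |-> a *: g] is
    its inverse there. *)
Definition generated_by P e (g : P) (kappa : {linear P -> A^o}) : Prop :=
  [/\ forall x, (kappa x : A) * e = kappa x, forall x, (kappa x : A) *: g = x
    & kappa g = e].

End Modules.

Section ProjectiveIndecomposables.
Variables (K : fieldType) (M : finMonoidType).
Local Notation A := (monoid_algebra K M).
Implicit Types (V P S : lmodType A) (e f : A).

Lemma quotient_pi_scale V (U : submodClosed V) (a : A) x :
  quotient_pi U (a *: x) = a *: quotient_pi U x.
Proof. exact: linearZ. Qed.

Lemma quotient_pi_sub V (U : submodClosed V) x y :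
  quotient_pi U (x - y) = quotient_pi U x - quotient_pi U y.
Proof. exact: linearB. Qed.

Lemma generated_idempotent P e g (kappa : {linear P -> A^o}) :
  generated_by e g kappa -> idempotent e /\ e *: g = g.
Proof.
move=> [ke kg eE]; split; first by have := ke g; rewrite eE.
by rewrite -eE kg.
Qed.

(** Fixing a nonzero vector rules out the nilpotent case of [corner_local]. *)
Lemma corner_unit V (v : V) e x : primitive e -> e * x = x -> x * e = x ->
  x *: v = v -> v <> 0 ->
  exists z, [/\ e * z = z, z * e = z, z * x = e & x * z = e].
Proof.
move=> eprim ex xe xv v0; have [[n xn]|//] := corner_local eprim ex xe.
suff xnv : x ^+ n *: v = v by case: v0; rewrite -xnv xn scale0r.
elim: n {xn} => [|n IHn]; first by rewrite scale1r.
by rewrite exprSr -scalerA xv.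
Qed.

(** Since 1 is a sum of primitive idempotents, some primitive [f] moves [x0] outside the maximal
    submodule [U]. Then [A f] maps onto [P / U], and projectivity of [P] lifts the projection
    [P -> P / U] to [A f]; the lift turns out to be an isomorphism. *)
Lemma pim_generator P : projective_indecomposable P ->
  exists e (g : P) (kappa : {linear P -> A^o}),
    primitive e /\ generated_by e g kappa.
Proof.
move=> [fgP projP [nzP indP]].
have [U [Unf Umax]] := maximal_submodule_exists (finitely_generated_dim fgP) nzP.
have /existsNP[x0 /negP x0U] := Unf.
have [s [sprim sE]] := @idempotent_decomposition K M 1 (mulr1 _).
have [f fprim fx0] : exists2 f, primitive f & f *: x0 \notin U.
  apply: contrapT => nf; case/negP: x0U.
  have -> : x0 = \sum_(f <- s) f *: x0.
    by rewrite -scaler_suml -(sE A id) ?scale1r.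
  rewrite big_seq; apply: rpred_sum => f fs.
  by apply: contrapT => /negP fx0; apply: nf; exists f => //; apply: sprim.
have [ff fn0 _] := fprim.
pose L := submodule (left_ideal f).
pose alpha : {linear L -> quotient_module U} :=
  action (quotient_pi U (f *: x0)) \o val.
(* [U] is maximal and misses [f *: x0], so [U] and the multiples of [f *: x0] together exhaust
   [P]. *)
have alpha_surj w : exists a, alpha a = w.
  pose Q y := exists a : A, y - a *: (f *: x0) \in U.
  have Q0 : Q 0 by exists 0; rewrite scale0r subr0 rpred0.
  have QL a x y : Q x -> Q y -> Q (a *: x + y).
    move=> [b xb] [c yc]; exists (a * b + c).
    rewrite scalerDl opprD addrACA -scalerA -scalerBr.
    by rewrite rpredD // rpredZ.
  have UQ : {subset U <= submodule_of Q0 QL}.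
    by move=> y yU; apply/submodule_ofP; exists 0; rewrite scale0r subr0.
  have [QU|Qf] := Umax _ UQ.
    case/negP: fx0; apply: QU; apply/submodule_ofP; exists 1.
    by rewrite scale1r subrr rpred0.
  have /submodule_ofP[a wa] := Qf (repr (w : Quotient.quot (submod_zmod U))).
  have afP : (a * f : A^o) \in left_ideal f by rewrite inE -mulrA ff.
  exists (Submodule afP); rewrite /alpha /= /action -quotient_pi_scale.
  rewrite -scalerA (scalerA f f) ff -[RHS]quotient_piK.
  apply/eqP; rewrite eq_sym -subr_eq0 -quotient_pi_sub quotient_pi_eq0.
  exact: wa.
have [h hE] := projP _ _ alpha (quotient_pi U) alpha_surj.
pose kappa : {linear P -> A^o} := val \o h.
have kZ a x : kappa (a *: x) = a * (kappa x : A) by exact: linearZ.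
have kf x : (kappa x : A) * f = kappa x.
  by have := valP (h x); rewrite inE => /eqP.
pose y : A := kappa (f *: x0).
have fy : f * y = y by rewrite /y -kZ scalerA ff.
have yf : y * f = y by exact: kf.
(* [alpha \o h] is the projection, and [alpha] acts on the class of [f *: x0]; hence [y] fixes this
   nonzero class and is invertible in the corner of [f]. *)
have yv : y *: quotient_pi U (f *: x0) = quotient_pi U (f *: x0).
  exact: hE.
have v0 : quotient_pi U (f *: x0) <> 0.
  by apply/eqP; rewrite quotient_pi_eq0.
have [z [fz zf zy yz]] := corner_unit fprim fy yf yv v0.
pose g := z *: (f *: x0).
have hg : kappa g = f by rewrite kZ.
exists f, g, kappa; split=> //; split=> //.
pose Z x := kappa x = 0.
have Z0 : Z 0 by rewrite /Z linear0.
have ZL a u v : Z u -> Z v -> Z (a *: u + v).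
  by rewrite /Z linearP => -> ->; rewrite scaler0 addr0.
pose G x := exists a : A, x = a *: g.
have G0 : G 0 by exists 0; rewrite scale0r.
have GL a u v : G u -> G v -> G (a *: u + v).
  by move=> [b ->] [c ->]; exists (a * b + c); rewrite scalerDl scalerA.
have fg : f *: g = g by rewrite /g scalerA fz.
have kg a : kappa (a *: g) = a * f by rewrite kZ hg.
have decomp x : kappa (x - (kappa x : A) *: g) = 0.
  by rewrite linearB kg kf subrr.
(* [P] is the direct sum of [ker kappa] and [A g]; the second is nonzero because [kappa g = f], so
   the first vanishes. *)
have [||Zz|Gz] := indP (submodule_of Z0 ZL) (submodule_of G0 GL).
- move=> x /submodule_ofP Zx /submodule_ofP[a xE].
  by move: Zx; rewrite /Z xE kg -[in X in _ -> X]fg scalerA => ->; rewrite scale0r.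
- move=> x; exists (x - (kappa x : A) *: g); first exact/submodule_ofP.
  exists ((kappa x : A) *: g); last by rewrite subrK.
  by apply/submodule_ofP; exists (kappa x).
- move=> x; apply/esym/eqP; rewrite -subr_eq0; apply/eqP/Zz.
  exact/submodule_ofP.
case: fn0; rewrite -hg (Gz g) ?linear0 //.
by apply/submodule_ofP; exists 1; rewrite scale1r.
Qed.

End ProjectiveIndecomposables.

Section IdempotentClasses.
Variables (K : fieldType) (M : finMonoidType).
Local Notation A := (monoid_algebra K M).
Implicit Types (V P S : lmodType A) (e f : A).

Lemma submodule_sub V (U : submodClosed V) x y :
  x \in U -> y \in U -> x - y \in U.
Proof. by move=> xU yU; apply: (GRing.submod_closedB (submodClosedP U)).2. Qed.

Lemma left_ideal_valZ f (c : A) (x : submodule (left_ideal f)) :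
  val (c *: x) = c * (val x : A).
Proof. exact: linearZ. Qed.

(** A decomposition [U + W] of [A f] splits the generator as [f = a + b]. Here [a *: w = u - a *: u]
    lies in both summands, so [a b = 0], likewise [b a = 0], and [a] is an idempotent below [f]. *)
Lemma primitive_pim f : primitive f ->
  projective_indecomposable (submodule (left_ideal f)).
Proof.
move=> [ff fn0 fprim]; pose L := submodule (left_ideal f).
have fL : (f : A^o) \in left_ideal f by rewrite inE; apply/eqP.
pose g : L := Submodule fL.
have Lf (x : L) : (val x : A) * f = val x.
  by have := valP x; rewrite inE => /eqP.
have Lg (x : L) : x = (val x : A) *: g.
  by apply: val_inj; rewrite linearZ /= -[RHS]/((val x : A) * f) Lf.
split.
- exists 1%N, (fun=> g) => v; exists (fun=> val v).
  by rewrite big_ord1 -Lg.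
- move=> V W p q psurj; have [v pv] := psurj (q g).
  exists (action v \o val) => x /=.
  by rewrite /action linearZ pv [in RHS](Lg x) [RHS]linearZ.
split; first by exists g; apply/eqP => /(congr1 val).
move=> U W UW0 UWf; have [u uU [w wW gE]] := UWf g.
pose a : A := val u; pose b : A := val w.
have fE : f = a + b.
  by rewrite -[f]/(val g) gE linearD.
have vZ (c : A) (x : L) : val (c *: x) = c * (val x : A).
  exact: left_ideal_valZ.
have valB (x y : L) : val (x - y) = (val x : A) - (val y : A).
  exact: linearB.
have af : a * f = a by apply: Lf.
have bf : b * f = b by apply: Lf.
have abu : a *: w = 0.
  apply: UW0; last exact: rpredZ.
  have -> : a *: w = u - a *: u; last by apply: submodule_sub => //; apply: rpredZ.
  apply: val_inj; rewrite valB !vZ -/a -/b; apply/eqP.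
  by rewrite eq_sym subr_eq addrC -mulrDr -fE af.
have bau : b *: u = 0.
  apply: UW0; first exact: rpredZ.
  have -> : b *: u = w - b *: w; last by apply: submodule_sub => //; apply: rpredZ.
  apply: val_inj; rewrite valB !vZ -/a -/b; apply/eqP.
  by rewrite eq_sym subr_eq -mulrDr -fE bf.
have ab : a * b = 0 by have := congr1 val abu; rewrite vZ.
have ba : b * a = 0 by have := congr1 val bau; rewrite vZ.
have aa : idempotent a by rewrite /idempotent -{3}af fE mulrDr ab addr0.
have fa : f * a = a by rewrite fE mulrDl ba addr0.
have [a0|aE] := fprim a aa fa af; [left|right] => x xU; apply: UW0 => //.
  have -> : x = (val x : A) *: w; last exact: rpredZ.
  have fb : f = b by rewrite fE a0 add0r.
  apply: val_inj; rewrite vZ -/b; apply: etrans (esym (Lf x)) _.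
  exact: (congr1 (fun c => (val x : A) * c) fb).
have -> : x = (val x : A) *: u; last exact: rpredZ.
by apply: val_inj; rewrite vZ -/a aE Lf.
Qed.

(** Homomorphisms between [A f] and [A e] are right multiplications by elements of [f A e] and
    [e A f]; [a] and [b] are the images of the generators under the two inverse isomorphisms. *)
Lemma generated_conjugate P e g (kappa : {linear P -> A^o}) f :
  generated_by e g kappa -> primitive f ->
  isomorphic (submodule (left_ideal f)) P ->
  exists a b : A, a * b = f /\ b * a = e.
Proof.
move=> gP [ff _ _] [phi [psi phiK psiK]].
have [ee eg] := generated_idempotent gP; have [ke kg eE] := gP.
have fL : (f : A^o) \in left_ideal f by rewrite inE; apply/eqP.
pose g' : submodule (left_ideal f) := Submodule fL.
have vZ (c : A) (x : submodule (left_ideal f)) : val (c *: x) = c * (val x : A).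
  exact: left_ideal_valZ.
pose a : A := kappa (phi g'); pose b : A := val (psi g).
have bf : b * f = b by have := valP (psi g); rewrite inE => /eqP.
have psiZ (c : A) x : psi (c *: x) = c *: psi x.
  by apply: (can_inj phiK); rewrite linearZ /= !psiK.
have psigE : psi g = b *: g' by apply: val_inj; rewrite vZ bf.
exists a, b; split.
  by rewrite /b -vZ -psiZ kg phiK.
have : b *: (a *: g) = g by rewrite kg -linearZ -psigE psiK.
move/(congr1 kappa); rewrite scalerA linearZ eE /= => <-.
by rewrite -[RHS]/(b * a * e) -mulrA ke.
Qed.

Section Representatives.
Variables (r : nat) (P : 'I_r -> lmodType A) (e : 'I_r -> A).
Hypothesis P_pim : pim_representatives P.
Hypothesis eP : forall i, exists (g : P i) (kappa : {linear P i -> A^o}),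
  primitive (e i) /\ generated_by (e i) g kappa.

(* The class of [A f] in the Grothendieck group of projective modules is
   [\sum_i n i * [A e_i]]. *)
Lemma idempotent_class f : idempotent f ->
  exists n : 'I_r -> nat, forall (G : zmodType) (Phi : A -> G),
    additive_on_idempotents Phi ->
    (forall a b, idempotent (a * b) -> idempotent (b * a) ->
       Phi (a * b) = Phi (b * a)) ->
    Phi f = \sum_i Phi (e i) *+ n i.
Proof.
move=> /idempotent_decomposition[s [sprim sE]].
suff [n nE] : exists n : 'I_r -> nat, forall (G : zmodType) (Phi : A -> G),
    (forall a b, idempotent (a * b) -> idempotent (b * a) ->
       Phi (a * b) = Phi (b * a)) ->
    \sum_(g <- s) Phi g = \sum_i Phi (e i) *+ n i.
  by exists n => G Phi PhiD PhiC; rewrite sE // nE.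
elim: s sprim {sE} => [|g s IHs] sprim.
  by exists (fun=> 0%N) => G Phi _; rewrite big_nil big1.
have [|n nE] := IHs; first by move=> h hs; apply: sprim; rewrite inE hs orbT.
have gprim : primitive g by apply: sprim; rewrite mem_head.
have [_ _ Prep] := P_pim; have [i iso] := Prep _ (primitive_pim gprim).
have [gi [ki [eprim gen]]] := eP i.
have [a [b [abE baE]]] := generated_conjugate gen gprim iso.
exists (fun j => (i == j) + n j)%N => G Phi PhiC.
rewrite big_cons nE //; under [RHS]eq_bigr do rewrite mulrnDr.
rewrite big_split; congr (_ + _) => /=.
rewrite (bigD1 i) //= eqxx big1 ?addr0 => [|j]; last first.
  by rewrite eq_sym => /negPf ->.
have [[gg _ _] [ee _ _]] := (gprim, eprim).
by rewrite mulr1n -abE PhiC ?abE ?baE.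
Qed.

End Representatives.
End IdempotentClasses.

(** * Multiplicities and the Cartan matrix *)

Section LinearConstructors.
Variables (R : pzRingType) (V W : lmodType R).

Definition linear_of (f : V -> W) (fL : linear f) : {linear V -> W} :=
  HB.pack f (GRing.isLinear.Build R V W *:%R f fL).

End LinearConstructors.

Section Isomorphisms.
Variables (R : pzRingType) (V W : lmodType R).

Lemma isomorphic_sym : isomorphic V W -> isomorphic W V.
Proof.
move=> [f [g fK gK]].
have gL : linear g by move=> a x y; apply: (can_inj fK); rewrite linearP /= !gK.
by exists (linear_of gL), f.
Qed.

Lemma quotient_isomorphic (U : submodClosed V) (f : {linear V -> W}) :
  (forall x, x \in U <-> f x = 0) -> (forall w, exists x, f x = w) ->
  isomorphic (quotient_module U) W.
Proof.
move=> Uf fsurj.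
pose h (x : quotient_module U) : W := f (repr (x : Quotient.quot (submod_zmod U))).
have hpi x : h (quotient_pi U x) = f x.
  apply/eqP; rewrite -subr_eq0 /h -linearB; apply/eqP/Uf.
  by rewrite -quotient_pi_eq0 raddfB /= quotient_piK subrr.
have hL : linear h.
  move=> a x y; rewrite -[x]quotient_piK -[y]quotient_piK.
  by rewrite -linearP !hpi linearP.
have hinj : injective h.
  move=> x y; rewrite -[x]quotient_piK -[y]quotient_piK !hpi => xy.
  apply/eqP; rewrite -subr_eq0 -raddfB quotient_pi_eq0; apply/Uf.
  by rewrite linearB xy subrr.
have [g gK] := choice fsurj.
exists (linear_of hL); exists (fun w => quotient_pi U (g w)) => [x|w] /=.
  by apply: hinj; rewrite hpi gK.
by rewrite hpi gK.
Qed.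

End Isomorphisms.

(** * The exact functor [V |-> e V] *)

Section FixedSpace.
Variables (K : fieldType) (M : finMonoidType).
Local Notation A := (monoid_algebra K M).
Implicit Types (V P S W Q : lmodType A) (e f : A).

Lemma linear_restrict_comb V W (f : {linear V -> W}) d
    (g : 'I_d -> restrict V) a :
  f (comb g a) = comb (fun i => f (g i) : restrict W) a.
Proof.
rewrite /comb (linear_sum f); apply: eq_bigr => i _.
by rewrite -[LHS]/(f ((a 0 i)%:A *: (g i : V))) linearZ.
Qed.

(** For idempotent [e] the space is [e U], that is [Hom(A e, U)]: a subspace over [K], not a
    submodule. *)
Definition fixed_dim V (U : submodClosed V) e d : Prop :=
  subspace_dim (fun v : restrict V => (v : V) \in U /\ e *: (v : V) = v) d.

Definition full_sub V : submodClosed V :=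
  @submodule_of A V (fun=> True) I (fun _ _ _ _ _ => I).

Lemma full_subP V : full_submodule (full_sub V).
Proof. by move=> x; apply/submodule_ofP. Qed.

Lemma scale_algC V (c : K) e (x : V) : e *: (c%:A *: x) = c%:A *: (e *: x).
Proof. by rewrite !scalerA -scalerAr -scalerAl mulr1 mul1r. Qed.

Lemma fixed_subspace V (U : submodClosed V) e :
  subspace (fun v : restrict V => (v : V) \in U /\ e *: (v : V) = v).
Proof.
split=> [|c x y [xU xe] [yU ye]]; first by rewrite rpred0 scaler0.
split; first exact: (restrict_subspace U).2.
by rewrite -[LHS]/(e *: (c%:A *: (x : V) + (y : V))) scalerDr scale_algC xe ye.
Qed.

Lemma fixed_dim_uniq V (U : submodClosed V) e d d' :
  fixed_dim U e d -> fixed_dim U e d' -> d = d'.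
Proof. by apply: subspace_dim_uniq; apply: fixed_subspace. Qed.

Lemma fixed_dim_exists V (U : submodClosed V) e : finite_dimensional V ->
  exists d, fixed_dim U e d.
Proof.
move=> [m [g gP]].
by have [d _] := subspace_dim_exists (fixed_subspace U e) gP; exists d.
Qed.

Lemma fixed_dim_full V (U : submodClosed V) e d : full_submodule U ->
  fixed_dim (full_sub V) e d <-> fixed_dim U e d.
Proof.
move=> Uf; split; apply: subspace_dim_ext => w; split=> -[_ we]; split=> //;
  by [exact: full_subP|exact: Uf].
Qed.

Lemma fixed_dim_iso V W e d : isomorphic V W ->
  fixed_dim (full_sub V) e d -> fixed_dim (full_sub W) e d.
Proof.
move=> [f [g fK gK]] [b [be bP]]; exists (fun i => f (b i)); split=> [i|w [_ we]].
  by split; [exact: full_subP|rewrite -linearZ (be i).2].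
have [|a [gE aP]] := bP (g w).
  by split; [exact: full_subP|apply: (can_inj fK); rewrite linearZ /= gK].
exists a; split=> [|a' wE]; first by rewrite -linear_restrict_comb -gE gK.
by apply: aP; apply: (can_inj fK); rewrite gK wE linear_restrict_comb.
Qed.

(** A basis of [e U] is completed to one of [e U'] by lifts of a basis of [e Q]. *)
Lemma fixed_dim_exact V (U U' : submodClosed V) Q
    (q : {linear submodule U' -> Q}) e d d' :
  idempotent e -> {subset U <= U'} -> (forall y, exists x, q x = y) ->
  (forall x, q x = 0 <-> val x \in U) ->
  fixed_dim U e d -> fixed_dim (full_sub Q) e d' -> fixed_dim U' e (d + d').
Proof.
move=> ee UU' qsurj qU [b [be bP]] [c [ce cP]].
have [x xP] := choice (fun j => qsurj (c j)).
(* Multiplying the lift by [e] makes it fixed and keeps its image, since [c j] is fixed. *)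
pose z j : restrict (submodule U') := e *: x j.
have ez j : e *: (z j : submodule U') = z j by rewrite scalerA ee.
have qz j : q (z j) = c j by rewrite /z linearZ /= xP (ce j).2.
pose y j : restrict V := val (z j : submodule U').
pose w (i : 'I_(d + d')) := match split i with inl j => b j | inr j => y j end.
have wE a : comb w a = comb b (lsubmx a) + comb y (rsubmx a).
  rewrite /comb big_split_ord; congr (_ + _); apply: eq_bigr => j _.
    by rewrite mxE /w -[lshift _ _]/(unsplit (inl j)) unsplitK.
  by rewrite mxE /w -[rshift _ _]/(unsplit (inr j)) unsplitK.
have yE a : comb y a = val (comb z a : submodule U').
  by rewrite (linear_restrict_comb val).
have qE a : q (comb z a) = comb c a.
  rewrite linear_restrict_comb /comb; apply: eq_bigr => i _.
  by rewrite qz.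
have fixB (u v : V) : e *: u = u -> e *: v = v -> e *: (u - v) = u - v.
  by move=> eu ev; rewrite scalerBr eu ev.
have yfix a : e *: (comb y a : V) = comb y a.
  suff yU i : (y i : V) \in U' /\ e *: (y i : V) = y i.
    exact: (subspace_comb a (fixed_subspace U' e) yU).2.
  by split; [exact: valP|rewrite /y -linearZ ez].
exists w; split=> [i|v [vU' ve]].
  rewrite /w; case: split => j.
    by have [bU bje] := be j; split=> //; apply: UU'.
  by split; [exact: valP|rewrite /y -linearZ ez].
pose v' : submodule U' := Submodule vU'.
have ev' : e *: v' = v' by apply: val_inj; rewrite linearZ.
have [|a2 [qv a2P]] := cP (q v').
  by split; [exact: full_subP|rewrite -linearZ ev'].
have dU : (v : V) - comb y a2 \in U.
  have /qU : q (v' - comb z a2) = 0 by rewrite linearB /= qE -qv subrr.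
  by rewrite linearB /= yE.
have [|a1 [dE a1P]] := bP ((v : V) - comb y a2).
  by split=> //; apply: fixB.
exists (row_mx a1 a2); split=> [|a].
  by rewrite wE row_mxKl row_mxKr -dE -[_ + _]/((v : V) - _ + _) subrK.
rewrite wE => vE.
have b1U : (comb b (lsubmx a) : V) \in U.
  exact: (subspace_comb _ (fixed_subspace U e) be).1.
have a2E : rsubmx a = a2.
  apply/esym/a2P; rewrite -qE; apply/eqP; rewrite -subr_eq0 -linearB; apply/eqP/qU.
  rewrite linearB /= -yE vE.
  by rewrite -[X in X \in U]/(comb b (lsubmx a) + comb y (rsubmx a) - comb y (rsubmx a)) addrK.
rewrite -[RHS]hsubmxK a2E; congr (row_mx _ _); apply: a1P.
by rewrite vE a2E -[LHS]/(comb b (lsubmx a) + comb y a2 - comb y a2) addrK.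
Qed.

End FixedSpace.

Section Multiplicity.
Variables (K : fieldType) (M : finMonoidType).
Local Notation A := (monoid_algebra K M).
Implicit Types (V P S W Q : lmodType A) (e f : A).

Definition covers V (U U' : submodClosed V) : Prop :=
  [/\ {subset U <= U'}, ~ {subset U' <= U} &
      forall W : submodClosed V, {subset U <= W} -> {subset W <= U'} ->
        {subset W <= U} \/ {subset U' <= W}].

(** Take a submodule of least dimension among those strictly larger than [U]. *)
Lemma cover_exists V (U : submodClosed V) : finite_dimensional V ->
  ~ full_submodule U -> exists U', covers U U'.
Proof.
move=> fV Unf.
pose big (W : submodClosed V) := {subset U <= W} /\ ~ {subset W <= U}.
pose Q d := `[< exists2 W, big W & subspace_dim (fun v : restrict V => (v : V) \in W) d >].
have Q0 : exists d, Q d.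
  have [d dP] := submodule_dim (full_sub V) fV; exists d; apply/asboolP.
  exists (full_sub V) => //; split=> [x _|sU]; first exact: full_subP.
  by apply: Unf => x; apply/sU/full_subP.
case: (ex_minnP Q0) => d /asboolP[U' [UU' U'U] dU'] dmin.
exists U'; split=> // W UW WU'.
have [WU|nWU] := pselect ({subset W <= U}); [by left|right=> x xU'].
apply: contrapT => xW; have [d' dW] := submodule_dim W fV.
have : Q d' by apply/asboolP; exists W.
move/dmin; rewrite leqNgt => /negP; apply.
exact: (subspace_dim_lt (restrict_subspace W) WU' xU' _ dW dU').
Qed.

Lemma covers_simple V (U U' : submodClosed V) :
  covers U U' -> simple_module (subquotient U' U).
Proof.
move=> [UU' U'U cov]; pose sU : submodClosed (submodule U') := @submodule_restrict A V U' U.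
have sUE (x : submodule U') : (x \in sU) = (val x \in U) by [].
split.
  have [x xU' xU] : exists2 x, x \in U' & x \notin U.
    apply: contrapT => nx; apply: U'U => x xU'; apply: contrapT => /negP xU.
    by apply: nx; exists x.
  exists (quotient_pi sU (Submodule xU')).
  by rewrite quotient_pi_eq0.
move=> X.
pose pi : {linear submodule U' -> subquotient U' U} := quotient_pi sU.
pose Y v := exists2 x : submodule U', val x = v & pi x \in X.
have Y0 : Y 0 by exists 0; rewrite linear0 ?rpred0.
have YL a u v : Y u -> Y v -> Y (a *: u + v).
  move=> [x <- xX] [y <- yX]; exists (a *: x + y); rewrite linearP //.
  by rewrite rpredD ?rpredZ.
have UY : {subset U <= submodule_of Y0 YL}.
  move=> v vU; apply/submodule_ofP; exists (Submodule (UU' v vU)) => //.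
  have -> : pi (Submodule (UU' v vU)) = 0; last exact: rpred0.
  by apply/eqP; rewrite quotient_pi_eq0.
have YU' : {subset submodule_of Y0 YL <= U'}.
  by move=> v /submodule_ofP[x <- _]; apply: valP.
case: (cov _ UY YU') => [YU|U'Y]; [left|right] => z.
  rewrite -[z]quotient_piK => zX; apply/eqP; rewrite quotient_pi_eq0 sUE.
  by apply/YU/submodule_ofP; eexists; last exact: zX.
rewrite -[z]quotient_piK; set x := repr _.
have /submodule_ofP[y /val_inj -> //] := U'Y _ (valP x).
Qed.

Lemma composition_series_exists V : finite_dimensional V ->
  exists n U, @composition_series A V n U.
Proof.
move=> fV.
have step (U : submodClosed V) :
    (* Above the full submodule the successor is arbitrary: the chain is indexed by all of [nat] and
       cut at its first full term. *)
    exists U' : submodClosed V, full_submodule U \/ covers U U'.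
  have [Uf|Unf] := pselect (full_submodule U); first by exists U; left.
  by have [U' cU'] := cover_exists fV Unf; exists U'; right.
have [next nextP] := choice step.
pose U t := iter t next (zero_sub V).
have [m mP] := submodule_dim_le fV.
(* Until the chain is full each step raises the dimension, so the bound [m] forces a full term
   before [m.+1]. *)
have grow t : (exists2 s, (s < t)%N & full_submodule (U s)) \/
    forall d, subspace_dim (fun v : restrict V => (v : V) \in U t) d -> (t <= d)%N.
  elim: t => [|t [[s st sf]|IHt]]; first by right.
    by left; exists s => //; apply: leqW.
  case: (nextP (U t)) => [Uf|[UU' U'U _]]; first by left; exists t.
  right=> d dU'; have [d0 d0U] := submodule_dim (U t) fV.
  have [x xU' xU] : exists2 x, x \in U t.+1 & x \notin U t.
    apply: contrapT => nx; apply: U'U => x xU'; apply: contrapT => /negP xU.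
    by apply: nx; exists x.
  apply: leq_ltn_trans (IHt _ d0U) _.
  exact: (subspace_dim_lt (restrict_subspace (U t)) UU' xU' (negP xU) d0U dU').
have ex_full : exists t, `[< full_submodule (U t) >].
  case: (grow m.+1) => [[s _ sf]|H]; first by exists s; apply/asboolP.
  have [d dU] := submodule_dim (U m.+1) fV.
  by have := leq_trans (H _ dU) (mP _ _ dU); rewrite ltnn.
case: (ex_minnP ex_full) => n /asboolP nf nmin; exists n, U; split=> //.
  by move=> x /zero_subP.
move=> i lt_in; have nfi : ~ full_submodule (U i).
  by move/asboolP/nmin; rewrite leqNgt lt_in.
case: (nextP (U i)) => [//|cov]; split; first by case: cov.
exact: covers_simple.
Qed.

Lemma simple_cyclic S (t : S) : simple_module S -> t <> 0 ->
  forall v, exists a : A, a *: t = v.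
Proof.
move=> [_ Ssimple] t0; pose Y v := exists a : A, a *: t = v.
have Y0 : Y 0 by exists 0; rewrite scale0r.
have YL a u v : Y u -> Y v -> Y (a *: u + v).
  by move=> [b <-] [c <-]; exists (a * b + c); rewrite scalerDl scalerA.
case: (Ssimple (submodule_of Y0 YL)) => [Yz|Yf v].
  by case: t0; apply: Yz; apply/submodule_ofP; exists 1; rewrite scale1r.
by have /submodule_ofP := Yf v.
Qed.

Lemma maximal_simple V (U : submodClosed V) :
  maximal_submodule U -> simple_module (quotient_module U).
Proof.
move=> [Unf Umax]; split.
  have /existsNP[x /negP xU] := Unf.
  by exists (quotient_pi U x); rewrite quotient_pi_eq0.
move=> X; pose Y v := quotient_pi U v \in X.
have Y0 : Y 0 by rewrite /Y linear0 rpred0.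
have YL a u v : Y u -> Y v -> Y (a *: u + v).
  by rewrite /Y linearP => Yu Yv; rewrite rpredD ?rpredZ.
have UY : {subset U <= submodule_of Y0 YL}.
  move=> v vU; apply/submodule_ofP; rewrite /Y.
  by have /eqP -> : quotient_pi U v == 0; rewrite ?quotient_pi_eq0 ?rpred0.
case: (Umax _ UY) => [YU|Yf]; [left|right] => z; rewrite -[z]quotient_piK.
  move=> zX; apply/eqP; rewrite quotient_pi_eq0.
  by apply/YU/submodule_ofP.
by have /submodule_ofP := Yf (repr (z : Quotient.quot (submod_zmod U))).
Qed.

Lemma quotient_finite_dimensional V (U : submodClosed V) :
  finite_dimensional V -> finite_dimensional (quotient_module U).
Proof.
move=> [m [x xP]].
exists m, (fun i => quotient_pi U (x i) : restrict (quotient_module U)) => w.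
have [a aE] := xP (repr ((w : quotient_module U) : Quotient.quot (submod_zmod U))).
exists a; rewrite -[LHS]quotient_piK [in LHS]aE.
exact: (linear_restrict_comb (quotient_pi U)).
Qed.

Section Generated.
Variables (P : lmodType A) (e : A) (g : P) (kappa : {linear P -> A^o}).
Hypotheses (eprim : primitive e) (gP : generated_by e g kappa).

Lemma generated_finite_dimensional : finite_dimensional P.
Proof.
apply: finitely_generated_dim; exists 1%N, (fun=> g) => v.
by exists (fun=> kappa v); rewrite big_ord1; case: gP.
Qed.

Lemma generated_nonzero : nonzero_module P.
Proof.
exists g; apply/eqP => g0; have [_ _ ke] := gP; have [_ + _] := eprim.
by rewrite -ke g0 linear0.
Qed.

(** Let [beta : P -> S] send [g] to [s]. If [beta x <> 0] for some [x] in a submodule [U], then a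
    suitable [e * c * kappa x] fixes [s], is invertible in the corner, and brings [g] into [U]. So
    [ker beta] contains every proper submodule and is the radical. *)
Lemma simple_top S (s : S) : simple_module S -> s <> 0 -> e *: s = s ->
  isomorphic (top_module P) S.
Proof.
move=> Ssimple s0 es; have [ke kg eE] := gP.
have [ee eg] := generated_idempotent gP.
have gen := simple_cyclic Ssimple.
pose beta : {linear P -> S} := action s \o kappa.
have betaE x : beta x = (kappa x : A) *: s by [].
have bg : beta g = s by rewrite betaE eE.
have proper (U : submodClosed P) : ~ full_submodule U ->
    forall x, x \in U -> beta x = 0.
  move=> Unf x xU; apply: contrapT => bx0; apply: Unf.
  have [c cE] := gen _ bx0 s.
  pose y := e * c * (kappa x : A).
  have ey : e * y = y by rewrite /y !mulrA ee.
  have ye : y * e = y by rewrite /y -mulrA ke.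
  have ys : y *: s = s by rewrite /y -!scalerA -betaE cE es.
  have [z [_ _ zy _]] := corner_unit eprim ey ye ys s0.
  have gU : g \in U.
    by rewrite -eg -zy /y -!scalerA kg !rpredZ.
  by move=> w; rewrite -(kg w) rpredZ.
pose N x := beta x = 0.
have N0 : N 0 by rewrite /N linear0.
have NL a u v : N u -> N v -> N (a *: u + v).
  by rewrite /N linearP => -> ->; rewrite scaler0 addr0.
have Nnf : ~ full_submodule (submodule_of N0 NL).
  by move=> /(_ g)/submodule_ofP; rewrite /N bg.
have Nmax : maximal_submodule (submodule_of N0 NL).
  split=> // W NW; have [Wf|Wnf] := pselect (full_submodule W); [by right|left].
  by move=> x xW; apply/submodule_ofP/(proper W).
apply: (@quotient_isomorphic _ _ _ _ beta) => [x|v].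
  split=> [/asboolP Rx|Nx]; first by have /submodule_ofP := Rx _ Nmax.
  apply/asboolP => U [Unf Umax].
  have UN : {subset U <= submodule_of N0 NL}.
    by move=> y yU; apply/submodule_ofP/(proper U).
  by case: (Umax _ UN) => // NU; apply: NU; apply/submodule_ofP.
have [a <-] := gen _ s0 v; exists (a *: g).
by rewrite -{1}bg -linearZ.
Qed.

Lemma top_fixed_nonzero : exists t : top_module P, t <> 0 /\ e *: t = t.
Proof.
have [ee eg] := generated_idempotent gP; have [ke kg eE] := gP.
exists (quotient_pi _ g); split; last by rewrite -quotient_pi_scale eg.
move/eqP; rewrite quotient_pi_eq0 => /asboolP Rg.
have [U [Unf Umax]] :=
  maximal_submodule_exists generated_finite_dimensional generated_nonzero.
by apply: (Unf) => x; rewrite -(kg x); apply/rpredZ/Rg.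
Qed.

(** [d0] is the dimension of [e (top P)]. By exactness of [e], each factor of a composition series
    of [Q] contributes [d0] if it is isomorphic to [top P] and 0 otherwise. The argument applies to
    whichever series [xget] selects. *)
Lemma multiplicity_dim : exists2 d0, (0 < d0)%N &
  forall Q d, finite_dimensional Q -> fixed_dim (full_sub Q) e d ->
    d = (multiplicity (top_module P) Q * d0)%N.
Proof.
have [ee eg] := generated_idempotent gP.
have fT : finite_dimensional (top_module P).
  exact/quotient_finite_dimensional/generated_finite_dimensional.
have [d0 d0P] := fixed_dim_exists (full_sub (top_module P)) e fT.
exists d0.
  have [t [t0 et]] := top_fixed_nonzero.
  have [b [be bP]] := d0P; case: d0 b be bP {d0P} => // b be bP.
  have [|a [tE _]] := bP t; first by split=> //; apply: full_subP.
  by case: t0; rewrite tE /comb big_ord0.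
move=> Q d fQ dQ; rewrite /multiplicity; case: xgetP => [mu _|]; last first.
  have [n [U UP]] := composition_series_exists fQ.
  by move=> H; case: (H _ (ex_intro _ n (ex_intro _ U (conj UP erefl)))).
move=> [n [U [[U0 Un Ustep] ->]]].
pose c i : nat := `[< isomorphic (subquotient (U i.+1) (U i)) (top_module P) >].
suff H t : (t <= n)%N -> fixed_dim (U t) e ((\sum_(i < t) c i) * d0).
  apply: (fixed_dim_uniq dQ).
  exact/(fixed_dim_full _ _ Un)/H.
elim: t => [_|t IHt lt_tn].
  rewrite big_ord0 mul0n; exists (fun=> 0); split=> [[]//|w [/U0 -> _]].
  exists 0; split=> [|a _]; first by rewrite /comb big_ord0.
  by apply/rowP => -[].
have [UU' Ssimple] := Ustep _ lt_tn.
rewrite big_ord_recr /= mulnDl.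
pose sU : submodClosed (submodule (U t.+1)) := @submodule_restrict A Q (U t.+1) (U t).
pose pi : {linear submodule (U t.+1) -> subquotient (U t.+1) (U t)} :=
  quotient_pi sU.
apply: (@fixed_dim_exact _ _ _ _ _ (subquotient (U t.+1) (U t)) pi) => //.
- exact: UU'.
- move=> y.
  exists (repr ((y : quotient_module sU) : Quotient.quot (submod_zmod sU))).
  exact: quotient_piK.
- by move=> x; split=> [/eqP|xU]; [|apply/eqP]; rewrite quotient_pi_eq0.
- exact/IHt/ltnW.
(* By [simple_top], a simple factor with a nonzero vector fixed by [e] is the top of [P]. *)
rewrite /c; case: asboolP => [iso|niso].
  by rewrite mul1n; apply: fixed_dim_iso (isomorphic_sym iso) d0P.
rewrite mul0n; exists (fun=> 0); split=> [[]//|w [_ ew]].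
exists 0; split=> [|a _]; last by apply/rowP => -[].
rewrite /comb big_ord0; apply: contrapT => w0.
exact/niso/isomorphic_sym/(simple_top Ssimple w0).
Qed.

End Generated.
End Multiplicity.

Section CartanMatrix.
Variables (K : fieldType) (M : finMonoidType).
Local Notation A := (monoid_algebra K M).
Implicit Types (e f : A).

(** The rank of [x |-> e x f], which is the dimension of [e A f]. *)
Definition corner_rank e f : nat := \rank (lmul_mx e *m rmul_mx f).

Lemma coord_row_generated_linear (P : lmodType A) (kappa : {linear P -> A^o}) :
  linear (fun x : restrict P => coord_row (kappa x)).
Proof.
move=> c x y; rewrite -linearP; congr coord_row.
rewrite -[LHS]/(kappa (c%:A *: (x : P) + (y : P))) linearP.
by rewrite -[X in X + _]/(c%:A * (kappa x : A)) mulr_algl.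
Qed.

Lemma fixed_dim_generated (P : lmodType A) e f g (kappa : {linear P -> A^o}) :
  idempotent e -> generated_by f g kappa ->
  fixed_dim (full_sub P) e (corner_rank e f).
Proof.
move=> ee gP; have [ff fg] := generated_idempotent gP.
have [kf kg kE] := gP.
pose c : {linear restrict P -> 'rV[K]_#|M|} :=
  linear_of (coord_row_generated_linear kappa).
pose b (i : 'I_#|M|) : restrict P :=
  (e * monoid_basis K (enum_val i) * f) *: g.
have -> : corner_rank e f = \rank (\matrix_i c (b i)).
  congr (\rank _); apply/row_matrixP => i; rewrite rowK /c /b /=.
  rewrite linearZ /= kE -[_ *: _]/(e * monoid_basis K (enum_val i) * f * f).
  rewrite -mulrA ff coord_row_rmul coord_row_lmul coord_row_basis.
  by rewrite -mulmxA -rowE.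
apply: subspace_dim_frame; first exact: fixed_subspace.
  by move=> i; split; [exact: full_subP|rewrite /b scalerA !mulrA ee].
move=> w [_ ew]; rewrite -[LHS](kg w).
have -> : kappa w = e * (kappa w : A) * f :> A.
  by rewrite -mulrA kf -{1}ew linearZ.
rewrite {1}[(kappa w : A)]coord_row_expand mulr_sumr mulr_suml scaler_suml.
apply: eq_bigr => i _.
rewrite -scalerAr -scalerAl -[_ *: (_ * f)]mulr_algl -scalerA.
by [].
Qed.

Variables (r : nat) (P : 'I_r -> lmodType A) (e : 'I_r -> A).
Hypothesis eP : forall i, exists (g : P i) (kappa : {linear P i -> A^o}),
  primitive (e i) /\ generated_by (e i) g kappa.

Lemma cartan_corner_rank : exists d : 'I_r -> nat, forall i, (0 < d i)%N /\
  forall j, corner_rank (e i) (e j)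
            = (multiplicity (top_module (P i)) (P j) * d i)%N.
Proof.
have H i : exists d, (0 < d)%N /\ forall j, corner_rank (e i) (e j)
                        = (multiplicity (top_module (P i)) (P j) * d)%N.
  have [g [kappa [eprim gen]]] := eP i.
  have [d d_gt0 dP] := multiplicity_dim eprim gen; exists d; split=> // j.
  have [g' [kappa' [_ gen']]] := eP j.
  apply: dP; first exact: generated_finite_dimensional gen'.
  by have [ee _ _] := eprim; apply: fixed_dim_generated gen'.
by have [d dP] := choice H; exists d.
Qed.

Lemma cartan_kernel (x : 'cV[int]_r) :
  cartan_matrix P *m x = 0 <->
  forall i, \sum_j (corner_rank (e i) (e j))%:Z * x j 0 = 0.
Proof.
have [d dP] := cartan_corner_rank.
have sumE i : \sum_j (corner_rank (e i) (e j))%:Z * x j 0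
              = (cartan_matrix P *m x) i 0 * (d i)%:Z.
  rewrite mxE mulr_suml; apply: eq_bigr => j _.
  by rewrite mxE (dP i).2 PoszM mulrAC.
split=> [Cx i|H]; first by rewrite sumE Cx mxE mul0r.
apply/colP => i; have := H i; rewrite sumE => /eqP; rewrite mulf_eq0 => /orP[].
  by move/eqP ->; rewrite mxE.
by have [+ _] := dP i; case: (d i).
Qed.

Lemma cartan_nonsingular :
  \det (cartan_matrix P) != 0 <->
  forall x : 'cV[int]_r,
    (forall i, \sum_j (corner_rank (e i) (e j))%:Z * x j 0 = 0) -> x = 0.
Proof.
(* [det0P] produces row vectors while the kernel consists of columns, hence the transposes. *)
rewrite -det_tr; split=> [detC x /cartan_kernel Cx|H].
  apply/eqP/negP => /negP x0; case/negP: detC; apply/det0P; exists x^T.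
    by rewrite -(inj_eq trmx_inj) trmxK trmx0.
  by rewrite -trmx_mul Cx trmx0.
apply/negP => /det0P[v v0 vC]; case/negP: v0.
rewrite -(inj_eq trmx_inj) trmx0; apply/eqP/H/cartan_kernel.
by rewrite -[cartan_matrix P]trmxK -trmx_mul vC trmx0.
Qed.

End CartanMatrix.

(** * Traces, powers and idempotents *)

(** Induction on the size: for [X = C R] of rank below [n], [tr (C R) = tr (R C)], and [R C] is
    smaller and nilpotent because [(R C) ^+ m.+1 = R X ^+ m C]. *)
Lemma trace_nilpotent (K : fieldType) n (X : 'M[K]_n) m :
  X ^+ m = 0 -> \tr X = 0.
Proof.
have [r] := ubnP n; elim: r n X m => // r IHr n X m /ltnSE le_nr Xm.
have [->|X0] := eqVneq X 0; first by rewrite mxtrace0.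
have [n_gt0|] := posnP n.
  by move: X X0 {Xm}; rewrite n_gt0 => X; rewrite [X]flatmx0 eqxx.
move=> n_gt0; have lt_rank : (\rank X < n)%N.
  rewrite ltn_neqAle rank_leq_row andbT; apply/negP => /row_freeP[Y XY].
  have XYm k : X ^+ k *m Y ^+ k = 1%:M.
    elim: k => [|k IHk]; first by rewrite !expr0 mulmx1.
    rewrite exprSr exprS -[_ * X]/(_ *m X) -[Y * _]/(Y *m _) mulmxA.
    by rewrite -(mulmxA _ X) XY mulmx1.
  have := XYm m; rewrite Xm mul0mx => /esym/eqP.
  by rewrite -mxrank_eq0 mxrank1 eqn0Ngt n_gt0.
move: (mulmx_base X); move: (col_base X) (row_base X) lt_rank.
move: (\rank X) => s C R lt_sn CR.
rewrite -CR mxtrace_mulC; apply: (IHr _ _ m.+1); first exact: leq_trans lt_sn le_nr.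
suff -> : (R *m C) ^+ m.+1 = R *m X ^+ m *m C by rewrite Xm mulmx0 mul0mx.
elim: m {Xm} => [|m IHm]; first by rewrite expr1 expr0 mulmx1.
rewrite exprSr IHm [X ^+ m.+1]exprSr -[_ * (R *m C)]/(_ *m (R *m C)).
by rewrite -[_ * X]/(_ *m X) -{3}CR !mulmxA.
Qed.

Section TraceForm.
Variables (R : comNzRingType) (M : finMonoidType) (V : lmodType R) (t : M -> V).
Local Notation RM := (monoid_algebra R M).

(** Used both for trace functions, with scalar values, and for representations, with matrix
    values. *)
Definition linear_extension (f : RM) : V := \sum_m f m *: t m.

Lemma linear_extension_linear : linear linear_extension.
Proof.
move=> c f g; rewrite /linear_extension scaler_sumr -big_split.
by apply: eq_bigr => m _; rewrite !ffunE scalerDl scalerA.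
Qed.

HB.instance Definition _ :=
  GRing.isLinear.Build R RM V *:%R linear_extension linear_extension_linear.

Lemma linear_extension_basis m : linear_extension (monoid_basis R m) = t m.
Proof.
rewrite /linear_extension (bigD1 m) //= ffunE eqxx scale1r big1 ?addr0 // => x.
by move=> /negPf xm; rewrite ffunE xm scale0r.
Qed.

Lemma linear_extensionC :
  (forall x y, t (x * y)%g = t (y * x)%g) ->
  forall f g : RM, linear_extension (f * g) = linear_extension (g * f).
Proof.
move=> tC f g; rewrite /linear_extension !monoid_algebra_lift_mul exchange_big.
by apply: eq_bigr => x _; apply: eq_bigr => y _; rewrite mulrC tC.
Qed.

End TraceForm.

Section CornerRank.
Variables (K : fieldType) (M : finMonoidType).
Local Notation A := (monoid_algebra K M).
Implicit Types (a b e f : A).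

Lemma corner_mx_idempotent e f : idempotent e -> idempotent f ->
  let E := lmul_mx e *m rmul_mx f in E *m E = E.
Proof.
move=> ee ff /=; rewrite mulmxA -(mulmxA (lmul_mx e)) -lmul_rmul_mxC mulmxA.
by rewrite -lmul_mxM ee -mulmxA -rmul_mxM ff.
Qed.

Lemma bitrace_corner_rank e f : idempotent e -> idempotent f ->
  bitrace e f = (corner_rank e f)%:R.
Proof. by move=> ee ff; apply/trace_idempotent_mx/corner_mx_idempotent. Qed.

Lemma corner_rankDl f : idempotent f ->
  additive_on_idempotents (fun e => (corner_rank e f)%:Z).
Proof.
move=> ff g h gg hh gh hg; rewrite /corner_rank linearD mulmxDl -PoszD.
have swap e e' : lmul_mx e *m rmul_mx f *m (lmul_mx e' *m rmul_mx f)
                 = lmul_mx (e' * e) *m rmul_mx f.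
  rewrite mulmxA -(mulmxA (lmul_mx e)) -lmul_rmul_mxC mulmxA -lmul_mxM.
  by rewrite -mulmxA -rmul_mxM ff.
congr Posz; apply: mxrank_orthogonal; rewrite swap ?gg ?hh //.
  by rewrite hg linear0 mul0mx.
by rewrite gh linear0 mul0mx.
Qed.

(** If [x y] is idempotent then [x y = x (y x) y], so each of the two operators factors through the
    other. *)
Lemma corner_rankC f a b : idempotent f ->
  idempotent (a * b) -> idempotent (b * a) ->
  corner_rank (a * b) f = corner_rank (b * a) f.
Proof.
move=> ff.
suff le (x y : A) : idempotent (x * y) ->
    (corner_rank (x * y)%R f <= corner_rank (y * x)%R f)%N.
  by move=> abab baba; apply/eqP; rewrite eqn_leq !le.
move=> xyxy; rewrite /corner_rank.
have -> : lmul_mx (x * y) *m rmul_mx f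
          = lmul_mx y *m (lmul_mx (y * x) *m rmul_mx f) *m lmul_mx x.
  rewrite !mulmxA -lmul_mxM -mulmxA -lmul_rmul_mxC mulmxA -lmul_mxM.
  by rewrite !mulrA -[x * y * x * y]mulrA xyxy.
exact: leq_trans (mxrankM_maxl _ _) (mxrankM_maxr _ _).
Qed.

Lemma lmul_mxX a n : lmul_mx (a ^+ n) = lmul_mx a ^+ n.
Proof.
elim: n => [|n IHn]; first by rewrite !expr0 lmul_mx1.
by rewrite exprSr lmul_mxM IHn [RHS]exprS.
Qed.

(** Left and right multiplications commute, so the operator [x |-> a x b] is itself nilpotent. *)
Lemma bitrace_nilpotent a b n : a ^+ n = 0 -> bitrace a b = 0.
Proof.
move=> an; apply: (@trace_nilpotent _ _ _ n).
rewrite (@exprMn_comm _ (lmul_mx a) (rmul_mx b)); last exact: lmul_rmul_mxC.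
by rewrite -lmul_mxX an linear0 mul0r.
Qed.

End CornerRank.

(** * Powers of monoid elements: group part and [p']-part *)

Section Powers.
Variable M : finMonoidType.
Implicit Type m : M.

Lemma periodP m : (0 < period m)%N /\
  (m ^+ power_index m = m ^+ (power_index m + period m))%g.
Proof. by rewrite /period; case: ex_minnP => s /andP[-> /eqP]. Qed.

Lemma expg_period m a c : (power_index m <= a)%N ->
  (m ^+ (a + period m * c) = m ^+ a)%g.
Proof.
move=> ia; rewrite -(subnKC ia); move: (a - _)%N => b.
have [_ per] := periodP m.
have one k : (m ^+ (power_index m + k + period m) = m ^+ (power_index m + k))%g.
  by rewrite addnAC expgnDr -per -expgnDr.
elim: c => [|c IHc]; first by rewrite muln0 addn0.
by rewrite mulnS addnA addnAC -(addnA _ b) one addnA.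
Qed.

Lemma expg_congr m a c : (power_index m <= a)%N -> (a <= c)%N ->
  (period m %| c - a)%N -> (m ^+ c = m ^+ a)%g.
Proof.
move=> ia ac /dvdnP[k kE]; rewrite -(subnKC ac) kE mulnC.
exact: expg_period.
Qed.

(** The exponent is at least the index, so [m ^+ t] lies in the cyclic group of high powers of [m];
    it is 1 modulo the period, so [m] and [m ^+ t] agree in high powers. *)
Lemma group_part m : exists t, [/\
  (m ^+ t ^+ (period m).+1 = m ^+ t)%g, (0 < t)%N,
  (period m %| t.-1)%N & (power_index m <= t)%N].
Proof.
have [s_gt0 _] := periodP m; exists (period m * power_index m).+1.
have it : (power_index m <= (period m * power_index m).+1)%N.
  by apply: leqW; apply: leq_pmull.
split=> //; last exact: dvdn_mulr.
by move: (_.+1) it => t it; rewrite -expgnA mulnS mulnC expg_period.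
Qed.

(** The [p']-part of [m]: [d] is the prime-to-[p] part of the period, and in characteristic [p] the
    last equation says that [m - m ^+ t] is nilpotent. *)
Lemma p_part p m : prime p -> exists t N d, [/\
  (m ^+ t ^+ d.+1 = m ^+ t)%g, (0 < d)%N, ~~ (p %| d)%N, (d %| period m)%N &
  (m ^+ (p ^ N) = m ^+ t ^+ (p ^ N))%g].
Proof.
move=> p_prime; have [s_gt0 _] := periodP m.
set s := period m in s_gt0 *; set i := power_index m.
pose d := (s`_p^')%N; have d_gt0 : (0 < d)%N := part_gt0 _ _.
have p_d : ~~ (p %| d)%N by rewrite -p'natE // part_pnat.
have pd : coprime p d by rewrite prime_coprime.
have sE : s = (p ^ logn p s * d)%N by rewrite -p_part partnC.
(* The summand [logn p s] lets [p ^ N] absorb the [p]-part of the period, and [i] makes [p ^ N]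
   exceed the index. By Euler [t] is 1 modulo [d], and [p ^ N] divides [t]. *)
pose N := (logn p s + i)%N; pose t := (p ^ (N * totient d))%N.
have pN_t : (p ^ N <= t)%N.
  by rewrite leq_exp2l ?prime_gt1 // leq_pmulr // totient_gt0.
have i_pN : (i <= p ^ N)%N.
  by apply: leq_trans (leq_addl (logn p s) i) (ltnW (ltn_expl _ (prime_gt1 _))).
have t_gt0 : (0 < t)%N by rewrite expn_gt0 prime_gt0.
have td : (d %| t - 1)%N.
  rewrite -eqn_mod_dvd // /t mulnC expnM.
  by rewrite -modnXm Euler_exp_totient // modnXm exp1n.
have st : (p ^ logn p s %| p ^ N)%N by rewrite dvdn_exp2l // leq_addr.
exists t, N, d; split=> //.
- rewrite -expgnA mulnS; apply: expg_congr; first exact: leq_trans pN_t.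
    exact: leq_addr.
  rewrite addKn -/s sE dvdn_mul // (dvdn_trans st) // dvdn_exp2l //.
  by rewrite leq_pmulr // totient_gt0.
- by rewrite -/s sE dvdn_mull.
rewrite -expgnA; apply/esym/expg_congr => //; first exact: leq_pmull.
by rewrite -/s sE -[X in (_ - X)%N]mul1n -mulnBl mulnC dvdn_mul.
Qed.

End Powers.

(** [eps s] is the projector onto the part where [a] acts as [w ^- s]. The powers in it run from 1
    to [d] because the identity of the group generated by [a] is [a ^+ d], which need not be 1. *)
Lemma group_element_expansion (R : comUnitRingType) (B : algType R) (a : B)
    d (w : R) :
  d.-primitive_root w -> d%:R \is a @GRing.unit R -> a ^+ d.+1 = a ->
  (forall i, (0 < i < d)%N -> \sum_(s < d) w ^+ (i * s) = 0) ->
  exists (c : 'I_d -> R) (eps : 'I_d -> B),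
    (forall s, idempotent (eps s)) /\ a = \sum_s c s *: eps s.
Proof.
move=> wP d_unit ad sum0; have d_gt0 := prim_order_gt0 wP.
pose b s := w ^+ s *: a.
have bd s : b s ^+ d.+1 = b s.
  by rewrite /b exprZn ad -exprM mulnS exprD mulnC exprM (prim_expr_order wP) expr1n mulr1.
pose eps s := d%:R^-1 *: \sum_(i < d) b s ^+ i.+1.
have beps s : b s * eps s = eps s.
  rewrite /eps -scalerAr; congr (_ *: _); rewrite mulr_sumr.
  under eq_bigr do rewrite -exprS.
  case: (d) d_gt0 (bd s) => // d' _ bd'; rewrite big_ord_recr big_ord_recl /=.
  by rewrite bd' expr1 addrC.
have bXeps s i : b s ^+ i * eps s = eps s.
  by elim: i => [|i IHi]; rewrite ?mul1r // exprSr -mulrA beps.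
exists (fun s => w ^+ (d.-1 * s)), (fun s => eps s); split=> [s|].
  rewrite /idempotent {1}/eps -scalerAl mulr_suml.
  under eq_bigr do rewrite bXeps.
  rewrite sumr_const card_ord.
  by rewrite -scaler_nat scalerA mulVr // scale1r.
(* The exponent [d + i] is [d.-1] from the coefficient, standing for -1, plus [i.+1] from the power
   of [w ^+ s *: a]; only [i = 0] survives the sum over [s]. *)
transitivity (d%:R^-1 *: \sum_(i < d) (\sum_(s < d) w ^+ ((d + i) * s)) *: a ^+ i.+1).
  rewrite (bigD1 (Ordinal d_gt0)) //= [X in _ + X]big1 => [|i i0].
    under eq_bigr do rewrite addn0 exprM (prim_expr_order wP) expr1n.
    by rewrite sumr_const card_ord addr0 expr1 scalerA mulVr // scale1r.
  rewrite (_ : \sum_(s < d) _ = 0) ?scale0r //.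
  under eq_bigr do rewrite mulnDl exprD exprM (prim_expr_order wP) expr1n mul1r.
  by rewrite sum0 // ltn_ord lt0n andbT.
rewrite scaler_sumr; under eq_bigr do rewrite scaler_suml scaler_sumr.
rewrite exchange_big; apply: eq_bigr => s _ /=.
rewrite /eps scalerA mulrC -scalerA scaler_sumr scaler_sumr.
apply: eq_bigr => i _; congr (_ *: _); rewrite /b exprZn scalerA -!exprM -exprD.
congr (_ ^+ _ *: _); rewrite mulnS [(s * _)%N]mulnC.
rewrite mulnDl addnA; congr (_ + _)%N; move: (s : nat) => k.
by case: (d) d_gt0 => // d' _; rewrite mulSn addnC.
Qed.

(** * Lifting idempotents *)

Section Map.
Variables (R S : comNzRingType) (phi : {rmorphism R -> S}) (M : finMonoidType).
Local Notation RM := (monoid_algebra R M).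
Local Notation SM := (monoid_algebra S M).

Definition map_algebra (a : RM) : SM := [ffun m => phi (a m)].

Fact map_algebra_zmod_morphism : zmod_morphism map_algebra.
Proof. by move=> a b; apply/ffunP => m; rewrite !ffunE rmorphB. Qed.

Fact map_algebra_monoid_morphism : monoid_morphism map_algebra.
Proof.
split=> [|a b]; apply/ffunP => m; rewrite !ffunE ?rmorph_nat // rmorph_sum.
apply: eq_bigr => x _; rewrite rmorph_sum; apply: eq_bigr => y _.
by rewrite rmorphM !ffunE.
Qed.

HB.instance Definition _ :=
  GRing.isZmodMorphism.Build RM SM map_algebra map_algebra_zmod_morphism.
HB.instance Definition _ :=
  GRing.isMonoidMorphism.Build RM SM map_algebra map_algebra_monoid_morphism.

Lemma map_algebraZ c a : map_algebra (c *: a) = phi c *: map_algebra a.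
Proof. by apply/ffunP => m; rewrite !ffunE rmorphM. Qed.

Lemma map_algebra_basis m : map_algebra (monoid_basis R m) = monoid_basis S m.
Proof. by apply/ffunP => x; rewrite !ffunE rmorph_nat. Qed.

Lemma map_coord_row a : map_mx phi (coord_row a) = coord_row (map_algebra a).
Proof. by apply/rowP => i; rewrite !mxE ffunE. Qed.

Lemma map_lmul_mx a : map_mx phi (lmul_mx a) = lmul_mx (map_algebra a).
Proof.
apply/row_matrixP => i; rewrite -map_row !rowK map_coord_row rmorphM /=.
by rewrite map_algebra_basis.
Qed.

Lemma map_rmul_mx a : map_mx phi (rmul_mx a) = rmul_mx (map_algebra a).
Proof.
apply/row_matrixP => i; rewrite -map_row !rowK map_coord_row rmorphM /=.
by rewrite map_algebra_basis.
Qed.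

Lemma map_bitrace a b : phi (bitrace a b) = bitrace (map_algebra a) (map_algebra b).
Proof. by rewrite /bitrace -map_lmul_mx -map_rmul_mx -map_mxM trace_map_mx. Qed.

End Map.

(** [B] need not be commutative, so the identities are proved in [{poly R}] and evaluated at [x]. *)
Lemma newton_identities (R : comNzRingType) (B : algType R) (x : B) :
  let y := x ^+ 2 *+ 3 - x ^+ 3 *+ 2 in
  y - x = (x ^+ 2 - x) * (1 - x *+ 2) /\
  y ^+ 2 - y = (x ^+ 2 - x) ^+ 2 * (x ^+ 2 *+ 4 - x *+ 4 - 3%:R).
Proof.
pose h : {rmorphism {poly R} -> B} := horner_alg x.
have hX : h 'X = x by apply: horner_algX.
pose Y : {poly R} := 'X ^+ 2 *+ 3 - 'X ^+ 3 *+ 2.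
have E1 : Y - 'X = ('X ^+ 2 - 'X) * (1 - 'X *+ 2) by rewrite /Y; ring.
have E2 : Y ^+ 2 - Y = ('X ^+ 2 - 'X) ^+ 2 * ('X ^+ 2 *+ 4 - 'X *+ 4 - 3%:R).
  by rewrite /Y; ring.
have hE : h Y = x ^+ 2 *+ 3 - x ^+ 3 *+ 2.
  by rewrite rmorphB !rmorphMn !rmorphXn /= hX.
clearbody Y; split.
  have := congr1 h E1.
  by rewrite rmorphB rmorphM !rmorphB rmorphMn rmorph1 rmorphXn /= hE hX.
have := congr1 h E2.
by rewrite rmorphB rmorphXn rmorphM rmorphXn !rmorphB !rmorphMn rmorph1
           !rmorphXn /= hE hX.
Qed.

(** * Arithmetic of the valuation ring [O] *)

Section ModularSystem.
Variables (p : nat) (O : idomainType) (F k : fieldType).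
Variables (iota : {rmorphism O -> F}) (red : {rmorphism O -> k}).
Hypothesis p_prime : prime p.
Hypothesis pms : p_modular_system p iota red.
Implicit Types x y : O.

Lemma reduction_unit x : (x \is a GRing.unit) = (red x != 0).
Proof. by rewrite (pms_red_ker pms) negbK. Qed.

(* [principal_ideals] speaks of proper ideals only; the unit ideal is generated
   by [1]. *)
Lemma principal_ideal (I : O -> Prop) : I 0 ->
  (forall a x y, I x -> I y -> I (a * x + y)) ->
  exists a, forall x, I x <-> exists b, x = b * a.
Proof.
move=> I0 IL; have [I1|nI1] := pselect (I 1).
  exists 1 => x; split=> [_|_]; first by exists x; rewrite mulr1.
  by have := IL x 1 0 I1 I0; rewrite addr0 mulr1.
pose S : {pred O} := [pred x | `[< I x >]].
have SP x : (x \in S) = `[< I x >] by [].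
have Sclosed : idealr_closed S.
  split; rewrite ?SP; first exact/asboolP.
    by apply/asboolP.
  by move=> a x y /asboolP Ix /asboolP Iy; apply/asboolP/IL.
pose J : idealr O := HB.pack S (isIdealr.Build O S Sclosed).
have [a aP] := (pms_dvr pms).1 J.
by exists a => x; rewrite -aP; split=> [/asboolP|/asboolP].
Qed.

Lemma natr_eq0_O n : (n%:R == 0 :> O) = (n == 0)%N.
Proof. by move/pcharf0P: (pms_char0 pms). Qed.

Lemma natr_inj_F m n : m%:R = n%:R :> F -> m = n.
Proof.
rewrite -!(rmorph_nat iota) => /(pms_iota_inj pms).
wlog le_mn : m n / (m <= n)%N => [W|].
  by case: (leqP m n) => [/W //|/ltnW/W H /esym/H].
move/eqP; rewrite eq_sym -subr_eq0 -natrB // natr_eq0_O subn_eq0 => le_nm.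
by apply/eqP; rewrite eqn_leq le_mn.
Qed.

(** The generator of the kernel of [red] is nonzero because that kernel contains [p], which is
    nonzero in characteristic 0. *)
Lemma uniformizer : exists2 pi : O, pi != 0 &
  forall x, red x = 0 <-> exists y, x = pi * y.
Proof.
have [||pi piP] := @principal_ideal (fun x => red x = 0); first exact: rmorph0.
  by move=> a x y x0 y0; rewrite rmorphD rmorphM x0 y0 mulr0 addr0.
exists pi => [|x]; last first.
  by rewrite piP; split=> -[b ->]; exists b; rewrite mulrC.
apply/eqP => pi0; have : red p%:R = 0 by rewrite rmorph_nat (pcharf0 (pms_char_p pms)).
case/piP=> b /eqP; rewrite pi0 mulr0 natr_eq0_O => /eqP p0.
by have := prime_gt0 p_prime; rewrite p0.
Qed.

Section Uniformizer.
Variable pi : O.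
Hypotheses (pi_neq0 : pi != 0)
  (piP : forall x, red x = 0 <-> exists y, x = pi * y).

Lemma ideal_powerP n x :
  ideal_power (@maximal_ideal O) n x <-> exists y, x = pi ^+ n * y.
Proof.
have mP z : z \in @maximal_ideal O <-> exists y, z = pi * y.
  by rewrite -(pms_red_ker pms) -piP; split=> /eqP.
split=> [[r [a [f [fm ->]]]]|[y ->]].
  have [g gP] : exists g : 'I_r -> O, forall i, \prod_j f i j = pi ^+ n * g i.
    have H i : exists y, \prod_j f i j = pi ^+ n * y.
      have [h hP] := choice (fun j => (mP _).1 (fm i j)).
      exists (\prod_j h j); under eq_bigr do rewrite hP.
      by rewrite big_split prodr_const card_ord.
    by have [g gP] := choice H; exists g.
  exists (\sum_i a i * g i); rewrite mulr_sumr; apply: eq_bigr => i _.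
  by rewrite gP mulrCA.
exists 1%N, (fun=> y), (fun _ _ => pi); split=> [_ _|].
  by apply/mP; exists 1; rewrite mulr1.
by rewrite big_ord1 prodr_const card_ord mulrC.
Qed.

Lemma pi_nonunit x : pi * x <> 1.
Proof.
move=> px; have : red (pi * x) = 0 by apply/piP; exists x.
by rewrite px rmorph1 => /eqP; rewrite oner_eq0.
Qed.

(** If [x] is nonzero, then [y n = pi * y n.+1] and the ideals generated by the [y n] increase.
    Their union is principal, so some [y n.+1] is a multiple of [y n], and cancelling it makes [pi]
    a unit. *)
Lemma pi_adic_separated x : (forall n, exists y, x = pi ^+ n * y) -> x = 0.
Proof.
move=> H; have [y yP] := choice H; apply/eqP/negP => /negP x0.
have yS n : y n = pi * y n.+1.
  apply: (mulfI (expf_neq0 n pi_neq0)).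
  by rewrite -yP mulrA -exprSr -yP.
have y0 n : y n != 0 by apply: contraNneq x0 => yn; rewrite (yP n) yn mulr0.
have up n i : exists c, y n = c * y (n + i)%N.
  elim: i => [|i [c cE]]; first by exists 1; rewrite addn0 mul1r.
  by exists (c * pi); rewrite cE yS addnS mulrA.
have [||a aP] := @principal_ideal (fun z => exists n c, z = c * y n).
- by exists 0%N, 0; rewrite mul0r.
- move=> b _ _ [n [c ->]] [n' [c' ->]].
  have [d dE] := up n n'; have [d' dE'] := up n' n.
  exists (n + n')%N, (b * (c * d) + c' * d').
  by rewrite dE dE' [(n' + n)%N]addnC mulrDl !mulrA.
have [n [c aE]] := (aP a).2 (ex_intro _ 1 (esym (mul1r a))).
have [|b yE] := (aP (y n.+1)).1; first by exists n.+1, 1; rewrite mul1r.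
apply: (@pi_nonunit (b * c)); apply: (mulIf (y0 n.+1)); rewrite mul1r.
by rewrite {2}yE aE (yS n); ring.
Qed.

End Uniformizer.

(** Divide both by a generator [d] of the ideal they span: the quotients satisfy a Bezout relation,
    so one of them is not in the maximal ideal. *)
Lemma valuation_total x y : (exists c, y = c * x) \/ (exists c, x = c * y).
Proof.
have [->|x0] := eqVneq x 0; first by right; exists 0; rewrite mul0r.
have [||d dP] := @principal_ideal (fun z => exists u v, z = u * x + v * y).
- by exists 0, 0; rewrite !mul0r addr0.
- move=> a _ _ [u [v ->]] [u' [v' ->]].
  by exists (a * u + u'), (a * v + v'); ring.
have [|x' xE] := (dP x).1; first by exists 1, 0; rewrite mul1r mul0r addr0.
have [|y' yE] := (dP y).1; first by exists 0, 1; rewrite mul1r mul0r add0r.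
have [u [v dE]] := (dP d).2 (ex_intro _ 1 (esym (mul1r d))).
have d0 : d != 0 by apply: contraNneq x0 => d0; rewrite xE d0 mulr0.
have uv1 : u * x' + v * y' = 1.
  by apply: (mulIf d0); rewrite mul1r {2}dE xE yE; ring.
have : (x' \is a GRing.unit) || (y' \is a GRing.unit).
  rewrite !reduction_unit; apply/norP => -[]; rewrite !negbK => /eqP rx /eqP ry.
  move/(congr1 red)/eqP: uv1; rewrite rmorphD !rmorphM rx ry !mulr0 addr0 rmorph1.
  by rewrite eq_sym oner_eq0.
case/orP=> U; [left; exists (y' / x')|right; exists (x' / y')].
  by rewrite xE mulrA divrK // -yE.
by rewrite yE mulrA divrK // -xE.
Qed.

(** By [valuation_total], [w] or its inverse [c] comes from [O]; in the second case [w ^+ d = 1]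
    gives [w = c ^+ d.-1]. *)
Lemma primitive_root_lift n d (z : F) : n.-primitive_root z -> (d %| n)%N ->
  exists w : O, d.-primitive_root w.
Proof.
move=> zP dn; set w := z ^+ (n %/ d).
have wP : d.-primitive_root w by apply: dvdn_prim_root.
have d_gt0 := prim_order_gt0 wP.
suff [v vE] : exists v, iota v = w.
  exists v; move: wP; rewrite /primitive_root_of_unity d_gt0 /= => /forallP wP.
  apply/forallP => i; rewrite -(eqP (wP i)) !unity_rootE -vE -rmorphXn.
  by rewrite -[1 in X in _ == X](rmorph1 iota) (inj_eq (pms_iota_inj pms)).
have [a [b [b0 wE]]] := pms_fraction pms w.
have ib0 : iota b != 0 by rewrite -(rmorph0 iota) (inj_eq (pms_iota_inj pms)).
have [[c ac]|[c bc]] := valuation_total b a.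
  by exists c; rewrite wE ac rmorphM mulfK.
have w0 : w != 0.
  by apply/eqP => w0; have /eqP := prim_expr_order wP;
     rewrite w0 expr0n eqn0Ngt d_gt0 /= eq_sym oner_eq0.
have ia0 : iota a != 0.
  by apply: contraNneq w0 => ia0; rewrite wE ia0 mul0r.
have cE : iota c * w = 1.
  by rewrite wE bc rmorphM mulrA -rmorphM -bc divff // bc rmorphM mulf_neq0.
exists (c ^+ d.-1); rewrite rmorphXn.
have cdw : iota c ^+ d.-1 * w ^+ d.-1 = 1 by rewrite -exprMn cE expr1n.
by rewrite -[RHS]mul1r -cdw -mulrA -exprSr prednK // (prim_expr_order wP) mulr1.
Qed.

End ModularSystem.

Section Lifting.
Variables (p : nat) (O : idomainType) (F k : fieldType).
Variables (iota : {rmorphism O -> F}) (red : {rmorphism O -> k}).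
Hypothesis p_prime : prime p.
Hypothesis pms : p_modular_system p iota red.
Variable M : finMonoidType.
Local Notation OM := (monoid_algebra O M).

Let unif := uniformizer p_prime pms.

Section Adic.
Variable pi : O.
Hypotheses (pi_neq0 : pi != 0)
  (piP : forall x, red x = 0 <-> exists y, x = pi * y).

Definition pi_divides n (a : OM) : Prop := exists b, a = pi ^+ n *: b.

Lemma pi_dividesD n a b :
  pi_divides n a -> pi_divides n b -> pi_divides n (a + b).
Proof. by move=> [a' ->] [b' ->]; exists (a' + b'); rewrite scalerDr. Qed.

Lemma pi_dividesN n a : pi_divides n a -> pi_divides n (- a).
Proof. by move=> [a' ->]; exists (- a'); rewrite scalerN. Qed.

Lemma pi_dividesMr n a b : pi_divides n a -> pi_divides n (a * b).
Proof. by move=> [a' ->]; exists (a' * b); rewrite -scalerAl. Qed.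

Lemma pi_dividesMl n a b : pi_divides n b -> pi_divides n (a * b).
Proof. by move=> [b' ->]; exists (a * b'); rewrite -scalerAr. Qed.

Lemma pi_divides_leq m n a : (m <= n)%N -> pi_divides n a -> pi_divides m a.
Proof.
move=> mn [b ->]; exists (pi ^+ (n - m) *: b).
by rewrite scalerA -exprD subnKC.
Qed.

Lemma pi_divides_coef n a :
  pi_divides n a <-> forall m, exists y, a m = pi ^+ n * y.
Proof.
split=> [[b ->] m|H]; first by exists (b m); rewrite ffunE.
have [f fP] := choice H; exists [ffun m => f m].
by apply/ffunP => m; rewrite ffunE ffunE fP.
Qed.

Lemma pi_divides_eq0 a : (forall n, pi_divides n a) -> a = 0.
Proof.
move=> H; apply/ffunP => m; rewrite [RHS]ffunE.
apply: (pi_adic_separated pms pi_neq0 piP) => n.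
exact: (pi_divides_coef n a).1.
Qed.

Lemma reduction_eq0 a : map_algebra red a = 0 <-> pi_divides 1 a.
Proof.
rewrite pi_divides_coef; split=> [a0 m|H].
  by rewrite expr1; apply/piP; move/ffunP/(_ m): a0; rewrite !ffunE.
apply/ffunP => m; rewrite !ffunE; apply/piP.
by have := H m; rewrite expr1.
Qed.

Definition newton (x : OM) : OM := x ^+ 2 *+ 3 - x ^+ 3 *+ 2.

(** The second identity squares the error; of the resulting exponent [2 * n.+1] only [n.+2] is
    recorded. *)
Lemma newton_step n x : pi_divides n.+1 (x ^+ 2 - x) ->
  pi_divides n.+1 (newton x - x) /\
  pi_divides n.+2 (newton x ^+ 2 - newton x).
Proof.
have [-> ->] := newton_identities x => dx; split; first exact: pi_dividesMr.
apply: pi_dividesMr; have [b ->] := dx; rewrite exprZn -exprM.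
by apply: (@pi_divides_leq _ (n.+1 * 2)); [rewrite muln2 -addnn addSn ltnS leq_addl|exists (b ^+ 2)].
Qed.

(** Newton iteration. The limit is taken coefficient by coefficient, and is uniform because [M] is
    finite; separatedness makes it exactly idempotent. *)
Lemma idempotent_lift_adic (x : OM) : pi_divides 1 (x ^+ 2 - x) ->
  exists2 e, idempotent e & pi_divides 1 (e - x).
Proof.
move=> x1; pose u n := iter n newton x.
have u_idem n : pi_divides n.+1 (u n ^+ 2 - u n).
  by elim: n => [|n IHn] //; apply: (newton_step IHn).2.
have u_cauchy i j n : (n <= i)%N -> (i <= j)%N -> pi_divides n.+1 (u j - u i).
  move=> ni /subnKC <-; elim: (j - i)%N => [|d IHd].
    by rewrite addn0 subrr; exists 0; rewrite scaler0.
  have -> : u (i + d.+1)%N - u i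
      = (newton (u (i + d)%N) - u (i + d)%N) + (u (i + d)%N - u i).
    by rewrite subrKA addnS.
  apply: pi_dividesD IHd; apply: (@pi_divides_leq _ (i + d).+1).
    by rewrite ltnS (leq_trans ni) // leq_addr.
  exact: (newton_step (u_idem _)).1.
have lim m : exists l, forall n, exists N, forall i, (N <= i)%N ->
    ideal_power (@maximal_ideal O) n (u i m - l).
  apply: (pms_complete pms) => n; exists n => i j ni nj.
  apply/(ideal_powerP pms piP).
  suff H a b : (n <= a)%N -> (a <= b)%N -> exists y, u b m - u a m = pi ^+ n * y.
    case: (leqP i j) => [ij|/ltnW ji]; last exact: H.
    have [y yE] := H _ _ ni ij; exists (- y).
    by rewrite mulrN -yE opprB.
  move=> na ab; have := u_cauchy _ _ _ na ab.
  move/(pi_divides_leq (leqnSn n))/pi_divides_coef/(_ m).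
  by rewrite !ffunE.
have [l lP] := choice lim.
pose e : OM := [ffun m => l m].
have lim_e n : exists N, forall i, (N <= i)%N -> pi_divides n (u i - e).
  have [N NP] := choice (fun m => lP m n).
  exists (\max_m N m)%N => i Ni; apply/pi_divides_coef => m.
  rewrite !ffunE; apply/(ideal_powerP pms piP)/NP.
  exact: leq_trans (leq_bigmax m) Ni.
exists e.
  apply/eqP; rewrite /idempotent -subr_eq0; apply/eqP/pi_divides_eq0 => n.
  have [N NP] := lim_e n; pose i := maxn N n.
  have -> : e * e - e = (u i ^+ 2 - u i)
      - ((u i - e) * u i + e * (u i - e)) + (u i - e).
    by rewrite mulrBl mulrBr subrKA opprB expr2 [X in _ = X + _]addrC !subrKA.
  have di : pi_divides n (u i - e) by apply: NP; apply: leq_maxl.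
  apply: pi_dividesD (di); apply: pi_dividesD; last first.
    by apply: pi_dividesN; apply: pi_dividesD;
       [apply: pi_dividesMr|apply: pi_dividesMl].
  by apply: pi_divides_leq (u_idem i); apply/leqW/leq_maxr.
have [N NP] := lim_e 1%N.
have -> : e - x = (u N - u 0%N) - (u N - e) by rewrite opprB [RHS]addrC subrKA.
apply: pi_dividesD; last exact/pi_dividesN/NP.
exact: u_cauchy.
Qed.

End Adic.

Lemma idempotent_lift (e : monoid_algebra k M) : idempotent e ->
  exists2 e' : OM, idempotent e' & map_algebra red e' = e.
Proof.
move=> ee; have [pi pi0 piP] := unif.
have [x xP] := choice (fun m => pms_red_surj pms (e m)).
have xE : map_algebra red [ffun m => x m] = e.
  by apply/ffunP => m; rewrite !ffunE.
have [|e' ee' e'x] := @idempotent_lift_adic pi pi0 piP [ffun m => x m].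
  by apply/(reduction_eq0 piP); rewrite rmorphB rmorphXn /= xE expr2 ee subrr.
exists e' => //; move/(reduction_eq0 piP)/eqP: e'x.
by rewrite rmorphB /= xE subr_eq0 => /eqP.
Qed.

(** Matrices [P], [Q] with [P Y Q = 1] lift to [O]; the determinant of the lifted product reduces to
    1, so it is nonzero in [F]. *)
Lemma rank_lower_bound n (X : 'M[O]_n) :
  (\rank (map_mx red X) <= \rank (map_mx iota X))%N.
Proof.
set Y := map_mx red X; pose r := \rank Y.
have [P [Q PYQ]] : exists (P : 'M[k]_(r, n)) (Q : 'M_(n, r)), P *m Y *m Q = 1%:M.
  have [P PC] := row_fullP (col_base_full Y).
  have [Q RQ] := row_freeP (row_base_free Y).
  exists P, Q; rewrite -{1}(mulmx_base Y).
  by move: (row_base Y) (col_base Y) PC RQ => R C PC RQ; rewrite mulmxA PC mul1mx.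
have lift m s (B : 'M[k]_(m, s)) : exists B' : 'M[O]_(m, s), map_mx red B' = B.
  have [f fP] := choice (fun ij : 'I_m * 'I_s => pms_red_surj pms (B ij.1 ij.2)).
  by exists (\matrix_(i, j) f (i, j)); apply/matrixP => i j; rewrite !mxE fP.
have [P' P'E] := lift _ _ P; have [Q' Q'E] := lift _ _ Q.
have detU : iota (\det (P' *m X *m Q')) != 0.
  rewrite -(rmorph0 iota) (inj_eq (pms_iota_inj pms)).
  apply: contraTneq isT => d0; have := congr1 red d0.
  rewrite -det_map_mx !map_mxM P'E Q'E PYQ det1 rmorph0 => /eqP.
  by rewrite oner_eq0.
have full : \rank (map_mx iota (P' *m X *m Q')) = r.
  by apply/mxrank_unit; rewrite unitmxE det_map_mx unitfE.
rewrite -/r -full !map_mxM.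
exact: leq_trans (mxrankM_maxl _ _) (mxrankM_maxr _ _).
Qed.

(** The lower bound also holds for [1 - X], and over both fields the two ranks add up to [n]. *)
Lemma rank_idempotent_reduction n (X : 'M[O]_n) : X *m X = X ->
  \rank (map_mx red X) = \rank (map_mx iota X).
Proof.
move=> XX; apply/eqP; rewrite eqn_leq rank_lower_bound /=.
have sum_rank (K : fieldType) (f : {rmorphism O -> K}) :
    (\rank (map_mx f X) + \rank (map_mx f (1%:M - X)) = n)%N.
  rewrite -mxrank_orthogonal -?map_mxM.
  - by rewrite -map_mxD addrC subrK map_mx1 mxrank1.
  - by rewrite XX.
  - by rewrite mulmxBl mul1mx mulmxBr mulmx1 XX subrr subr0.
  - by rewrite mulmxBr mulmx1 XX subrr map_mx0.
  by rewrite mulmxBl mul1mx XX subrr map_mx0.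
rewrite -(leq_add2r (\rank (map_mx iota (1%:M - X)))) sum_rank.
by rewrite -{1}(sum_rank _ red) leq_add2l rank_lower_bound.
Qed.

(* For idempotents of [O M], the trace of [x |-> e x f] is an integer, namely
   the dimension of the reduction of [e (O M) f]. *)
Lemma bitrace_reduction (e f : OM) : idempotent e -> idempotent f ->
  bitrace e f = (corner_rank (map_algebra red e) (map_algebra red f))%:R.
Proof.
move=> ee ff; apply: (pms_iota_inj pms); rewrite map_bitrace rmorph_nat.
rewrite bitrace_corner_rank; try by rewrite /idempotent -rmorphM ?ee ?ff.
congr (_%:R); rewrite /corner_rank -!map_lmul_mx -!map_rmul_mx -!map_mxM.
apply/esym/rank_idempotent_reduction.
rewrite mulmxA -(mulmxA (lmul_mx e)) -lmul_rmul_mxC mulmxA.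
by rewrite -lmul_mxM ee -mulmxA -rmul_mxM ff.
Qed.

Lemma group_element_lift n d (z : F) (g : M) : n.-primitive_root z ->
  (d %| n)%N -> ~~ (p %| d)%N -> (g ^+ d.+1 = g)%g ->
  exists (c : 'I_d -> O) (eps : 'I_d -> OM),
    (forall s, idempotent (eps s)) /\ monoid_basis O g = \sum_s c s *: eps s.
Proof.
move=> zP dn pd gd; have [w wP] := primitive_root_lift pms zP dn.
apply: (group_element_expansion wP); last 2 first.
- by rewrite -monoid_basisX gd.
- move=> i /andP[i_gt0 lt_id]; apply: (@mulfI _ (w ^+ i - 1)).
    rewrite subr_eq0 -(prim_order_dvd wP).
    by rewrite gtnNdvd.
  under eq_bigr do rewrite exprM.
  by rewrite mulr0 -subrX1 -exprM mulnC exprM (prim_expr_order wP) expr1n subrr.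
rewrite (reduction_unit pms) rmorph_nat.
by rewrite -(dvdn_pcharf (pms_char_p pms)).
Qed.

End Lifting.

(** * Projective modules over O M and their characters *)

Section ProjectiveModule.
Variables (R : comNzRingType) (M : finMonoidType) (I : finType).
Local Notation RM := (monoid_algebra R M).
Variable eps : I -> RM.

Definition fixed_rows : {pred {ffun I -> RM^o}} :=
  [pred v : {ffun I -> RM^o} | [forall i, (v i : RM) * eps i == v i]].

Lemma fixed_rowsP (v : {ffun I -> RM^o}) :
  reflect (forall i, (v i : RM) * eps i = v i) (v \in fixed_rows).
Proof. exact: 'forall_eqP. Qed.

Fact fixed_rows_closed : submod_closed fixed_rows.
Proof.
split=> [|a u v /fixed_rowsP ue /fixed_rowsP ve]; apply/fixed_rowsP => i.
  by rewrite ffunE mul0r.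
by rewrite !ffunE mulrDl ve -[a *: u i]/(a * (u i : RM)) -mulrA ue.
Qed.

HB.instance Definition _ := GRing.isSubmodClosed.Build RM {ffun I -> RM^o}
  fixed_rows (GRing.submod_closed_semi fixed_rows_closed).

(* The direct sum of the left ideals [RM * eps i]. *)
Definition sum_module : lmodType RM := submodule fixed_rows.

Definition entry (v : sum_module) (i : I) : RM := (val v : {ffun I -> RM^o}) i.

Lemma entry_inj u v : entry u =1 entry v -> u = v.
Proof. by move=> uv; apply/val_inj/ffunP. Qed.

Lemma entryP a u v i : entry (a *: u + v) i = a * entry u i + entry v i.
Proof. by rewrite /entry linearP !ffunE. Qed.

Lemma entryZ a u i : entry (a *: u) i = a * entry u i.
Proof. by rewrite /entry linearZ !ffunE. Qed.

Lemma entry_sum (J : Type) (r : seq J) (f : J -> sum_module) i :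
  entry (\sum_(j <- r) f j) i = \sum_(j <- r) entry (f j) i.
Proof.
elim/big_rec2: _ => [|j a b _ <-]; first by rewrite /entry linear0 ffunE.
by rewrite -[f j]scale1r entryP mul1r scale1r.
Qed.

Hypothesis eps_idem : forall i, idempotent (eps i).

Definition row_of (w : I -> RM) : {ffun I -> RM^o} := [ffun i => w i * eps i].

Fact row_of_fixed w : row_of w \in fixed_rows.
Proof. by apply/fixed_rowsP => i; rewrite ffunE -mulrA eps_idem. Qed.

Definition sum_generator (i : I) : sum_module :=
  Submodule (row_of_fixed (fun j => (i == j)%:R)).

Lemma entry_generator i j : entry (sum_generator i) j = (i == j)%:R * eps j.
Proof. by rewrite /entry ffunE. Qed.

Lemma sum_module_expand (v : sum_module) : v = \sum_i entry v i *: sum_generator i.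
Proof.
apply: entry_inj => j; rewrite entry_sum (bigD1 j) //= big1 ?addr0.
  rewrite entryZ entry_generator eqxx mul1r.
  by have /fixed_rowsP/(_ j) := valP v.
by move=> i /negPf ij; rewrite entryZ entry_generator ij mul0r mulr0.
Qed.

Lemma sum_module_finitely_generated : finitely_generated sum_module.
Proof.
exists #|I|, (fun i => sum_generator (enum_val i)) => v.
exists (fun i => entry v (enum_val i)); rewrite {1}[v]sum_module_expand.
rewrite (reindex (@enum_val I I)) //; exact/onW_bij/enum_val_bij.
Qed.

Lemma sum_module_projective : projective sum_module.
Proof.
move=> V W f g fsurj; have [v vP] := choice (fun i => fsurj (g (sum_generator i))).
pose h (x : sum_module) : V := \sum_i entry x i *: v i.
have hL : linear h.
  move=> a x y; rewrite /h scaler_sumr -big_split; apply: eq_bigr => i _.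
  by rewrite entryP scalerDl scalerA.
exists (linear_of hL) => x /=; rewrite linear_sum [in RHS](sum_module_expand x).
by rewrite [RHS]linear_sum; apply: eq_bigr => i _; rewrite !linearZ /= vP.
Qed.

Definition sum_basis (t : I * M) : restrict sum_module :=
  monoid_basis R t.2 *: sum_generator t.1.

Lemma sum_module_span (v : restrict sum_module) :
  v = \sum_t entry v t.1 t.2 *: sum_basis t.
Proof.
rewrite -(pair_bigA _ (fun i m => entry v i m *: sum_basis (i, m))) /=.
rewrite [LHS](sum_module_expand v); apply: eq_bigr => i _.
rewrite {1}[entry v i]monoid_algebra_expand scaler_suml; apply: eq_bigr => m _.
by rewrite -[entry v i m *: _]mulr_algl -scalerA.
Qed.

End ProjectiveModule.

Section SumModuleCharacter.
Variables (F : fieldType) (M : finMonoidType) (I : finType).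
Local Notation FM := (monoid_algebra F M).
Variable eps : I -> FM.
Hypothesis eps_idem : forall i, idempotent (eps i).

(** On the whole algebra [x |-> m x eps_i] has image in [A eps_i] and is the action of [m] there, so
    its trace is the character of that summand. The family [m' eps_i] is only spanning, which is why
    [trace_frame] is used. *)
Lemma sum_module_character m :
  character (sum_module eps) m = \sum_i bitrace (monoid_basis F m) (eps i).
Proof.
pose V := sum_module eps.
have actL : linear (fun v : restrict V => monoid_basis F m *: (v : V) : restrict V).
  move=> c x y; rewrite -[LHS]/(monoid_basis F m *: (c%:A *: (x : V) + (y : V))).
  by rewrite scalerDr scale_algC.
rewrite /character -[trace _]/(trace (linear_of actL)).
pose g (i : 'I_#|{: I * M}|) : restrict V := sum_basis eps_idem (enum_val i).
pose c0 (v : restrict V) : 'rV[F]_#|{: I * M}| :=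
  \row_i entry v (enum_val i).1 (enum_val i).2.
have cL : linear c0.
  move=> c x y; apply/rowP => i; rewrite !mxE.
  rewrite -[X in entry X]/((c%:A : FM) *: (x : V) + (y : V)) entryP.
  by rewrite monoid_algebraD mulr_algl monoid_algebraZ.
rewrite (@trace_frame _ _ _ _ g (linear_of cL)); last first.
  move=> v; rewrite {1}[v](sum_module_span eps_idem).
  exact: (comb_enum (sum_basis eps_idem) (fun t => entry v t.1 t.2)).
pose G (t : I * M) : F := (monoid_basis F m * monoid_basis F t.2 * eps t.1 : FM) t.2.
transitivity (\sum_t G t).
  rewrite /mxtrace [RHS](reindex (@enum_val _ {: I * M})) /=; last exact/onW_bij/enum_val_bij.
  apply: eq_bigr => i _; rewrite !mxE entryZ /G.
  by rewrite entryZ entry_generator eqxx mul1r mulrA.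
rewrite -(pair_bigA _ (fun i x => G (i, x))) /=.
by apply: eq_bigr => i _; rewrite bitraceE.
Qed.

End SumModuleCharacter.

Section ScalarExtension.
Variables (O : comNzRingType) (F : fieldType) (iota : {rmorphism O -> F}).
Variables (M : finMonoidType) (I : finType).
Variable eps : I -> monoid_algebra O M.
Hypothesis eps_idem : forall i, idempotent (eps i).
Let epsF i := map_algebra iota (eps i).
Local Notation P := (sum_module eps).
Local Notation V := (sum_module epsF).

Lemma epsF_idem i : idempotent (epsF i).
Proof. by rewrite /idempotent -rmorphM eps_idem. Qed.

Fact extend_row_fixed (v : P) :
  [ffun i => map_algebra iota (entry v i) : (monoid_algebra F M)^o]
    \in fixed_rows epsF.
Proof.
apply/fixed_rowsP => i; rewrite ffunE -rmorphM.
by congr (map_algebra iota _); have /fixed_rowsP := valP v; apply.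
Qed.

Definition extend_row (v : restrict P) : restrict V :=
  Submodule (extend_row_fixed v) : V.

Lemma entry_extend_row v i :
  entry (extend_row v) i = map_algebra iota (entry v i).
Proof. by rewrite /entry /extend_row /= ffunE. Qed.

Fact extend_row_linear : linear_for (iota \; *:%R) extend_row.
Proof.
move=> a u v; apply: entry_inj => i.
rewrite -[X in entry X i = _]/(extend_row ((a%:A *: (u : P)) + (v : P))).
rewrite -[X in _ = entry X i]/((iota a)%:A *: (extend_row u : V) + (extend_row v : V)).
rewrite entryP !entry_extend_row -entry_extend_row entry_extend_row entryP.
by rewrite rmorphD rmorphM /= map_algebraZ rmorph1.
Qed.

Definition extend_row_lin : {linear restrict P -> restrict V | iota \; *:%R} :=
  HB.pack extend_row (GRing.isLinear.Build O (restrict P) (restrict V)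
    (iota \; *:%R) extend_row extend_row_linear).

Lemma extend_row_generator i :
  extend_row (sum_generator eps_idem i) = sum_generator epsF_idem i.
Proof.
apply: entry_inj => j; rewrite entry_extend_row !entry_generator.
by rewrite rmorphM rmorph_nat.
Qed.

Lemma extend_row_basis m (x : P) :
  extend_row (monoid_basis O m *: x) = monoid_basis F m *: (extend_row x : V).
Proof.
apply: entry_inj => i; rewrite entry_extend_row !entryZ entry_extend_row.
by rewrite rmorphM /= map_algebra_basis.
Qed.

Lemma extend_sum_basis t :
  extend_row (sum_basis eps_idem t) = sum_basis epsF_idem t.
Proof. by rewrite /sum_basis extend_row_basis extend_row_generator. Qed.

Lemma sum_module_extension : is_scalar_extension extend_row_lin.
Proof.
split=> [m x|W g|W h h' hh' v]; first exact: extend_row_basis.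
  pose h (v : restrict V) : W :=
    \sum_t entry v t.1 t.2 *: g (sum_basis eps_idem t).
  have hL : linear h.
    move=> c x y; rewrite /h scaler_sumr -big_split; apply: eq_bigr => t _.
    rewrite -[X in entry X]/((c%:A : monoid_algebra F M) *: (x : V) + (y : V)).
    by rewrite entryP monoid_algebraD mulr_algl monoid_algebraZ scalerDl scalerA.
  exists (linear_of hL) => x /=.
  rewrite [in RHS](sum_module_span eps_idem x) linear_sum.
  apply: eq_bigr => t _; rewrite linearZ /= entry_extend_row.
  by rewrite ffunE.
rewrite [v](sum_module_span epsF_idem) !linear_sum; apply: eq_bigr => t _.
by rewrite !linearZ -extend_sum_basis; congr (_ *: _); apply: hh'.
Qed.

End ScalarExtension.

(** * Separating the projective indecomposables of k M *)

Section MatrixRepresentation.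
Variables (K : fieldType) (M : finMonoidType).
Local Notation A := (monoid_algebra K M).
Implicit Types (V P S : lmodType A).

(** Elements [a] of [e' A e] and [b] of [e A e'] exchange [s] and [s']. As [b a] fixes [s], it is
    invertible in the corner of [e]; correcting [b] to [c] gives [c a = e], and [a c] is a nonzero
    idempotent below [e'], hence [e']. *)
Lemma simple_separates S P P' e e' g g' (kappa : {linear P -> A^o})
    (kappa' : {linear P' -> A^o}) (s s' : S) :
  primitive e -> generated_by e g kappa ->
  primitive e' -> generated_by e' g' kappa' ->
  simple_module S -> s <> 0 -> e *: s = s -> s' <> 0 -> e' *: s' = s' ->
  isomorphic P P'.
Proof.
move=> eprim gP e'prim gP' Ssimple s0 es s'0 es'.
have [ee eg] := generated_idempotent gP; have [ke kg kE] := gP.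
have [ee' eg'] := generated_idempotent gP'; have [ke' kg' kE'] := gP'.
have [a0 a0E] := simple_cyclic Ssimple s0 s'.
have [b0 b0E] := simple_cyclic Ssimple s'0 s.
pose a := e' * a0 * e; pose b := e * b0 * e'.
have as_ : a *: s = s' by rewrite /a -!scalerA es a0E.
have bs' : b *: s' = s by rewrite /b -!scalerA es' b0E.
have e'a : e' * a = a by rewrite /a !mulrA ee'.
have ae : a * e = a by rewrite /a -mulrA ee.
have eb : e * b = b by rewrite /b !mulrA ee.
have be : b * e' = b by rewrite /b -mulrA ee'.
have [||//|//|z [ez ze zba baz]] := @corner_unit _ _ _ s e (b * a) eprim.
- by rewrite mulrA eb.
- by rewrite -mulrA ae.
- by rewrite -scalerA as_.
pose c := z * b.
have ca : c * a = e by rewrite /c -mulrA.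
have ac : a * c = e'.
  have [_ _ e'P] := e'prim; have [||||//] := e'P (a * c).
  - by rewrite /idempotent mulrA -(mulrA a) ca -mulrA /c (mulrA e) ez.
  - by rewrite mulrA e'a.
  - by rewrite -mulrA /c -mulrA be.
  move=> ac0; case: s'0; rewrite -as_ -ae -ca mulrA ac0.
  by rewrite mul0r scale0r.
have ec : e * c = c by rewrite /c mulrA ez.
have ce : c * e' = c by rewrite /c -mulrA be.
have kZ (u v : A) : kappa (u *: (v *: g)) = u * v * e.
  by rewrite scalerA linearZ kE.
have kZ' (u v : A) : kappa' (u *: (v *: g')) = u * v * e'.
  by rewrite scalerA linearZ kE'.
exists (action (c *: g') \o kappa), (action (a *: g) \o kappa') => x;
  rewrite /= /action ?kZ ?kZ'.
  by rewrite -(mulrA _ c) ce scalerA -mulrA ca ke kg.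
by rewrite -(mulrA _ a) ae scalerA -mulrA ac ke' kg'.
Qed.

Definition representation n (rho : M -> 'M[K]_n) : Prop :=
  rho 1%g = 1%:M /\ forall x y, rho (x * y)%g = rho x *m rho y.

Lemma linear_extension_mul n (rho : M -> 'M[K]_n) (a b : A) :
  representation rho ->
  linear_extension rho (a * b) = linear_extension rho a *m linear_extension rho b.
Proof.
move=> [_ rhoM]; rewrite {1}/linear_extension monoid_algebra_lift_mul.
rewrite mulmx_suml; apply: eq_bigr => x _; rewrite mulmx_sumr.
apply: eq_bigr => y _; rewrite rhoM -scalemxAl -scalemxAr scalerA.
by [].
Qed.

Lemma linear_extensionX n (rho : M -> 'M[K]_n) (a : A) i :
  representation rho ->
  linear_extension rho (a ^+ i) = linear_extension rho a ^+ i.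
Proof.
move=> rhoP; elim: i => [|i IHi].
  by rewrite !expr0 -[1]/(monoid_basis K 1%g) linear_extension_basis; case: rhoP.
by rewrite !exprS linear_extension_mul // IHi.
Qed.

(** Coordinates are rows, so the matrices [X] reverse products; their transposes form the
    representation. *)
Lemma module_representation S : finite_dimensional S -> nonzero_module S ->
  exists n (rho : M -> 'M[K]_n), [/\ (0 < n)%N, representation rho &
    forall a : A, (forall v : S, a *: v = 0) -> linear_extension rho a = 0].
Proof.
move=> [m [x xP]] [v0 v0n].
have subT : subspace (fun _ : restrict S => True) by [].
have [n _ [b [_ bP]]] := subspace_dim_exists subT xP.
have b_inj a a' : comb b a = comb b a' -> a = a'.
  move=> aa'; have [c [_ cP]] := bP (comb b a) I.
  by rewrite -(cP a) // (cP a').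
have HX (y : M) : exists X : 'M[K]_n,
    forall j, (monoid_basis K y *: (b j : S) : restrict S) = comb b (row j X).
  by apply: comb_rows => j; have [a [aE _]] := bP (monoid_basis K y *: (b j : S)) I; exists a.
have [X XP] := choice HX.
have actE (a : A) j : (a *: (b j : S) : restrict S)
                      = comb b (row j (\sum_y a y *: X y)).
  rewrite action_expand linear_sum linear_sum; apply: eq_bigr => y _.
  by rewrite XP !linearZ.
have actc y c : (monoid_basis K y *: (comb b c : S) : restrict S) = comb b (c *m X y).
  rewrite -(comb_mulmx c (XP y)) /comb -[LHS]/(_ *: \sum_i _ : S) scaler_sumr.
  by apply: eq_bigr => i _; apply: scale_algC.
exists n, (fun y => (X y)^T); split.
- rewrite lt0n; apply/eqP => n0; case/eqP: v0n.
  have [a [-> _]] := bP v0 I; rewrite /comb big1 // => i.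
  by case: i => i lt_in; exfalso; rewrite n0 in lt_in.
- split=> [|y z]; [rewrite -trmx1|rewrite -trmx_mul]; congr trmx;
    apply/row_matrixP => j; apply: b_inj.
    by rewrite -XP scale1r row1 comb_delta.
  by rewrite -XP -monoid_basisM -scalerA [in LHS]XP actc row_mul.
move=> a a0; have -> : linear_extension (fun y => (X y)^T) a = (\sum_y a y *: X y)^T.
  by rewrite linear_sum; apply: eq_bigr => y _; rewrite linearZ.
rewrite -[RHS]trmx0; congr trmx; apply/row_matrixP => j; apply: b_inj.
by rewrite -actE a0 row0 linear0.
Qed.

End MatrixRepresentation.

(** Induction on the size down to an irreducible factor, whose root is adjoined. *)
Lemma root_extension (K : fieldType) (q : {poly K}) : (1 < size q)%N ->
  exists (L : fieldType) (f : {rmorphism K -> L}) (x : L),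
    root (map_poly f q) x.
Proof.
have [s] := ubnP (size q); elim: s q => // s IHs q /ltnSE qs q1.
have [irr|nirr] := pselect (irreducible_poly q).
  have [L _ [z zP _]] := irredp_FAdjoin irr.
  by exists L, (in_alg L), z.
have [d [d1 dq dNq]] : exists d : {poly K}, [/\ size d != 1%N, d %| q & ~~ (d %= q)].
  apply: contrapT => nd; apply: nirr; split=> // d d1 dq.
  by apply: contrapT => /negP dNq; apply: nd; exists d.
have q0 : q != 0 by rewrite -size_poly_gt0 ltnW.
have d0 : d != 0 by apply: contraNneq q0 => d0; rewrite d0 dvd0p in dq.
have ltdq : (size d < size q)%N.
  rewrite ltn_neqAle dvdp_leq // andbT; apply: contra dNq.
  by rewrite -dvdp_size_eqp.
have [||L [f [x rx]]] := IHs d.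
- exact: leq_trans ltdq qs.
- by rewrite ltn_neqAle eq_sym d1 lt0n size_poly_eq0.
exists L, f, x; move: dq => /dvdpP[c ->].
by rewrite rmorphM rootM rx orbT.
Qed.

(** * A representation over an extension of [k] whose trace does not vanish *)

Section NonzeroCharacter.
Variables (k : fieldType) (M : finMonoidType) (E : monoid_algebra k M -> Prop).

(** [E] will be the set of all [e i] except one. The field varies so that dimension and rank can be
    minimised over all extensions at once. *)
Definition killing_representation (K : fieldType) (f : {rmorphism k -> K}) n
    (rho : M -> 'M[K]_n) : Prop :=
  representation rho /\
  forall a, E a -> linear_extension rho (map_algebra f a) = 0.

Lemma map_linear_extension (K L : fieldType) (f : {rmorphism K -> L}) n
    (rho : M -> 'M[K]_n) (a : monoid_algebra K M) :
  map_mx f (linear_extension rho a)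
    = linear_extension (fun m => map_mx f (rho m)) (map_algebra f a).
Proof.
rewrite /linear_extension map_mx_sum; apply: eq_bigr => m _.
by rewrite map_mxZ ffunE.
Qed.

Lemma killing_representation_map (K L : fieldType) (f : {rmorphism k -> K})
    (h : {rmorphism K -> L}) n (rho : M -> 'M[K]_n) :
  killing_representation f rho ->
  killing_representation (h \o f) (fun m => map_mx h (rho m)).
Proof.
move=> [[rho1 rhoM] rhoE]; split; first split.
- by rewrite rho1 map_mx1.
- by move=> x y; rewrite rhoM map_mxM.
move=> a Ea; have := map_linear_extension h rho (map_algebra f a).
rewrite rhoE // map_mx0 => ->; congr (linear_extension _ _).
by apply/ffunP => m; rewrite !ffunE.
Qed.

Section Minimal.
Variable n : nat.
Hypothesis n_min : forall r (K : fieldType) (f : {rmorphism k -> K})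
  (rho : M -> 'M[K]_r), (0 < r)%N -> killing_representation f rho -> (n <= r)%N.

(** The row space of [B] is the submodule generated by [v]. It carries a killing representation
    [rho'] of dimension [r > 0], so minimality of [n] makes it everything. *)
Lemma minimal_irreducible (K : fieldType) (f : {rmorphism k -> K})
    (rho : M -> 'M[K]_n) (v w : 'rV[K]_n) :
  killing_representation f rho -> v != 0 ->
  exists a : monoid_algebra K M, w = v *m linear_extension rho a.
Proof.
move=> [[rho1 rhoM] rhoE] v0.
pose B : 'M[K]_(#|M|, n) := \matrix_i (v *m rho (enum_val i)).
have rowB m : (v *m rho m <= B)%MS.
  by have := row_sub (enum_rank m) B; rewrite rowK enum_rankK.
set R := row_base B; set r := \rank B.
have RB : (R :=: B)%MS by apply: eq_row_base.
have stab m : (R *m rho m <= R)%MS.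
  rewrite RB (eqmxMr _ RB); apply/row_subP => i.
  by rewrite row_mul rowK -mulmxA -rhoM rowB.
pose rho' m := R *m rho m *m pinvmx R.
have rho'R m : rho' m *m R = R *m rho m by apply: mulmxKpV.
have Rinj := row_free_inj (row_base_free B).
have ext_R a : linear_extension rho' a *m R = R *m linear_extension rho a.
  rewrite /linear_extension mulmx_suml mulmx_sumr; apply: eq_bigr => m _.
  by rewrite -scalemxAl -scalemxAr rho'R.
have r_gt0 : (0 < r)%N.
  rewrite lt0n; apply/eqP => r0; have := mxrankS (rowB 1%g).
  by rewrite rho1 mulmx1 -/r r0 leqn0 mxrank_eq0 (negPf v0).
have le_nr : (n <= r)%N.
  apply: (n_min (f := f) (rho := rho') r_gt0); split; first split.
  - by apply: Rinj; rewrite rho'R rho1 mulmx1 mul1mx.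
  - move=> x y; apply: Rinj.
    by rewrite rho'R rhoM -[RHS]mulmxA (rho'R y) [RHS]mulmxA (rho'R x) mulmxA.
  by move=> a Ea; apply: Rinj; rewrite ext_R rhoE // mulmx0 mul0mx.
have /submxP[D ->] : (w <= B)%MS.
  by apply: submx_full; rewrite /row_full eqn_leq rank_leq_col.
exists [ffun m => D 0 (enum_rank m)].
rewrite mulmx_sum_row /linear_extension mulmx_sumr.
rewrite -(sum_enum_val (fun m => _ *m (_ *: rho m))); apply: eq_bigr => i _.
by rewrite ffunE enum_valK rowK -scalemxAr.
Qed.

Section MinimalRank.
Variable s : nat.
Hypothesis s_min : forall (K : fieldType) (f : {rmorphism k -> K})
  (rho : M -> 'M[K]_n) (a : monoid_algebra K M),
  killing_representation f rho -> linear_extension rho a != 0 ->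
  (s <= \rank (linear_extension rho a))%N.

(* An eigenvector of [T A] on the image of [T] makes [T A T - lambda T] of
   smaller rank than [T], hence zero. *)
Lemma minimal_rank_scalar (K : fieldType) (f : {rmorphism k -> K})
    (rho : M -> 'M[K]_n) (a b : monoid_algebra K M) :
  let T := linear_extension rho a in
  killing_representation f rho -> T != 0 -> \rank T = s ->
  exists (L : fieldType) (h : {rmorphism K -> L}) (x : L),
    map_mx h (T *m linear_extension rho b *m T) = x *: map_mx h T.
Proof.
move=> T rhoP T0 rankT.
have [C [R [CR]]] : exists (C : 'M[K]_(n, s)) (R : 'M_(s, n)), C *m R = T.
  by rewrite -rankT; exists (col_base T), (row_base T); rewrite mulmx_base.
have s_gt0 : (0 < s)%N by rewrite -rankT lt0n mxrank_eq0.
pose X := R *m linear_extension rho b *m C.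
have [|L [h [x rx]]] := @root_extension K (char_poly X).
  by rewrite size_char_poly ltnS.
exists L, h, x; apply/eqP; rewrite -subr_eq0; apply/negP => /negP T'0.
have T'E : map_mx h (T *m linear_extension rho b *m T) - x *: map_mx h T
    = map_mx h C *m (map_mx h X - x%:M) *m map_mx h R.
  rewrite mulmxBr mulmxBl mul_mx_scalar -scalemxAl -!map_mxM CR /X.
  by congr (map_mx h _ - _); rewrite -[in LHS]CR !mulmxA.
pose a' := map_algebra h (a * b * a) - x *: map_algebra h a.
have T'A : map_mx h (T *m linear_extension rho b *m T) - x *: map_mx h T
    = linear_extension (fun m => map_mx h (rho m)) a'.
  rewrite /a' [RHS]linearB [X in _ = _ - X]linearZ /= -!map_linear_extension.
  by have [rhoR _] := rhoP; rewrite !linear_extension_mul.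
have := s_min (killing_representation_map h rhoP) (a := a').
rewrite -T'A => /(_ T'0); rewrite T'E leqNgt => /negP; apply.
apply: leq_ltn_trans (mxrankM_maxl _ _) _; apply: leq_ltn_trans (mxrankM_maxr _ _) _.
rewrite ltn_neqAle rank_leq_row andbT; apply/negP => /row_freeP[Y XY].
have : eigenvalue (map_mx h X) x by rewrite eigenvalue_root_char -map_char_poly.
case/eigenvalueP => v vX; case/negP; apply/eqP.
by rewrite -[v]mulmx1 -XY mulmxA mulmxBr vX mul_mx_scalar subrr mul0mx.
Qed.

End MinimalRank.
End Minimal.

(* The trace of a simple [k M]-module could a priori vanish identically in
   characteristic [p] (through inseparability or a Schur index divisible by [p]);
   choosing the dimension minimal over all extension fields avoids this without
   constructing a splitting field. *)
Lemma nonzero_character n (rho : M -> 'M[k]_n) : (0 < n)%N ->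
  killing_representation idfun rho ->
  exists (K : fieldType) (f : {rmorphism k -> K}) r (tau : M -> 'M[K]_r),
    killing_representation f tau /\ exists m, \tr (tau m) != 0.
Proof.
move=> n_gt0 rhoP.
pose Q1 n := `[< (0 < n)%N /\ exists (K : fieldType) (f : {rmorphism k -> K})
  (rho : M -> 'M[K]_n), killing_representation f rho >].
have Q1n : exists n, Q1 n.
  by exists n; apply/asboolP; split=> //; exists k, idfun, rho.
case: (ex_minnP Q1n) => {n_gt0 rho rhoP Q1n} n.
case/asboolP=> n_gt0 [K0 [f0 [rho0 rho0P]]] Q1min.
have n_min r (K : fieldType) (f : {rmorphism k -> K}) (rho : M -> 'M[K]_r) :
    (0 < r)%N -> killing_representation f rho -> (n <= r)%N.
  move=> r_gt0 rhoP; apply: Q1min; apply/asboolP; split=> //.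
  by exists K, f, rho.
pose Q2 s := `[< exists (K : fieldType) (f : {rmorphism k -> K})
  (rho : M -> 'M[K]_n) (a : monoid_algebra K M),
  [/\ killing_representation f rho, linear_extension rho a != 0 &
      \rank (linear_extension rho a) = s] >].
have Q2n : exists s, Q2 s.
  exists n; apply/asboolP; exists K0, f0, rho0, (monoid_basis K0 1%g).
  rewrite linear_extension_basis; have [[-> _] _] := rho0P; rewrite mxrank1.
  by split=> //; rewrite -mxrank_eq0 mxrank1 -lt0n.
case: (ex_minnP Q2n) => s /asboolP[K [f [rho [a [rhoP T0 rankT]]]]] Q2min.
have s_min (K' : fieldType) (f' : {rmorphism k -> K'}) (rho' : M -> 'M[K']_n)
    (a' : monoid_algebra K' M) :
    killing_representation f' rho' -> linear_extension rho' a' != 0 ->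
    (s <= \rank (linear_extension rho' a'))%N.
  by move=> rho'P a'0; apply: Q2min; apply/asboolP; exists K', f', rho', a'.
exists K, f, n, rho; split=> //.
set T := linear_extension rho a in T0 rankT.
have [i Ti] : exists i, row i T != 0.
  apply/existsP; apply: contra_neqT T0 => /existsPn T0.
  by apply/row_matrixP => i; apply/eqP; rewrite row0; have := T0 i; rewrite negbK.
(* For [b] taking row [i] of [T] to the [j]-th unit vector, row [j] of [T] is row [i] of [T B T], a
   multiple of row [i] of [T] over [L]; inclusion of row spaces descends to [K]. *)
have line j : (row j T <= row i T)%MS.
  have [b bE] := minimal_irreducible n_min (delta_mx 0 j) rhoP Ti.
  have [L [h [x hx]]] := minimal_rank_scalar s_min b rhoP T0 rankT.
  rewrite -(map_submx h); apply/submxP; exists x%:M.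
  rewrite mul_scalar_mx !rowE bE rowE -!mulmxA [in LHS]map_mxM mulmxA hx.
  by rewrite -scalemxAr -map_mxM.
have rank1 : (\rank T <= 1)%N.
  apply: leq_trans (rank_leq_row (row i T)); apply: mxrankS.
  by apply/row_subP => j; apply: line.
have [b bE] := minimal_irreducible n_min (delta_mx 0 i) rhoP Ti.
have [L [h [x hx]]] := minimal_rank_scalar s_min b rhoP T0 rankT.
set B := linear_extension rho b in bE hx.
(* Now [b] takes row [i] of [T] to the [i]-th unit vector, so rows [i] of [T B T] and of [T]
   coincide. *)
have x1 : x = 1.
  have hTi : map_mx h (row i T) != 0 by rewrite map_mx_eq0.
  pose u : 'rV[K]_n := delta_mx 0 i; have uT : u *m T = row i T by rewrite -rowE.
  have : map_mx h u *m map_mx h (T *m B *m T)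
         = map_mx h u *m (x *: map_mx h T) by rewrite hx.
  rewrite -scalemxAr -!map_mxM !mulmxA uT -bE -/u uT => /eqP.
  rewrite eq_sym -subr_eq0 -[X in _ - X]scale1r -scalerBl scaler_eq0.
  by rewrite (negPf hTi) orbF subr_eq0 => /eqP.
have TBT : T *m B *m T = T.
  by apply: (@map_mx_inj _ _ h); rewrite hx x1 scale1r.
have BTBT : B *m T *m (B *m T) = B *m T by rewrite -mulmxA (mulmxA T) TBT.
have rankBT : \rank (B *m T) = 1%N.
  apply/eqP; rewrite eqn_leq (leq_trans (mxrankM_maxr _ _) rank1) /=.
  rewrite lt0n mxrank_eq0; apply: contraNneq T0 => BT0.
  by rewrite -TBT -mulmxA BT0 mulmx0.
(* The rank is exactly 1, so the trace survives in characteristic [p]; and [B T] is a combination of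
   the [rho m]. *)
apply: contrapT => ntr; have : \tr (B *m T) = 1 by rewrite trace_idempotent_mx // rankBT.
rewrite -linear_extension_mul; last by case: rhoP.
rewrite /linear_extension raddf_sum big1 => [/esym/eqP|m _].
  by rewrite oner_eq0.
rewrite /= mxtraceZ; have [->|tr0] := eqVneq (\tr (rho m)) 0; first by rewrite mulr0.
by case: ntr; exists m.
Qed.

End NonzeroCharacter.

Lemma expr_sub_pchar (R : nzRingType) p (x y : R) N : p \in [pchar R] ->
  GRing.comm x y -> (x - y) ^+ (p ^ N) = x ^+ (p ^ N) - y ^+ (p ^ N).
Proof.
move=> pR xy; elim: N => [|N IHN]; first by rewrite !expr1.
rewrite !expnSr !exprM IHN -!(pFrobenius_autE pR) pFrobenius_autB_comm //.
exact/commrX/commr_sym/commrX/commr_sym.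
Qed.

Lemma monoid_algebra_pchar (K : fieldType) (M : finMonoidType) p :
  p \in [pchar K] -> p \in [pchar monoid_algebra K M].
Proof.
move=> pK; rewrite inE (pcharf_prime pK) /=; apply/eqP/ffunP => m.
have -> : p%:R = p%:R *: 1 :> monoid_algebra K M by rewrite scaler_nat.
by rewrite (pcharf0 pK) scale0r.
Qed.

Section SeparatingCharacter.
Variables (p : nat) (O : idomainType) (F k : fieldType).
Variables (iota : {rmorphism O -> F}) (red : {rmorphism O -> k}).
Hypotheses (p_prime : prime p) (pms : p_modular_system p iota red).
Variables (M : finMonoidType) (z : F).
Hypothesis zP : (\big[lcmn/1%N]_(m : M) period m).-primitive_root z.
Variables (r : nat) (P : 'I_r -> lmodType (monoid_algebra k M)).
Variable e : 'I_r -> monoid_algebra k M.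
Hypothesis P_pim : pim_representatives P.
Hypothesis eP : forall i,
  exists (g : P i) (kappa : {linear P i -> (monoid_algebra k M)^o}),
    primitive (e i) /\ generated_by (e i) g kappa.

(** Take a simple quotient of [P i0]; by [simple_separates] no other [e i] acts on it without
    vanishing. *)
Lemma killing_simple i0 : exists n (rho : M -> 'M[k]_n), (0 < n)%N /\
  killing_representation (fun a => exists2 i, i != i0 & a = e i) idfun rho.
Proof.
have [g [kappa [eprim gP]]] := eP i0.
have [ee eg] := generated_idempotent gP; have [_ kg _] := gP.
have fP := generated_finite_dimensional gP.
have [U Umax] := maximal_submodule_exists fP (generated_nonzero eprim gP).
have Ssimple := maximal_simple Umax.
have fS := quotient_finite_dimensional U fP.
have [n [rho [n_gt0 rhoP rhoK]]] := module_representation fS Ssimple.1.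
exists n, rho; split=> //; split=> // a [i ii0 ->].
have -> : map_algebra idfun (e i) = e i by apply/ffunP => m; rewrite ffunE.
apply: rhoK => v; apply: contrapT => v0; case/negP: ii0; apply/eqP.
have [g' [kappa' [e'prim gP']]] := eP i.
have [_ Pinj _] := P_pim; apply/esym/Pinj.
apply: (simple_separates (s := quotient_pi U g) (s' := e i *: v)
  eprim gP e'prim gP' Ssimple) => //.
- move/eqP; rewrite quotient_pi_eq0 => gU; case: Umax => Unf _; apply: Unf => x.
  by rewrite -(kg x) rpredZ.
- by rewrite -quotient_pi_scale eg.
have [ei _ _] := e'prim; by rewrite scalerA ei.
Qed.

(** By Frobenius the [p ^ N]-th power of [m - m ^+ t] is 0, and nilpotent matrices have trace 0. *)
Lemma p_part_character (K : fieldType) n (tau : M -> 'M[K]_n) m t N :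
  p \in [pchar K] -> representation tau ->
  (m ^+ (p ^ N) = m ^+ t ^+ (p ^ N))%g -> \tr (tau m) = \tr (tau (m ^+ t)%g).
Proof.
move=> pK tauP mt; apply/eqP; rewrite -subr_eq0 -raddfB /=; apply/eqP.
apply: (@trace_nilpotent _ _ _ (p ^ N)).
pose a : monoid_algebra K M := monoid_basis K m - monoid_basis K (m ^+ t)%g.
have -> : tau m - tau (m ^+ t)%g = linear_extension tau a.
  by rewrite linearB /= !linear_extension_basis.
rewrite -linear_extensionX // expr_sub_pchar ?monoid_algebra_pchar //.
  by rewrite -!monoid_basisX mt subrr linear0.
by rewrite monoid_basisX; apply: commrX.
Qed.

Definition character_value (K : fieldType) (f : {rmorphism k -> K})
    (ell : M -> K) (a : monoid_algebra k M) : K :=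
  \sum_m f (a m) * ell m.

(* A p'-element of [M] is a combination of idempotents lifting to [O M], so the
   class in the Grothendieck group of some such idempotent has nonzero value. *)
Lemma separating_character i0 :
  exists (K : fieldType) (f : {rmorphism k -> K}) (ell : M -> K),
    [/\ forall x y, ell (x * y)%g = ell (y * x)%g,
        forall i, i != i0 -> character_value f ell (e i) = 0 &
        character_value f ell (e i0) <> 0].
Proof.
have [n [rho [n_gt0 rhoP]]] := killing_simple i0.
have [K [f [s [tau [[tauR tauE] [m trm]]]]]] := nonzero_character n_gt0 rhoP.
exists K, f, (fun x => \tr (tau x)).
set chi := character_value f _.
have pK : p \in [pchar K] by apply: rmorph_pchar (pms_char_p pms).
have chiE a : chi a = \tr (linear_extension tau (map_algebra f a)).
  rewrite /linear_extension. rewrite raddf_sum; apply: eq_bigr => x _ /=.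
  by rewrite mxtraceZ ffunE.
have chi0 i : i != i0 -> chi (e i) = 0.
  by move=> ii0; rewrite chiE tauE ?mxtrace0 //; exists i.
split=> //; first by move=> x y; rewrite !tauR.2 mxtrace_mulC.
have [t [N [d [gd d_gt0 pd dm mt]]]] := p_part m p_prime.
set g := (m ^+ t)%g in gd mt.
have trg : \tr (tau g) != 0 by rewrite -(p_part_character pK tauR mt).
have dn : (d %| \big[lcmn/1%N]_(m : M) period m)%N.
  by apply: dvdn_trans dm _; apply: (@biglcmn_sup _ m).
have [c [eps [eps_idem gE]]] := group_element_lift pms zP dn pd gd.
have trE : \tr (tau g)
    = \sum_(j < d) f (red (c j)) * chi (map_algebra red (eps j)).
  rewrite -(linear_extension_basis tau) -(map_algebra_basis f).
  rewrite -(map_algebra_basis red) gE.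
  have -> : map_algebra f (map_algebra red (\sum_(j < d) c j *: eps j))
      = \sum_(j < d) f (red (c j)) *: map_algebra f (map_algebra red (eps j)).
    rewrite 2!rmorph_sum; apply: eq_bigr => j _.
    by rewrite /= !map_algebraZ.
  rewrite [linear_extension tau _]linear_sum raddf_sum; apply: eq_bigr => j _ /=.
  by rewrite linearZ /= mxtraceZ chiE.
have [j chij] : exists j, chi (map_algebra red (eps j)) != 0.
  apply/existsP; apply: contraNT trg => /existsPn H; rewrite trE big1 // => j _.
  by have := H j; rewrite negbK => /eqP ->; rewrite mulr0.
have ej : idempotent (map_algebra red (eps j)).
  by rewrite /idempotent -rmorphM eps_idem.
have [nu nuE] := idempotent_class P_pim eP ej.
move=> chi_i0; case/eqP: chij; rewrite nuE.
- rewrite big1 // => i _; have [->|ii0] := eqVneq i i0; first by rewrite chi_i0 mul0rn.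
  by rewrite chi0 // mul0rn.
- by move=> a b _ _ _ _; rewrite !chiE rmorphD linearD mxtraceD.
by move=> a b _ _; rewrite !chiE !rmorphM !linear_extension_mul // mxtrace_mulC.
Qed.

End SeparatingCharacter.

(** * Descent on the kernel of the Cartan matrix *)

(** Every power [p ^ d] divides every entry; [d = |x_j|] is already too large for a nonzero
    entry. *)
Lemma integer_descent (p n : nat) (S : 'cV[int]_n -> Prop) : (1 < p)%N ->
  (forall x, S (p%:Z *: x) -> S x) ->
  (forall x, S x -> forall j, (p %| x j 0%R)%Z) ->
  forall x, S x -> x = 0.
Proof.
move=> p1 Sdiv Sp x Sx; apply/colP => j; rewrite mxE.
have H d : forall x, S x -> (p%:Z ^+ d %| x j 0%R)%Z.
  elim: d => [|d IHd] y Sy; first by rewrite expr0 dvd1z.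
  have yE : y = p%:Z *: \col_i (y i 0%R %/ p)%Z.
    apply/colP => i; rewrite !mxE mulrC divzK //.
    exact: Sp.
  have /IHd : S (\col_i (y i 0%R %/ p)%Z) by apply: Sdiv; rewrite -yE.
  by rewrite [in X in _ -> X]yE !mxE exprS => /(dvdz_mul (dvdzz p%:Z)).
apply/eqP; rewrite -absz_eq0; apply/negP => /negP x0.
have := H (absz (x j 0)) x Sx; rewrite dvdzE abszX => /dvdn_leq.
by rewrite lt0n => /(_ x0); rewrite leqNgt ltn_expl.
Qed.

(** On each level set [l] factors out of the sum. [K] need not be finite, so level sets are indexed
    by a chosen representative [c t] in [T]. *)
Lemma sum_level_sets (T : finType) (K : pzRingType) (G l : T -> K) :
  (forall v, \sum_(t | l t == v) G t = 0) -> \sum_t G t * l t = 0.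
Proof.
move=> H; pose c t := odflt t [pick t' | l t' == l t].
have lc t : l (c t) = l t.
  by rewrite /c; case: pickP => [t' /eqP|].
have cE t t' : l t = l t' -> c t = c t'.
  move=> tt'; rewrite /c (@eq_pick _ _ (fun u => l u == l t')); last first.
    by move=> u; rewrite tt'.
  by case: pickP => [//|/(_ t')]; rewrite eqxx.
rewrite (partition_big c xpredT) //= big1 // => t' _.
have [t0 /eqP t0E|nt] := pickP (fun t => c t == t').
  rewrite (eq_bigl (fun t => l t == l t')) => [|t]; last first.
    apply/eqP/eqP => [<-|tt']; first by rewrite lc.
    by rewrite -t0E; apply: cE; rewrite tt' -t0E lc.
  rewrite (eq_bigr (fun t => G t * l t')) => [|t /eqP -> //].
  by rewrite -mulr_suml H mul0r.
by rewrite big_pred0.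
Qed.

(** For the basis element [a] of [m] the difference is [a (1 - a ^+ t.-1)], and [a ^+ power_index m]
    kills the second factor. The successor in the exponent keeps one such factor when the index is
    0. *)
Lemma group_part_nilpotent (R : comNzRingType) (M : finMonoidType) (m : M) t :
  (0 < t)%N -> (period m %| t.-1)%N ->
  (monoid_basis R m - monoid_basis R (m ^+ t)%g) ^+ (power_index m).+1 = 0.
Proof.
move=> t_gt0 /dvdnP[c tE]; set a := monoid_basis R m.
have -> : monoid_basis R (m ^+ t)%g = a * a ^+ t.-1.
  by rewrite monoid_basisX -exprS prednK.
have comm : GRing.comm a (1 - a ^+ t.-1).
  by apply: commrB; [apply: commr1|apply: commrX].
rewrite -{1}[a]mulr1 -mulrBr exprMn_comm // exprS [(1 - _) ^+ _]exprS.
rewrite -mulrA [X in _ * X]mulrA.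
have -> : a ^+ power_index m * (1 - a ^+ t.-1) = 0.
  rewrite mulrBr mulr1 -exprD -!monoid_basisX tE mulnC expg_period //.
  by rewrite subrr.
by rewrite mul0r mulr0.
Qed.

Section MainArgument.
Variables (M : finMonoidType) (p : nat) (O : idomainType) (F k : fieldType).
Variables (iota : {rmorphism O -> F}) (red : {rmorphism O -> k}).
Hypotheses (p_prime : prime p) (pms : p_modular_system p iota red).
Variable z : F.
Hypothesis zP : (\big[lcmn/1%N]_(m : M) period m).-primitive_root z.

Local Notation OM := (monoid_algebra O M).
Local Notation FM := (monoid_algebra F M).
Local Notation kM := (monoid_algebra k M).

Lemma intr_eq0_F (x : int) : x%:~R = 0 :> F -> x = 0.
Proof.
have nat0 n : n%:R = 0 :> F -> n = 0%N.
  by move=> n0; apply: (natr_inj_F pms); rewrite n0.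
case: x => n; first by move/nat0 ->.
by rewrite NegzE mulrNz => /eqP; rewrite oppr_eq0 => /eqP/nat0.
Qed.

Variables (rk : nat) (Pk : 'I_rk -> lmodType kM) (ek : 'I_rk -> kM).
Hypothesis Pk_pim : pim_representatives Pk.
Hypothesis ekP : forall i,
  exists (g : Pk i) (kappa : {linear Pk i -> kM^o}),
    primitive (ek i) /\ generated_by (ek i) g kappa.
Variable eh : 'I_rk -> OM.
Hypotheses (eh_idem : forall j, idempotent (eh j))
  (eh_red : forall j, map_algebra red (eh j) = ek j).

Variable x : 'cV[int]_rk.
Hypothesis x_kernel :
  forall i, \sum_j (corner_rank (ek i) (ek j))%:Z * x j 0 = 0.

Lemma ek_idem i : idempotent (ek i).
Proof. by have [g [kappa [[ee _ _] _]]] := ekP i. Qed.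

(** The rank against [ek j] depends only on the class of [f], which is a combination of the classes
    of the [ek i]. *)
Lemma kernel_idempotent (f : kM) : idempotent f ->
  \sum_j (corner_rank f (ek j))%:Z * x j 0 = 0.
Proof.
move=> ff; have [n nE] := idempotent_class Pk_pim ekP ff.
rewrite (nE _ (fun f => \sum_j (corner_rank f (ek j))%:Z * x j 0)).
- by rewrite big1 // => i _; rewrite x_kernel mul0rn.
- move=> g h gg hh gh hg; rewrite -big_split; apply: eq_bigr => j _ /=.
  by rewrite (corner_rankDl (ek_idem j) gg hh gh hg) mulrDl.
move=> a b abab baba; apply: eq_bigr => j _.
by rewrite (corner_rankC (ek_idem j)).
Qed.

(** The character of the virtual projective module with class [\sum_j x_j [O M e^_j]]. *)
Definition virtual_character (m : M) : O :=
  \sum_j bitrace (monoid_basis O m) (eh j) *~ x j 0.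

Lemma virtual_character_regular m : p_regular p m -> virtual_character m = 0.
Proof.
rewrite /p_regular => pm; have [t [gd t_gt0 dt it]] := group_part m.
set g := (m ^+ t)%g in gd.
(* The comparison is made in [F], since the vanishing of nilpotent traces is proved over fields. *)
have mg j : bitrace (monoid_basis O m) (eh j) = bitrace (monoid_basis O g) (eh j).
  apply: (pms_iota_inj pms); rewrite !map_bitrace !map_algebra_basis.
  rewrite -[X in bitrace X _ = _](subrK (monoid_basis F g)) bitraceDl.
  by rewrite (bitrace_nilpotent _ (group_part_nilpotent F t_gt0 dt)) add0r.
have dn : (period m %| \big[lcmn/1%N]_(m : M) period m)%N.
  exact: (@biglcmn_sup _ m).
have [c [eps [eps_idem gE]]] := group_element_lift pms zP dn pm gd.
have repE s : \sum_j bitrace (eps s) (eh j) *~ x j 0 = 0.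
  have es : idempotent (map_algebra red (eps s)).
    by rewrite /idempotent -rmorphM eps_idem.
  transitivity ((\sum_j (corner_rank (map_algebra red (eps s)) (ek j))%:Z
                   * x j 0)%:~R : O); last by rewrite kernel_idempotent.
  rewrite rmorph_sum; apply: eq_bigr => j _ /=.
  by rewrite (bitrace_reduction pms) // eh_red intrM -mulrzr.
rewrite /virtual_character.
transitivity (\sum_s c s * \sum_j bitrace (eps s) (eh j) *~ x j 0); last first.
  by rewrite big1 // => s _; rewrite repE mulr0.
under [RHS]eq_bigr do rewrite mulr_sumr.
rewrite exchange_big; apply: eq_bigr => j _ /=; rewrite mg gE.
have bitrace_sum (a : 'I_(period m) -> OM) b :
    bitrace (\sum_s a s) b = \sum_s bitrace (a s) b.
  by rewrite /bitrace linear_sum mulmx_suml raddf_sum.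
rewrite bitrace_sum mulrz_suml; apply: eq_bigr => s _.
by rewrite bitraceZl mulrzAr.
Qed.

Definition pos_part (a : int) : nat := if 0 <= a then `|a|%N else 0%N.

Lemma pos_partE a : a = (pos_part a)%:Z - (pos_part (- a))%:Z.
Proof.
rewrite /pos_part Num.Theory.oppr_ge0 abszN.
case: (Num.Theory.ltrgt0P a) => [a0|a0|->]; rewrite ?subr0 ?sub0r ?subrr //.
  by rewrite gtz0_abs.
by rewrite ltz0_abs // opprK.
Qed.

(** The sigma type indexes a direct sum with [n j] copies of the ideal of [eh j]. *)
Lemma multiples_character (n : 'I_rk -> nat) m :
  \sum_(t : {j : 'I_rk & 'I_(n j)})
      bitrace (monoid_basis F m) (map_algebra iota (eh (tag t)))
  = iota (\sum_j bitrace (monoid_basis O m) (eh j) *+ n j).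
Proof.
rewrite rmorph_sum.
rewrite -(sig_big_dep xpredT (fun _ _ => true) (fun j _ =>
  bitrace (monoid_basis F m) (map_algebra iota (eh j)))) /=.
apply: eq_bigr => j _; rewrite sumr_const card_ord rmorphMn /= map_bitrace.
by rewrite map_algebra_basis.
Qed.

Hypothesis character_determined :
  forall P P' : lmodType OM,
    finitely_generated P -> projective P ->
    finitely_generated P' -> projective P' ->
  forall (V V' : lmodType FM)
    (j : {linear restrict P -> restrict V | iota \; *:%R})
    (j' : {linear restrict P' -> restrict V' | iota \; *:%R}),
    is_scalar_extension j -> is_scalar_extension j' ->
    (forall m : M, p_regular p m -> character V m = character V' m) ->
    forall m : M, character V m = character V' m.

(** The hypothesis compares genuine modules, so [x] is split into its positive and negative
    parts. *)
Lemma virtual_character_eq0 m : virtual_character m = 0.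
Proof.
pose n j := pos_part (x j 0); pose n' j := pos_part (- x j 0).
have vE y : virtual_character y
    = \sum_j bitrace (monoid_basis O y) (eh j) *+ n j
      - \sum_j bitrace (monoid_basis O y) (eh j) *+ n' j.
  rewrite -sumrB; apply: eq_bigr => j _.
  by rewrite {1}[x j 0]pos_partE mulrzBr.
pose eps (t : {j : 'I_rk & 'I_(n j)}) := eh (tag t).
pose eps' (t : {j : 'I_rk & 'I_(n' j)}) := eh (tag t).
have eI t : idempotent (eps t) by apply: eh_idem.
have eI' t : idempotent (eps' t) by apply: eh_idem.
have chE y : character (sum_module (fun t => map_algebra iota (eps t))) y
    = iota (\sum_j bitrace (monoid_basis O y) (eh j) *+ n j).
  rewrite sum_module_character ?multiples_character // => t.
  exact: epsF_idem.
have chE' y : character (sum_module (fun t => map_algebra iota (eps' t))) y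
    = iota (\sum_j bitrace (monoid_basis O y) (eh j) *+ n' j).
  rewrite sum_module_character ?multiples_character // => t.
  exact: epsF_idem.
have := character_determined
  (sum_module_finitely_generated eI) (sum_module_projective eI)
  (sum_module_finitely_generated eI') (sum_module_projective eI')
  (sum_module_extension iota eI) (sum_module_extension iota eI').
move=> /(_ _ m); rewrite chE chE' => H.
rewrite vE; apply/eqP; rewrite subr_eq0; apply/eqP/(pms_iota_inj pms)/H.
move=> y /virtual_character_regular; rewrite vE chE chE' => /eqP.
by rewrite subr_eq0 => /eqP ->.
Qed.

End MainArgument.

Section ProjectiveCharacter.
Variables (M : finMonoidType) (F : fieldType).
Local Notation FM := (monoid_algebra F M).
Hypothesis F_char0 : forall x : int, x%:~R = 0 :> F -> x = 0.
Variables (rF : nat) (PF : 'I_rF -> lmodType FM) (eF : 'I_rF -> FM).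
Hypothesis PF_pim : pim_representatives PF.
Hypothesis eFP : forall i,
  exists (g : PF i) (kappa : {linear PF i -> FM^o}),
    primitive (eF i) /\ generated_by (eF i) g kappa.
Hypothesis CF_nonsingular : \det (cartan_matrix PF) != 0.

(* Virtual projective modules with zero character are zero in the Grothendieck
   group of projectives, so every trace function kills their idempotents. *)
Lemma trace_function_eq0 n (f : 'I_n -> FM) (x : 'I_n -> int) (t : M -> F^o) :
  (forall j, idempotent (f j)) ->
  (forall m, \sum_j bitrace (monoid_basis F m) (f j) *~ x j = 0) ->
  (forall u v, t (u * v)%g = t (v * u)%g) ->
  \sum_j linear_extension t (f j) *~ x j = 0.
Proof.
move=> f_idem char0 tC.
have eF_idem i : idempotent (eF i) by have [g [ka [[ee _ _] _]]] := eFP i.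
have [N NE] := choice (fun j => idempotent_class PF_pim eFP (f_idem j)).
pose y : 'cV[int]_rF := \col_l \sum_j (N j l)%:Z * x j.
have expand (Phi : FM -> F) :
    additive_on_idempotents Phi ->
    (forall a b, idempotent (a * b) -> idempotent (b * a) ->
      Phi (a * b) = Phi (b * a)) ->
    \sum_j Phi (f j) *~ x j = \sum_l Phi (eF l) *~ y l 0.
  move=> PhiD PhiC.
  under eq_bigr do rewrite (NE _ _ Phi PhiD PhiC) mulrz_suml.
  rewrite exchange_big; apply: eq_bigr => l _; rewrite mxE mulrz_sumr.
  by apply: eq_bigr => j _; rewrite mulrzA.
(* [y] is the class of the virtual module in terms of the [eF l]. Row [l] of the kernel condition is
   its character extended linearly and evaluated at [eF l], hence 0. *)
have y0 : y = 0.
  apply: (cartan_nonsingular eFP).1 => // l; apply: F_char0.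
  have char_e : \sum_j bitrace (eF l) (f j) *~ x j = 0.
    rewrite (eq_bigr (fun j => \sum_m eF l m * (bitrace (monoid_basis F m) (f j) *~ x j))).
      rewrite exchange_big big1 // => m _.
      by rewrite -mulr_sumr char0 mulr0.
    move=> j _; rewrite {1}[eF l]monoid_algebra_expand /bitrace linear_sum mulmx_suml.
    rewrite raddf_sum mulrz_suml; apply: eq_bigr => m _ /=.
    by rewrite linearZ -scalemxAl mxtraceZ mulrzAr.
  rewrite -[RHS]char_e (expand (bitrace (eF l))).
  - rewrite rmorph_sum; apply: eq_bigr => i _.
    by rewrite bitrace_corner_rank // rmorphM /= mulrzr.
  - by move=> g h _ _ _ _; rewrite bitraceDr.
  by move=> a b _ _; rewrite bitraceMC.
rewrite (expand (linear_extension t)).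
- by rewrite big1 // => l _; rewrite y0 mxE mulr0z.
- by move=> g h _ _ _ _; rewrite linearD.
by move=> a b _ _; apply: (linear_extensionC tC).
Qed.

End ProjectiveCharacter.

Section KernelDivisibility.
Variables (M : finMonoidType) (p : nat) (O : idomainType) (F k : fieldType).
Variables (iota : {rmorphism O -> F}) (red : {rmorphism O -> k}).
Hypotheses (p_prime : prime p) (pms : p_modular_system p iota red).
Variable z : F.
Hypothesis zP : (\big[lcmn/1%N]_(m : M) period m).-primitive_root z.
Variables (rk : nat) (Pk : 'I_rk -> lmodType (monoid_algebra k M)).
Variable ek : 'I_rk -> monoid_algebra k M.
Hypothesis Pk_pim : pim_representatives Pk.
Hypothesis ekP : forall i,
  exists (g : Pk i) (kappa : {linear Pk i -> (monoid_algebra k M)^o}),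
    primitive (ek i) /\ generated_by (ek i) g kappa.
Variable eh : 'I_rk -> monoid_algebra O M.
Hypothesis eh_red : forall j, map_algebra red (eh j) = ek j.

(* The level sets of a trace function on [k M] carry trace functions on [F M],
   whose values on [eh] lie in [O] and can be reduced. *)
Lemma kernel_divisible (x : 'cV[int]_rk) :
  (forall t : M -> F^o, (forall u v, t (u * v)%g = t (v * u)%g) ->
     \sum_j linear_extension t (map_algebra iota (eh j)) *~ x j 0 = 0) ->
  forall i, (p %| x i 0%R)%Z.
Proof.
move=> H i.
have [K [f [ell [ellC ell0 elli]]]] :=
  separating_character p_prime pms zP Pk_pim ekP i.
have pK : p \in [pchar K] by apply: rmorph_pchar (pms_char_p pms).
pose G m := \sum_j f (ek j m) *~ x j 0.
have G0 v : \sum_(m | ell m == v) G m = 0.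
  have : \sum_j (\sum_(m | ell m == v) eh j m) *~ x j 0 = 0.
    apply: (pms_iota_inj pms); rewrite rmorph0 rmorph_sum.
    pose t m : F^o := (ell m == v)%:R.
    have tC u w : t (u * w)%g = t (w * u)%g by rewrite /t ellC.
    rewrite -[RHS](H t tC); apply: eq_bigr => j _; rewrite rmorphMz rmorph_sum.
    congr (_ *~ _); rewrite /linear_extension big_mkcond; apply: eq_bigr => m _.
    rewrite ffunE /t -[_ *: _]/(_ * _).
    by case: eqP => _; rewrite ?mulr1 ?mulr0.
  move/(congr1 (f \o red)); rewrite rmorph0 rmorph_sum => E.
  rewrite -[RHS]E exchange_big; apply: eq_bigr => j _.
  rewrite rmorphMz rmorph_sum mulrz_suml; apply: eq_bigr => m _.
  by rewrite -eh_red ffunE.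
have := sum_level_sets G0.
have -> : \sum_m G m * ell m = \sum_j character_value f ell (ek j) *~ x j 0.
  under eq_bigr do rewrite mulr_suml.
  rewrite exchange_big; apply: eq_bigr => j _; rewrite mulrz_suml.
  by apply: eq_bigr => m _; rewrite mulrzAl.
rewrite (bigD1 i) //= big1 => [|j ji]; last by rewrite ell0 // mul0rz.
move/eqP; rewrite addr0 -mulrzr mulf_eq0 => /orP[/eqP //|].
have natK n : (n%:R == 0 :> K) = (p %| n)%N by rewrite (dvdn_pcharf pK).
by rewrite dvdzE /=; case: (x i 0) => n; rewrite ?NegzE ?mulrNz ?oppr_eq0 natK.
Qed.

End KernelDivisibility.

Theorem proposition5p9 (M : finMonoidType) (p : nat) (O : idomainType)
    (F k : fieldType) (iota : {rmorphism O -> F}) (red : {rmorphism O -> k})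
    (p_prime : prime p)
    (pms : p_modular_system p iota red)
    (root_of_unity :
       exists z : F, (\big[lcmn/1%N]_(m : M) period m).-primitive_root z)
    (rF : nat) (PF : 'I_rF -> lmodType (monoid_algebra F M))
    (PF_pim : pim_representatives PF)
    (CF_nonsingular : \det (cartan_matrix PF) != 0)
    (character_determined :
       forall P P' : lmodType (monoid_algebra O M),
         finitely_generated P -> projective P ->
         finitely_generated P' -> projective P' ->
       forall (V V' : lmodType (monoid_algebra F M))
         (j : {linear restrict P -> restrict V | iota \; *:%R})
         (j' : {linear restrict P' -> restrict V' | iota \; *:%R}),
         is_scalar_extension j -> is_scalar_extension j' ->
         (forall m : M, p_regular p m -> character V m = character V' m) ->
         forall m : M, character V m = character V' m)
    (rk : nat) (Pk : 'I_rk -> lmodType (monoid_algebra k M))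
    (Pk_pim : pim_representatives Pk) :
  \det (cartan_matrix Pk) != 0.
Proof.
have [z zP] := root_of_unity.
have [eF eFP] := choice (fun i => pim_generator (let: And3 H _ _ := PF_pim in H i)).
have [ek ekP] := choice (fun i => pim_generator (let: And3 H _ _ := Pk_pim in H i)).
have lift j : exists e', idempotent e' /\ map_algebra red e' = ek j.
  have [g [kappa [[ee _ _] _]]] := ekP j.
  by have [e' e'e' e'E] := idempotent_lift p_prime pms ee; exists e'.
have [eh ehP] := choice lift.
have eh_idem j := (ehP j).1; have eh_red j := (ehP j).2.
apply/(cartan_nonsingular ekP); apply: (integer_descent (prime_gt1 p_prime)).
  move=> x Hx i; have p0 : p%:Z != 0 by rewrite eqz_nat -lt0n prime_gt0.
  apply: (mulfI p0); rewrite mulr0 -[RHS](Hx i) mulr_sumr.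
  by apply: eq_bigr => j _; rewrite mxE mulrCA.
move=> x Hx; apply: (kernel_divisible p_prime pms zP Pk_pim ekP eh_red).
move=> t tC.
apply: (trace_function_eq0 (intr_eq0_F pms) PF_pim eFP CF_nonsingular) => //.
  by move=> j; rewrite /idempotent -rmorphM eh_idem.
move=> m; have := virtual_character_eq0 pms zP Pk_pim ekP eh_idem eh_red
  Hx character_determined m.
move/(congr1 iota); rewrite /virtual_character rmorph_sum rmorph0 => E; rewrite -[RHS]E.
by apply: eq_bigr => j _; rewrite rmorphMz map_bitrace map_algebra_basis.
Qed.
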